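(* Let $\alpha,\beta_w\in(0,1)$ be constants and let $n\to\infty$ with $m=\alpha n$ and $k=\beta_w n$. Let $A$ be an $m\times n$ matrix with i.i.d. standard normal entries. Fix a set $S\subset\{1,\dots,n\}$ with $|S|=k$ and a sign pattern $\sigma\in\{-1,+1\}^S$, and consider $k$-sparse vectors $\mathbf{x}\in\mathbb{R}^n$ with $\mathbf{x}_i=0$ for $i\notin S$ and whose nonzero entries $\mathbf{x}_i$, $i\in S$, have sign $\sigma_i$. For $\mathbf{y}=A\mathbf{x}$ consider $$\min_{\mathbf{u}}\ \|\mathbf{u}\|_1\quad\text{subject to}\quad A\mathbf{u}=\mathbf{y}.\qquad(\ast)$$ Let $\epsilon_1^{(c)},\epsilon_2^{(c)},\epsilon_1^{(m)},\epsilon_1^{(g)},\epsilon_3^{(g)}>0$ be arbitrarily small constants independent of $n$. (1) Let $\hat\theta_w\in[\beta_w,1]$ be the solution of $$(1-\epsilon_1^{(c)})(1-\beta_w)\frac{\sqrt{2/\pi}\,e^{-(\operatorname{erfinv}(\frac{1-\theta_w}{1-\beta_w}))^2}}{\theta_w}-\sqrt{2}\operatorname{erfinv}\Big((1+\epsilon_1^{(c)})\frac{1-\theta_w}{1-\beta_w}\Big)=0.$$ If $$\alpha>\frac{1-\beta_w}{\sqrt{2\pi}}\left(\sqrt{2\pi}+2\frac{\sqrt{2(\operatorname{erfinv}(\frac{1-\hat\theta_w}{1-\beta_w}))^2}}{e^{(\operatorname{erfinv}(\frac{1-\hat\theta_w}{1-\beta_w}))^2}}-\sqrt{2\pi}\frac{1-\hat\theta_w}{1-\beta_w}\right)+\beta_w-\frac{\left((1-\beta_w)\sqrt{2/\pi}\,e^{-(\operatorname{erfinv}(\frac{1-\hat\theta_w}{1-\beta_w}))^2}\right)^2}{\hat\theta_w},$$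 then with overwhelming probability the solution of $(\ast)$ is the $k$-sparse $\mathbf{x}$. (2) Let $\hat\theta_w\in[\beta_w,1]$ be the solution of $$(1+\epsilon_2^{(c)})(1-\beta_w)\frac{\sqrt{2/\pi}\,e^{-(\operatorname{erfinv}(\frac{1-\theta_w}{1-\beta_w}))^2}}{\theta_w}-\sqrt{2}\operatorname{erfinv}\Big((1-\epsilon_2^{(c)})\frac{1-\theta_w}{1-\beta_w}\Big)=0.$$ If $$\alpha<\frac{1}{(1+\epsilon_1^{(m)})^2}\left((1-\epsilon_1^{(g)})\Big(\hat\theta_w+\frac{2(1-\beta_w)}{\sqrt{2\pi}}\frac{\sqrt{2(\operatorname{erfinv}(\frac{1-\hat\theta_w}{1-\beta_w}))^2}}{e^{(\operatorname{erfinv}(\frac{1-\hat\theta_w}{1-\beta_w}))^2}}\Big)-(1+\epsilon_3^{(g)})^{2}\frac{\left((1-\beta_w)\sqrt{2/\pi}\,e^{-(\operatorname{erfinv}(\frac{1-\hat\theta_w}{1-\beta_w}))^2}\right)^2}{\hat\theta_w}\right),$$ then with overwhelming probability there is a $k$-sparse $\mathbf{x}$ with support in $S$ and sign pattern $\sigma$ that satisfies $A\mathbf{x}=\mathbf{y}$ and is not the solution of $(\ast)$.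
   Context: $\operatorname{erfinv}$ is the inverse of the standard error function $\operatorname{erf}(t)=\frac{2}{\sqrt{\pi}}\int_0^t e^{-s^2}\,ds$. ''With overwhelming probability'' means with probability at least $1-e^{-cn}$ for some constant $c>0$ independent of $n$ (for all large $n$). ''The solution of $(\ast)$ is $\mathbf{x}$'' means $\mathbf{x}$ is the unique minimizer of $(\ast)$. *)

(* Defs.v *)
From HB Require Import structures.
From mathcomp Require Import all_boot all_order all_algebra.
From mathcomp Require Import all_classical all_reals all_analysis.
Set Implicit Arguments. Unset Strict Implicit. Unset Printing Implicit Defensive.
Import Order.TTheory GRing.Theory Num.Theory.
Import numFieldNormedType.Exports.
Local Open Scope classical_set_scope.
Local Open Scope ring_scope.

Section Defs.
Variable R : realType.

Definition erf (t : R) : R :=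
  2 / Num.sqrt pi *
  (if 0 <= t then Rintegral lebesgue_measure `[0, t] (fun s => expR (- s ^+ 2))
   else - Rintegral lebesgue_measure `[t, 0] (fun s => expR (- s ^+ 2))).

(* erfinv y = the (unique, for -1 < y < 1) t with erf t = y;
   an arbitrary default outside the range (never used in the statement,
   whose hypotheses force the arguments into (-1,1)). *)
Definition erfinv (y : R) : R := xget 0 [set t | erf t = y].

Definition l1norm n (u : 'cV[R]_n) : R := \sum_(i < n) `| u i ord0 |.

Definition l1_unique_solution m n (A : 'M[R]_(m, n)) (y : 'cV[R]_m)
    (x : 'cV[R]_n) : Prop :=
  A *m x = y /\ forall u : 'cV[R]_n, A *m u = y -> u <> x -> l1norm x < l1norm u.

(* x is supported exactly on S with sign pattern sigma on S
   (sigma i = false means +1, sigma i = true means -1) *)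
Definition sparse_with_signs n (S : {set 'I_n}) (sigma : 'I_n -> bool)
    (x : 'cV[R]_n) : Prop :=
  (forall i, i \in S -> 0 < (-1) ^+ sigma i * x i ord0) /\
  (forall i, i \notin S -> x i ord0 = 0).

Definition iid_std_normal_matrix d (T : measurableType d)
    (P : probability T R) m n (A : T -> 'M[R]_(m, n)) : Prop :=
  (forall i j, measurable_fun setT (fun w => A w i j)) /\
  (forall i j (B : set R), measurable B ->
      P [set w | B (A w i j)] = normal_prob 0 1 B) /\
  (forall B : 'I_m -> 'I_n -> set R, (forall i j, measurable (B i j)) ->
      P [set w | forall i j, B i j (A w i j)] =
      (\prod_(i < m) \prod_(j < n) P [set w | B i j (A w i j)])%E).

End Defs.

(* Main.v *)
Require Import Defs.
From HB Require Import structures.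
From mathcomp Require Import all_boot all_order all_algebra.
From mathcomp Require Import all_classical all_reals all_analysis.
From mathcomp Require Import measurable_realfun ring lra.
Set Implicit Arguments. Unset Strict Implicit. Unset Printing Implicit Defensive.
Import Order.TTheory GRing.Theory Num.Theory.
Import numFieldNormedType.Exports.
Local Open Scope classical_set_scope.
Local Open Scope ring_scope.

(** The recovery of every [x] with signs [sigma] on [S] is equivalent to the
    null space of [A] meeting the descent cone [C] of the l1 norm only at [0].
    On finite nets of the unit sphere and of [C] cut by the unit sphere, the
    process [p A q + g] is compared with [p g' + q g''] by Gordon's inequality
    for a smoothed min-max functional; it follows by splitting the Gaussian
    interpolation into many small steps and expanding each to second order.

    For part (1) the comparison gives [min_C |A h| > 0] as soon as [|g'|] exceeds
    [max_C (- h g'')], which duality bounds by the distance of [g''] to the scaled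
    subdifferential of the norm.  For part (2) the roles are exchanged: an explicit
    vector of [C] makes [h g''] larger than [|g'|], so that every unit [b] has some
    [h] in [C] with [b A h] bounded below, and minimising a penalised residual over
    [C] produces a nonzero element of the null space.  All norms concentrate by
    Chernoff bounds.  Both conditions on [alpha] are comparisons with the limit of
    the squared distance divided by [n], evaluated at the cutoff [sqrt 2 * E] and
    the multiplier given by the equation for [theta]; that equation only serves to
    order these two numbers. *)

(** * Gaussian integrals on the line *)

(** The scalar [g] is there for the covariances: with it those of the two processes differ by
    [(1 - p p') (1 - q q')], which is nonnegative for unit vectors and vanishes inside a block,
    where [p] or [q] is constant. One comparison thus serves both parts, with blocks indexed by the
    cone in the first and by the sphere in the second. Small steps replace differentiation under the
    integral: a step of variance [s] costs [s^(3/2)], so [1/s] steps cost [sqrt s] in all, provided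
    the functional has a cubic Taylor remainder; this dictates the smoothing. Nets may be as fine as
    needed, because their cardinality enters no bound; only the Frobenius norm of [A] has to be
    controlled. The obstacle in the thresholds is that the equation for theta is perturbed, so that
    the cutoff [v] and the multiplier [v'] differ, while they agree at the exact optimum. All means
    are therefore computed with two separate parameters: [v <= v'] keeps the distance bound valid,
    and [v' < v] leaves room to push the trial vector inside the cone. *)

Section density.
Context d (T : measurableType d) (R : realType).
Variables (mu nu : {measure set T -> \bar R}) (p : T -> R).
Hypotheses (mp : measurable_fun [set: T] p) (p0 : forall x, 0 <= p x).
Hypothesis nuE : forall A, measurable A -> (nu A = \int[mu]_(x in A) (p x)%:E)%E.

Import HBNNSimple.

(** Both sides are limits over the same simple functions increasing to [f], so monotone convergence
    reduces the claim to indicators, where it is [nuE]. *)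
Lemma ge0_integral_density (f : T -> \bar R) :
  measurable_fun [set: T] f -> (forall x, 0 <= f x)%E ->
  (\int[nu]_x f x = \int[mu]_x (f x * (p x)%:E))%E.
Proof.
move=> mf f0; pose f_ := nnsfun_approx measurableT mf.
have mp' : measurable_fun [set: T] (fun x => (p x)%:E) by exact/measurable_EFinP.
have mf_ n : measurable_fun [set: T] (fun x => (f_ n x)%:E) by exact/measurable_EFinP.
transitivity (limn (fun n => \int[nu]_x (f_ n x)%:E))%E.
  rewrite -monotone_convergence//.
  - apply: eq_integral => x _; apply/esym/cvg_lim => //.
    exact: cvg_nnsfun_approx.
  - by move=> n x _; rewrite lee_fin.
  - by move=> x _ m n mn; rewrite lee_fin; exact/lefP/nd_nnsfun_approx.
transitivity (limn (fun n => \int[mu]_x ((f_ n x)%:E * (p x)%:E)))%E; last first.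
  rewrite -monotone_convergence//.
  - apply: eq_integral => x _; apply/cvg_lim => //.
    by apply: cvgeZr => //; exact: cvg_nnsfun_approx.
  - by move=> n; apply: emeasurable_funM.
  - by move=> n x _; rewrite mule_ge0// lee_fin.
  - move=> x _ m n mn; rewrite lee_wpmul2r// ?lee_fin//.
    exact/lefP/nd_nnsfun_approx.
congr (limn _); apply/funext => n.
under eq_integral do rewrite fimfunE// -fsumEFin//.
rewrite ge0_integral_fsum//; last 2 first.
- by move=> r; exact/measurable_EFinP/measurable_funM.
- by move=> r x _; rewrite nnfun_muleindic_ge0.
under [RHS]eq_integral => x _.
  rewrite fimfunE// -fsumEFin// ge0_mule_fsuml; last first.
    by move=> r; rewrite nnfun_muleindic_ge0.
  over.
rewrite ge0_integral_fsum//; last 2 first.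
- move=> r; apply: emeasurable_funM => //.
  exact/measurable_EFinP/measurable_funM.
- by move=> r x _; rewrite mule_ge0 ?nnfun_muleindic_ge0// lee_fin.
apply: eq_fsbigr => r _.
rewrite integralZl_indic_nnsfun// integral_indic// setIT.
under [RHS]eq_integral do rewrite EFinM -muleA.
(* A negative value is never taken by the approximation: its preimage is empty and both sides
   vanish. *)
case: (leP 0 r) => [r0|r0]; last first.
  rewrite preimage_nnfun0// measure0 mule0.
  by apply/esym/integral0_eq => x _; rewrite indic0 mul0e mule0.
rewrite ge0_integralZl//; last 2 first.
- by apply: emeasurable_funM => //; exact/measurable_EFinP.
- by move=> x _; rewrite mule_ge0// lee_fin.
congr (_ * _)%E; rewrite nuE// integral_mkcond; apply: eq_integral => x _.
by rewrite patchE indicE; case: ifPn => _; rewrite ?mul1e ?mul0e.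
Qed.

End density.

Section gaussian_line.
Context {R : realType}.
Local Notation mu := (@lebesgue_measure R).
Local Notation gauss := (normal_prob (0 : R) 1).
Local Notation pdf := (normal_pdf (0 : R) 1).

Lemma ge0_integral_gauss (f : R -> \bar R) :
  measurable_fun [set: R] f -> (forall x, 0 <= f x)%E ->
  (\int[gauss]_x f x = \int[mu]_x (f x * (pdf x)%:E))%E.
Proof.
move=> mf f0; apply: (@ge0_integral_density _ (measurableTypeR R)) => //.
- exact: measurable_normal_pdf.
- by move=> x; exact: normal_pdf_ge0.
Qed.

(** The push-forward of Lebesgue measure under the affine map, scaled by [b], agrees with Lebesgue
    measure on half-open intervals, hence on all measurable sets. *)
Lemma ge0_integral_affine (f : R -> \bar R) (b c : R) : 0 < b ->
  measurable_fun [set: R] f -> (forall x, 0 <= f x)%E ->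
  (\int[mu]_y (f (b * y + c)%R * b%:E) = \int[mu]_x f x)%E.
Proof.
move=> b0 mf f0.
pose phi := (fun y : measurableTypeR R => b * y + c : measurableTypeR R).
have mphi : measurable_fun setT phi.
  by apply: measurable_funD => //; exact: measurable_funM.
pose pf := measure_function_pushforward__canonical__measure_function_Measure mu mphi.
rewrite ge0_integralZr//; last first.
- exact: ltW.
- by apply: measurableT_comp.
have b0' : 0 <= b by exact: ltW.
pose m := mscale (NngNum b0') pf.
have E A : measurable A -> mu A = m A.
  apply: lebesgue_measure_unique => //= _ [[u v]] _ <-.
  rewrite /mscale /pushforward/= [X in (_ * mu X)%E](_ : _ = `](u - c) / b, (v - c) / b]%classic).
    rewrite !lebesgue_measure_itv/= !lte_fin ltr_pM2r ?invr_gt0// ltrD2r.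
    case: ifPn => _; last by rewrite mule0.
    by rewrite -EFinM; congr (_%:E); field; rewrite gt_eqF.
  apply/seteqP; split => y /=; rewrite !in_itv/= /phi ltr_pdivrMr// ler_pdivlMr//; lra.
rewrite [RHS](_ : _ = \int[m]_x f x)%E; last first.
  by apply: eq_measure_integral => A mA _; exact: E.
rewrite ge0_integral_mscale//= muleC.
by rewrite ge0_integral_pushforward.
Qed.

Lemma gauss_pdfE (x : R) : pdf x = (Num.sqrt (2 * pi))^-1 * expR (- x ^+ 2 / 2).
Proof.
rewrite normal_pdfE ?oner_eq0// /normal_peak /normal_fun subr0 expr1n mul1r.
by rewrite -mulr_natl.
Qed.

(** Both exponents are minus half of [(u^2 - 2 a x u + x^2) / b^2], which is symmetric in [x] and
    [u]. *)
Lemma gauss_pdf_rotate (a b x u : R) : a ^+ 2 + b ^+ 2 = 1 -> b != 0 ->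
  pdf ((u - a * x) / b) * pdf x = pdf u * pdf ((x - a * u) / b).
Proof.
move=> ab b0; rewrite !gauss_pdfE mulrACA -expRD [RHS]mulrACA -expRD.
congr (_ * expR _).
have E (y z : R) : ((z - a * y) / b) ^+ 2 + y ^+ 2 = (z ^+ 2 - 2 * a * y * z + y ^+ 2) / b ^+ 2.
  have -> : ((z - a * y) / b) ^+ 2 + y ^+ 2 =
    (z ^+ 2 - 2 * a * y * z + (a ^+ 2 + b ^+ 2) * y ^+ 2) / b ^+ 2 by field.
  by rewrite ab mul1r.
rewrite -!mulrDl -!opprD E addrC [in RHS]addrC E; congr (- (_ / _) / _); ring.
Qed.

Lemma measurable_pdf : measurable_fun [set: measurableTypeR R] pdf.
Proof. exact: measurable_normal_pdf. Qed.

(** Substitute [u = a x + b y] in the inner integral, exchange the integrals and apply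
    [gauss_pdf_rotate]: what remains in [x] is a normal density of total mass 1. The substitution
    divides by [b], so [b = 0] is treated apart. *)
Lemma ge0_gauss_stable (f : R -> \bar R) (a b : R) :
  0 <= a -> 0 <= b -> a ^+ 2 + b ^+ 2 = 1 ->
  measurable_fun [set: R] f -> (forall x, 0 <= f x)%E ->
  (\int[gauss]_x \int[gauss]_y f (a * x + b * y)%R = \int[gauss]_u f u)%E.
Proof.
move=> a0 b0 ab mf f0; have [b00|bN0] := eqVneq b 0.
  have a1 : a = 1.
    by move: ab; rewrite b00 expr0n addr0 => /eqP; rewrite sqrp_eq1// => /eqP.
  apply: eq_integral => x _.
  transitivity (\int[gauss]_y f x)%E; first by apply: eq_integral => y _; rewrite a1 b00 mul1r mul0r addr0.
  have gT : gauss setT = 1%E := probability_setT _. rewrite integral_cst// [X in (_ * X)%E]gT mule1. done.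
have b1 : 0 < b by rewrite lt_def bN0.
have p0 x : (0 <= (pdf x)%:E)%E by rewrite lee_fin normal_pdf_ge0.
have mL (c e : R) : measurable_fun [set: R] (fun y : R => e * y + c).
  by apply: measurable_funD => //; exact: measurable_funM.
pose h (z : measurableTypeR R * measurableTypeR R) : \bar R :=
  (f z.2 * (pdf ((z.2 - a * z.1) / b) * b^-1)%:E * (pdf z.1)%:E)%E.
have h0 z : (0 <= h z)%E.
  by rewrite /h !mule_ge0// lee_fin mulr_ge0// ?invr_ge0// normal_pdf_ge0.
have mh : measurable_fun setT h.
  apply: emeasurable_funM; last first.
    by apply/measurable_EFinP; apply: measurableT_comp => //; exact: measurable_pdf.
  apply: emeasurable_funM; first exact: measurableT_comp.
  apply/measurable_EFinP; apply: measurable_funM => //.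
  apply: measurableT_comp; first exact: measurable_pdf.
  apply: measurable_funM => //; apply: measurable_funB => //.
  exact: measurable_funM.
have inner x : (\int[gauss]_y f (a * x + b * y)%R =
    \int[mu]_u (f u * (pdf ((u - a * x) / b) * b^-1)%:E))%E.
  rewrite ge0_integral_gauss//; last first.
    by apply: measurableT_comp => //; under eq_fun do rewrite addrC; exact: mL.
  rewrite -[RHS](@ge0_integral_affine _ b (a * x))//.
  - apply: eq_integral => y _ /=; rewrite [a * x + _]addrC -muleA -EFinM addrK.
    by rewrite [b * y]mulrC mulfK// -mulrA mulVf// mulr1.
  - apply: emeasurable_funM => //.
    apply/measurable_EFinP; apply: measurable_funM => //.
    apply: measurableT_comp; first exact: measurable_pdf.
    by apply: measurable_funM => //; exact: measurable_funB.
  - by move=> u; rewrite mule_ge0// lee_fin mulr_ge0// ?invr_ge0// normal_pdf_ge0.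
under eq_integral do rewrite inner.
rewrite [LHS]ge0_integral_gauss; last 2 first.
- pose h' (z : measurableTypeR R * measurableTypeR R) : \bar R :=
    (f z.2 * (pdf ((z.2 - a * z.1) / b) * b^-1)%:E)%E.
  have mh' : measurable_fun setT h'.
    apply: emeasurable_funM; first exact: measurableT_comp.
    apply/measurable_EFinP; apply: measurable_funM => //.
    apply: measurableT_comp; first exact: measurable_pdf.
    apply: measurable_funM => //; apply: measurable_funB => //.
    exact: measurable_funM.
  have h'0 z : (0 <= h' z)%E.
    by rewrite mule_ge0// lee_fin mulr_ge0// ?invr_ge0// normal_pdf_ge0.
  have := measurable_fun_fubini_tonelli_F h' mh' h'0.
  by move=> /(_ mu).
- move=> x; apply: integral_ge0 => u _.
  by rewrite mule_ge0// lee_fin mulr_ge0// ?invr_ge0// normal_pdf_ge0.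
transitivity (\int[mu]_x \int[mu]_u h (x, u))%E.
  apply: eq_integral => x _; rewrite -ge0_integralZr//.
  - apply: emeasurable_funM => //.
    apply/measurable_EFinP; apply: measurable_funM => //.
    apply: measurableT_comp; first exact: measurable_pdf.
    by apply: measurable_funM => //; exact: measurable_funB.
  - move=> u _.
    by rewrite mule_ge0// lee_fin mulr_ge0// ?invr_ge0// normal_pdf_ge0.
rewrite (@fubini_tonelli _ _ _ _ _ mu mu h)// ge0_integral_gauss//.
apply: eq_integral => u _.
transitivity (\int[mu]_x (f u * (pdf u)%:E * ((pdf ((x - a * u) / b)) * b^-1)%:E))%E.
  apply: eq_integral => x _; rewrite /h/= -!muleA -!EFinM; congr (_ * _%:E)%E.
  by rewrite mulrAC gauss_pdf_rotate// mulrA.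
rewrite ge0_integralZl//; last 3 first.
- apply/measurable_EFinP; apply: measurable_funM => //.
  apply: measurableT_comp; first exact: measurable_pdf.
  by apply: measurable_funM => //; exact: measurable_funB.
- by move=> x _; rewrite lee_fin mulr_ge0// ?invr_ge0// normal_pdf_ge0.
- exact: mule_ge0.
rewrite -[RHS]mule1; congr (_ * _)%E.
rewrite -(@ge0_integral_affine (fun x => (pdf ((x - a * u) / b) / b)%:E) b (a * u))//.
- rewrite -(integral_normal_pdf (0:R) 1).
  apply: eq_integral => y _; rewrite -EFinM addrK [b * y]mulrC mulfK//.
  by rewrite -mulrA mulVf// mulr1.
- apply/measurable_EFinP; apply: measurable_funM => //.
  apply: measurableT_comp; first exact: measurable_pdf.
  by apply: measurable_funM => //; exact: measurable_funB.
- by move=> x; rewrite lee_fin mulr_ge0// ?invr_ge0// normal_pdf_ge0.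
Qed.

End gaussian_line.

(** * Finite Gaussian families *)

Section gaussian_tuple.
Context {R : realType}.
Local Notation gauss := (normal_prob (0 : R) 1).
Local Notation TR := (measurableTypeR R).

Lemma measurable_cons_pair n :
  measurable_fun [set: TR * n.-tuple TR]
    (fun z : TR * n.-tuple TR => [the n.+1.-tuple TR of z.1 :: z.2]).
Proof. exact: measurable_cons. Qed.

Definition cons_pair n : {mfun (TR * n.-tuple TR)%type >-> (n.+1.-tuple TR)%type} :=
  mfun_Sub (mem_set (@measurable_cons_pair n)).

(** Recursion on the length lets Tonelli peel off one coordinate at a time. *)
Fixpoint gaussN n : probability (n.-tuple TR) R :=
  match n with
  | 0%N => \d_ ([tuple] : 0.-tuple TR)
  | n'.+1 => distribution (gauss \x gaussN n')%E (cons_pair n')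
  end.

Lemma ge0_integral_gaussNS n (f : n.+1.-tuple TR -> \bar R) :
  measurable_fun [set: n.+1.-tuple TR] f -> (forall t, 0 <= f t)%E ->
  (\int[gaussN n.+1]_t f t =
   \int[gauss]_x \int[gaussN n]_t f [the n.+1.-tuple TR of x :: t])%E.
Proof.
move=> mf f0 /=; rewrite ge0_integral_distribution//.
rewrite fubini_tonelli1//=.
apply: measurableT_comp => //.
exact: measurable_cons_pair.
Qed.

Lemma measurable_fun_prode d (T : measurableType d) (I : Type) (s : seq I)
    (f : I -> T -> \bar R) :
  (forall i, measurable_fun [set: T] (f i)) ->
  measurable_fun [set: T] (fun x => \prod_(i <- s) f i x)%E.
Proof.
move=> mf; elim: s => [|i s ih].
  by under eq_fun do rewrite big_nil; exact: measurable_cst.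
by under eq_fun do rewrite big_cons; exact: emeasurable_funM.
Qed.

Lemma prode_ge0' (I : Type) (s : seq I) (f : I -> \bar R) :
  (forall i, 0 <= f i)%E -> (0 <= \prod_(i <- s) f i)%E.
Proof. by move=> f0; elim/big_rec : _ => // i x _ x0; exact: mule_ge0. Qed.

Lemma ge0_integral_gaussN_prod n (f : 'I_n -> R -> \bar R) :
  (forall i, measurable_fun [set: TR] (f i)) -> (forall i x, 0 <= f i x)%E ->
  (\int[gaussN n]_t \prod_(i < n) f i (tnth t i) = \prod_(i < n) \int[gauss]_x f i x)%E.
Proof.
elim: n f => [|n ih] f mf f0.
  rewrite big_ord0; under eq_integral do rewrite big_ord0.
  rewrite integral_cst// mul1e.
  exact: (@probability_setT _ _ _ (gaussN 0)).
rewrite ge0_integral_gaussNS; last 2 first.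
- apply: measurable_fun_prode => i.
  by apply: measurableT_comp => //; exact: measurable_tnth.
- by move=> t; apply: prode_ge0'.
rewrite big_ord_recl.
transitivity (\int[gauss]_x (f ord0 x * \prod_(i < n) \int[gauss]_y f (lift ord0 i) y))%E.
  apply: eq_integral => x _; rewrite -ih//.
  rewrite -ge0_integralZl//.
  - apply: eq_integral => t _; rewrite big_ord_recl/=; congr (_ * _)%E.
    by apply: eq_bigr => i _; rewrite tnthS.
  - apply: measurable_fun_prode => i.
    by apply: measurableT_comp => //; exact: measurable_tnth.
  - by move=> t _; apply: prode_ge0'.
rewrite ge0_integralZr//.
by apply: prode_ge0' => i; exact: integral_ge0.
Qed.

Definition tbox n (B : 'I_n -> set R) : set (n.-tuple TR) :=
  [set t | forall i, B i (tnth t i)].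

Lemma measurable_tbox n (B : 'I_n -> set R) :
  (forall i, measurable (B i : set TR)) -> measurable (tbox B).
Proof.
move=> mB; rewrite /tbox.
have -> : [set t : n.-tuple TR | forall i, B i (tnth t i)] =
    \bigcap_(i in [set: 'I_n]) ((fun t : n.-tuple TR => tnth t i) @^-1` B i).
  by apply/seteqP; split => t /= h; [move=> i _; exact: h|move=> i; exact: (h i I)].
apply: fin_bigcap_measurable => // i _.
by rewrite -[X in measurable X]setTI; exact: measurable_tnth.
Qed.

Lemma indic_tbox n (B : 'I_n -> set R) (t : n.-tuple TR) :
  (\1_(tbox B) t)%:E = (\prod_(i < n) (\1_(B i) (tnth t i))%:E)%E :> \bar R.
Proof.
rewrite indicE; case: (boolP (t \in _)) => [/set_mem h|h].
  by rewrite big1// => i _; rewrite indicE mem_set.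
have [i hi] : exists i, ~ B i (tnth t i).
  apply: contrapT => H; move/negP: h; apply; apply/mem_set => i; apply: contrapT => Hi; apply: H; by exists i.
by rewrite (bigD1 i)//= indicE memNset// mul0e.
Qed.

Lemma gaussN_tbox n (B : 'I_n -> set R) :
  (forall i, measurable (B i : set TR)) ->
  gaussN n (tbox B) = (\prod_(i < n) gauss (B i))%E.
Proof.
move=> mB.
transitivity (\int[gaussN n]_t (\1_(tbox B) t)%:E)%E.
  by rewrite integral_indic ?setIT//; exact: measurable_tbox.
under eq_integral do rewrite indic_tbox.
rewrite (@ge0_integral_gaussN_prod _ (fun i x => (\1_(B i) x)%:E)).
- by apply: eq_bigr => i _; rewrite integral_indic ?setIT.
- by move=> i; apply/measurable_EFinP; exact: measurable_indic.
- by move=> i x; rewrite lee_fin.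
Qed.

(** Boxes are stable under intersection, contain the whole space and generate the sigma-algebra of
    tuples, so they determine a probability. *)
Lemma gaussN_unique n (Q : probability (n.-tuple TR) R) :
  (forall B : 'I_n -> set R, (forall i, measurable (B i : set TR)) ->
     Q (tbox B) = (\prod_(i < n) gauss (B i))%E) ->
  forall A, measurable A -> Q A = gaussN n A.
Proof.
move=> QE A mA.
pose C : set (set (n.-tuple TR)) :=
  [set X | exists B : 'I_n -> set R, (forall i, measurable (B i : set TR)) /\ X = tbox B].
have CT : C setT.
  by exists (fun=> setT); split => //; apply/seteqP; split.
apply: (measure_unique C (fun=> setT)) => //.
- apply/seteqP; split.
    apply: smallest_sub; first exact: smallest_sigma_algebra.
    move=> X; rewrite -bigcup_seq => -[i _] [B mB <-].
    apply: sub_sigma_algebra; exists (fun j => if j == i then B else setT).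
    split; first by move=> j; case: ifP.
    rewrite setTI; apply/seteqP; split => t /=.
      by move=> h j; case: ifPn => // /eqP ->.
    by move=> /(_ i); rewrite eqxx.
  apply: smallest_sub; first exact: sigma_algebra_measurable.
  by move=> X [B [mB ->]]; exact: measurable_tbox.
- move=> _ _ [B [mB ->]] [B' [mB' ->]]; exists (fun i => B i `&` B' i); split.
    by move=> i; exact: measurableI.
  apply/seteqP; split => t /=.
    by move=> [h1 h2] i; split; [exact: h1|exact: h2].
  by move=> h; split => i; case: (h i).
- by apply/seteqP; split => // t _; exists 0%N.
- by move=> _ [B [mB ->]]; exact: etrans (QE _ mB) (esym (gaussN_tbox mB)).
- by move=> k; apply: (le_lt_trans (probability_le1 Q measurableT)); rewrite ltry.
Qed.

End gaussian_tuple.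

(** * Independent standard normal families over a finite index type *)

Section gaussian_family.
Context {R : realType} (I : finType).
Local Notation gauss := (normal_prob (0 : R) 1).
Local Notation TR := (measurableTypeR R).

(** A family indexed by [I] is stored as a tuple, which carries the measurable structure; [gco]
    reads it through the enumeration of [I]. *)
Definition gspace := (#|I|.-tuple TR)%type.
Definition gco (z : gspace) (i : I) : R := tnth z (enum_rank i).
Definition gaussI : probability gspace R := gaussN #|I|.

Lemma measurable_gco i : measurable_fun [set: gspace] (fun z => gco z i).
Proof. exact: measurable_tnth. Qed.

Lemma big_gco (f : I -> R -> \bar R) (z : gspace) :
  (\prod_i f i (gco z i) = \prod_(k < #|I|) f (enum_val k) (tnth z k))%E.
Proof.
rewrite (reindex (@enum_val I I)); last first.
  by apply: onW_bij; exact: enum_val_bij.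
by apply: eq_big => // k; rewrite /gco enum_valK.
Qed.

Lemma ge0_integral_gaussI_prod (f : I -> R -> \bar R) :
  (forall i, measurable_fun [set: TR] (f i)) -> (forall i x, 0 <= f i x)%E ->
  (\int[gaussI]_z \prod_i f i (gco z i) = \prod_i \int[gauss]_x f i x)%E.
Proof.
move=> mf f0; under eq_integral do rewrite big_gco.
rewrite (@ge0_integral_gaussN_prod _ _ (fun k => f (enum_val k)))//.
rewrite [RHS](reindex (@enum_val I I))//.
by apply: onW_bij; exact: enum_val_bij.
Qed.

(** The box formula expresses independence and standard normality at once, and is exactly what
    [gaussN_unique] asks for. *)
Definition gauss_family d (T : measurableType d) (Q : probability T R) (X : I -> T -> R) :=
  (forall i, measurable_fun [set: T] (X i : T -> TR)) /\
  forall B : I -> set R, (forall i, measurable (B i : set TR)) ->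
    Q [set w | forall i, B i (X i w)] = (\prod_i gauss (B i))%E.

(** The law of the tuple of the [X i] is [gaussI] by uniqueness on boxes. Expectations can thus be
    moved from any probability space to the canonical one. *)
Lemma ge0_integral_gauss_family d (T : measurableType d) (Q : probability T R)
    (X : I -> T -> R) (phi : (I -> R) -> \bar R) : gauss_family Q X ->
  measurable_fun [set: gspace] (fun z => phi (gco z)) -> (forall x, 0 <= phi x)%E ->
  (\int[Q]_w phi (X ^~ w) = \int[gaussI]_z phi (gco z))%E.
Proof.
move=> [mX QX] mphi phi0.
pose Y w : gspace := [tuple X (enum_val k) w | k < #|I|].
have mY : measurable_fun [set: T] Y.
  apply/measurable_fun_tnthP => k /=.
  rewrite (_ : _ \o _ = X (enum_val k))//.
  by apply/funext => w /=; rewrite tnth_mktuple.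
pose Ym : {mfun T >-> gspace} := mfun_Sub (mem_set mY).
have coY w : gco (Y w) = X ^~ w.
  by apply/funext => i; rewrite /gco tnth_mktuple enum_rankK.
transitivity (\int[distribution Q Ym]_z phi (gco z))%E.
  rewrite ge0_integral_distribution//.
  by apply: eq_integral => w _ /=; rewrite coY.
apply: eq_measure_integral => A mA _.
apply: (gaussN_unique (Q := distribution Q Ym)) => // B mB.
transitivity (Q [set w | forall i, B (enum_rank i) (X i w)]); last first.
  rewrite (QX (fun i => B (enum_rank i))); last by move=> i; exact: mB.
  rewrite (reindex (@enum_val I I)); last first.
    by apply: onW_bij; exact: enum_val_bij.
  by apply: eq_bigr => k _; rewrite enum_valK.
rewrite [LHS]/(Q (Y @^-1` tbox B)); congr (Q _); apply/seteqP; split => w /= h.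
  by move=> i; have := h (enum_rank i); rewrite /= tnth_mktuple enum_rankK.
by move=> k; rewrite tnth_mktuple; have := h (enum_val k); rewrite enum_valK.
Qed.

Lemma gauss_family_gco : gauss_family gaussI (fun i z => gco z i).
Proof.
split; first exact: measurable_gco.
move=> B mB.
rewrite (_ : [set _ | _] = tbox (fun k => B (enum_val k))).
  rewrite [LHS](gaussN_tbox (B := fun k => B (enum_val k)))//.
  rewrite [RHS](reindex (@enum_val I I))//.
  by apply: onW_bij; exact: enum_val_bij.
apply/seteqP; split => z /= h.
  by move=> k; have := h (enum_val k); rewrite /gco enum_valK.
by move=> i; have := h (enum_rank i); rewrite enum_rankK.
Qed.

Lemma indic_forall T (B : I -> set T) (x : I -> T) :
  (\1_[set y : I -> T | forall i, B i (y i)] x)%:E = (\prod_i (\1_(B i) (x i))%:E)%E :> \bar R.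
Proof.
rewrite indicE; case: (boolP (x \in _)) => [/set_mem h|h].
  by rewrite big1// => i _; rewrite indicE mem_set.
have [i hi] : exists i, ~ B i (x i).
  apply: contrapT => H; move/negP: h; apply; apply/mem_set => i.
  by apply: contrapT => Hi; apply: H; exists i.
by rewrite (bigD1 i)//= indicE memNset// mul0e.
Qed.

Lemma measurable_forall d (T : measurableType d) (X : I -> T -> R) (B : I -> set R) :
  (forall i, measurable_fun [set: T] (X i : T -> TR)) ->
  (forall i, measurable (B i : set TR)) ->
  measurable [set w | forall i, B i (X i w)].
Proof.
move=> mX mB; rewrite (_ : [set w | _] = \bigcap_(i in [set: I]) ((X i) @^-1` B i)).
  apply: fin_bigcap_measurable => // i _.
  by rewrite -[X in measurable X]setTI; exact: mX.
by apply/seteqP; split => t /= h; [move=> i _; exact: h|move=> i; exact: (h i Logic.I)].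
Qed.

(** On a box the integrand is a product over the coordinates, so two applications of Tonelli leave
    the one-dimensional stability in each coordinate. *)
Lemma gauss_family_stable (c e : I -> R) : (forall i, 0 <= c i) -> (forall i, 0 <= e i) ->
  (forall i, c i ^+ 2 + e i ^+ 2 = 1) ->
  gauss_family (gaussI \x gaussI)%E
    (fun i (z : gspace * gspace) => c i * gco z.1 i + e i * gco z.2 i).
Proof.
move=> c0 e0 ce; set X := (fun i => _).
have mX i : measurable_fun [set: gspace * gspace] (X i : _ -> TR).
  apply: measurable_funD; apply: measurable_funM => //.
    exact: (measurableT_comp (measurable_gco i) measurable_fst).
  exact: (measurableT_comp (measurable_gco i) measurable_snd).
split=> // B mB.
have mE := measurable_forall mX mB.
rewrite -[LHS]mul1e -[X in (X * _)%E]/(1%:E) -[LHS]integral_cst//.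
transitivity (\int[(gaussI \x gaussI)%E]_z (\1_[set w | forall i, B i (X i w)] z)%:E)%E.
  by rewrite integral_indic ?setIT// integral_cst// mul1e.
have E z : (\1_[set w | forall i, B i (X i w)] z)%:E =
   (\prod_i (\1_(B i) (X i z))%:E)%E :> \bar R.
  by rewrite -(indic_forall B (X ^~ z)); rewrite !indicE; congr (_%:R%:E); apply/idP/idP; rewrite !inE.
under eq_integral do rewrite E.
have mBi i : measurable_fun [set: TR] (fun x : TR => (\1_(B i) x)%:E : \bar R).
  by apply/measurable_EFinP; exact: measurable_indic.
rewrite fubini_tonelli1; last 2 first.
- apply: measurable_fun_prode => i.
  exact: (@measurableT_comp _ _ _ _ _ _ (fun x : TR => (\1_(B i) x)%:E)).
- by move=> z; apply: prode_ge0' => i; rewrite lee_fin.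
have mcd i (x : TR) : measurable_fun [set: TR] (fun y : TR => c i * x + e i * y : TR).
  by apply: measurable_funD => //; exact: measurable_funM.
transitivity (\int[gaussI]_z \prod_i \int[gauss]_y (\1_(B i) (c i * gco z i + e i * y))%:E)%E.
  apply: eq_integral => z _.
  rewrite -ge0_integral_gaussI_prod//.
  by move=> i; exact: (@measurableT_comp _ _ _ _ _ _ (fun x : TR => (\1_(B i) x)%:E)).
rewrite (@ge0_integral_gaussI_prod (fun i x => \int[gauss]_y (\1_(B i) (c i * x + e i * y))%:E)%E).
- apply: eq_bigr => i _.
  rewrite (@ge0_gauss_stable _ (fun x => (\1_(B i) x)%:E) _ _ (c0 i) (e0 i) (ce i) (mBi i)); last first.
    by move=> x; rewrite lee_fin.
  by rewrite integral_indic ?setIT.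
- move=> i.
  pose h (z : TR * TR) : \bar R := (\1_(B i) (c i * z.1 + e i * z.2))%:E.
  have mh : measurable_fun setT h.
    apply: (@measurableT_comp _ _ _ _ _ _ (fun x : TR => (\1_(B i) x)%:E)) => //.
    by apply: measurable_funD; exact: measurable_funM.
  have := measurable_fun_fubini_tonelli_F h mh (fun z => _).
  by move=> /(_ gauss); apply=> z; rewrite lee_fin.
- by move=> i x; apply: integral_ge0 => y _; rewrite lee_fin.
Qed.

End gaussian_family.

(** * Truncated Gaussian moments *)

Section gaussian_moments.
Context {R : realType}.
Local Notation mu := (@lebesgue_measure R).
Local Notation gauss := (normal_prob (0 : R) 1).
Local Notation pdf := (normal_pdf (0 : R) 1).
Local Notation TR := (measurableTypeR R).
Import gauss_integral_proof.
Local Notation J := (@integral0_gauss R).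

Lemma integrable_gauss_fun (a b : R) : mu.-integrable `[a, b] (EFin \o gauss_fun).
Proof. by apply: (@integrableS _ _ _ mu setT) => //; exact: integrableT_gauss. Qed.

Lemma cvg_integral0_gauss : J x @[x --> +oo] --> Num.sqrt pi / 2.
Proof.
have -> : Num.sqrt pi / 2 = Num.sqrt (pi / 4) :> R.
  rewrite -[2 in LHS]ger0_norm// -sqrtr_sqr -sqrtrV -?sqrtrM ?pi_ge0//.
  by congr (Num.sqrt (_ / _)); ring.
have -> : (fun x => J x) = Num.sqrt \o (fun x => J x ^+ 2).
  by apply/funext => x /=; rewrite sqrtr_sqr ger0_norm ?integral0_gauss_ge0.
by apply: continuous_cvg; [exact: sqrt_continuous|exact: cvg_integral0_gauss_sqr].
Qed.

Lemma continuous_integral0_gauss (x : R) : 0 <= x -> {within `[0, x], continuous J}.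
Proof. by move=> x0; exact: parameterized_integral_continuous (integrable_gauss_fun 0 x). Qed.

Lemma is_derive_integral0_gauss (x : R) : 0 < x -> is_derive x 1 J (gauss_fun x).
Proof.
move=> x0; have x1 : x < x + 1 by rewrite ltrDl.
have [dJ J'] := continuous_FTC1_closed x1 (integrable_gauss_fun 0 _) x0 (@continuous_gauss_fun R x).
by apply: DeriveDef; [exact: dJ|rewrite -derive1E; exact: J'].
Qed.

(** The integral of the standard normal density over [[0, x]], obtained from that of [exp(- s^2)] by
    scaling; its limit at infinity is 1/2. *)
Definition half_normal_cdf (x : R) := J (x / Num.sqrt 2) / Num.sqrt pi.

Lemma is_derive_half_normal_cdf (x : R) : 0 < x ->
  is_derive x 1 half_normal_cdf (pdf x).
Proof.
move=> x0.
have y0 : 0 < x / Num.sqrt 2 by rewrite divr_gt0// sqrtr_gt0.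
have dJ' := is_derive_integral0_gauss y0.
have dl : is_derive x (1:R) (fun x : R => x / Num.sqrt 2) (Num.sqrt 2)^-1.
  by apply: is_derive_eq; rewrite /GRing.scale/= ?mulr0 ?add0r ?addr0 ?mulr1.
have dc := @is_derive1_comp R J (fun x : R => x / Num.sqrt 2) x _ _ dJ' dl.
rewrite /half_normal_cdf.
have -> : pdf x = (Num.sqrt pi)^-1 *: (gauss_fun (x / Num.sqrt 2) * (Num.sqrt 2)^-1).
  rewrite gauss_pdfE /gauss_fun /GRing.scale/= exprMn exprVn sqr_sqrtr// sqrtrM// invfM mulNr.
  by rewrite mulrCA mulrC [X in _ * X]mulrC.
rewrite (_ : (fun _ => _) = (Num.sqrt pi)^-1 *: (J \o (fun x : R => x / Num.sqrt 2))).
  exact: is_deriveZ.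
by apply/funext => z /=; rewrite mulrC.
Qed.

Lemma is_derive_gauss_pdf (x : R) : is_derive x 1 pdf (- x * pdf x).
Proof.
rewrite (_ : pdf = fun x => (Num.sqrt (2 * pi))^-1 * expR (- x ^+ 2 / 2)); last first.
  by apply/funext => z; rewrite gauss_pdfE.
apply: is_derive_eq.
rewrite /GRing.scale/= ?mulr0 ?addr0 ?add0r ?expr1.
by set c := (_ (2 * pi))^-1; set e := expR _; field.
Qed.

Lemma gauss_pdf_gt0 (x : R) : 0 < pdf x.
Proof. by rewrite gauss_pdfE mulr_gt0 ?expR_gt0// invr_gt0 sqrtr_gt0 mulr_gt0// pi_gt0. Qed.

Lemma gauss_pdf_tail (x : R) : 0 < x -> x * pdf x <= 2 / x.
Proof.
move=> x0; rewrite gauss_pdfE.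
have peak1 : (Num.sqrt (2 * pi))^-1 <= 1 :> R.
  have p2 := @pi_ge2 R; rewrite invf_le1; last by rewrite sqrtr_gt0; lra.
  by rewrite -[leLHS]sqrtr1 ler_sqrt; lra.
have E : expR (- x ^+ 2 / 2) <= 2 / x ^+ 2.
  rewrite mulNr expRN -[leRHS]invrK ler_pV2 ?inE ?unitfE ?invr_eq0 ?gt_eqF ?invr_gt0 ?divr_gt0 ?exprn_gt0 ?expR_gt0//.
  rewrite invf_div; have := expR_ge1Dx (x ^+ 2 / 2); lra.
have E0 := expR_ge0 (- x ^+ 2 / 2).
apply: (@le_trans _ _ (x * (2 / x ^+ 2))).
  apply: ler_wpM2l; first exact: ltW.
  by apply: le_trans E; rewrite ler_piMl.
by rewrite expr2 le_eqVlt; apply/orP; left; apply/eqP; field; rewrite gt_eqF.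
Qed.

Lemma cvg_gauss_pdf_tail : x * pdf x @[x --> +oo] --> (0 : R).
Proof.
apply/cvgrPdist_le => e e0; near=> x.
have x0 : 0 < x by near: x; apply: nbhs_pinfty_gt; rewrite num_real.
have xe : 2 / e <= x by near: x; apply: nbhs_pinfty_ge; rewrite num_real.
rewrite sub0r normrN ger0_norm; last by rewrite mulr_ge0// ltW// gauss_pdf_gt0.
apply: (le_trans (gauss_pdf_tail x0)).
by rewrite ler_pdivrMr// mulrC -ler_pdivrMr.
Unshelve. all: end_near. Qed.

Lemma cvg_gauss_pdf : pdf x @[x --> +oo] --> (0 : R).
Proof.
apply: (@squeeze_cvgr _ _ _ _ (fun=> 0) (fun x : R => x * pdf x)).
- near=> x.
  have x1 : 1 <= x by near: x; apply: nbhs_pinfty_ge; rewrite num_real.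
  by rewrite ler_peMl// ltW// gauss_pdf_gt0.
- exact: cvg_cst.
- exact: cvg_gauss_pdf_tail.
Unshelve. all: end_near. Qed.

Lemma cvg_half_normal_cdf : half_normal_cdf x @[x --> +oo] --> (2^-1 : R).
Proof.
rewrite (_ : 2^-1 = (Num.sqrt pi / 2) / Num.sqrt pi :> R); last first.
  by field; rewrite gt_eqF// sqrtr_gt0 pi_gt0.
apply: cvgMl; apply: (@cvg_comp _ _ _ (fun x : R => x / Num.sqrt 2) J _ +oo).
  by apply: gt0_cvgMly; [rewrite invr_gt0 sqrtr_gt0|exact: cvg_id].
exact: cvg_integral0_gauss.
Qed.

Lemma half_normal_cdf_right (v : R) : 0 <= v ->
  half_normal_cdf x @[x --> v^'+] --> half_normal_cdf v.
Proof.
move=> v0.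
rewrite le_eqVlt in v0; case/orP: v0 => [/eqP <-|v0]; last first.
  apply: cvg_at_right_filter; apply: differentiable_continuous.
  have d := is_derive_half_normal_cdf v0.
  by apply/derivable1_diffP.
have [_ J0 _] := (continuous_within_itvP J (@ltr01 R)).1 (continuous_integral0_gauss ler01).
apply: cvgMl; apply: (@cvg_comp _ _ _ (fun x : R => x / Num.sqrt 2) J _ 0^'+); last first.
  by rewrite mul0r.
move=> P [e /= e0 He]; exists (e * Num.sqrt 2) => /=; first by rewrite mulr_gt0// sqrtr_gt0.
move=> x /=; rewrite sub0r normrN => xe x0; apply: He => /=; last by rewrite divr_gt0// sqrtr_gt0.
by rewrite sub0r normrN normrM [X in _ * X]gtr0_norm ?invr_gt0 ?sqrtr_gt0// ltr_pdivrMr ?sqrtr_gt0.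
Qed.

Lemma half_normal_cdfE (v : R) : 0 <= v -> half_normal_cdf v = erf (v / Num.sqrt 2) / 2.
Proof.
move=> v0; rewrite /erf divr_ge0 ?sqrtr_ge0// /half_normal_cdf /integral0_gauss.
set r := Rintegral _ _ _; rewrite -[X in X / _ = _]/r.
by field; rewrite gt_eqF// sqrtr_gt0 pi_gt0.
Qed.

Lemma gauss_half_integral0 (v : R) : 0 <= v ->
  (\int[mu]_(x in `[v, +oo[) (pdf x)%:E = (2^-1 - half_normal_cdf v)%:E)%E.
Proof.
move=> v0; rewrite (@ge0_continuous_FTC2y _ pdf half_normal_cdf _ (2^-1)) ?EFinB//.
- by move=> x _; exact: normal_pdf_ge0.
- by apply: continuous_subspaceT; apply: continuous_normal_pdf; exact: oner_neq0.
- exact: cvg_half_normal_cdf.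
- by move=> x vx; have [] := is_derive_half_normal_cdf (le_lt_trans v0 vx).
- exact: half_normal_cdf_right.
- move=> x; rewrite in_itv/= andbT => vx.
  by rewrite derive1E; have [] := is_derive_half_normal_cdf (le_lt_trans v0 vx).
Qed.

Lemma continuous_gauss_pdf : continuous pdf.
Proof. by apply: continuous_normal_pdf; exact: oner_neq0. Qed.

Lemma gauss_half_integral1 (v : R) : 0 <= v ->
  (\int[mu]_(x in `[v, +oo[) (x * pdf x)%:E = (pdf v)%:E)%E.
Proof.
move=> v0; rewrite (@ge0_continuous_FTC2y _ (fun x => x * pdf x) (fun x => - pdf x) _ 0).
- by rewrite sub0e EFinN oppeK.
- by move=> x vx; rewrite mulr_ge0 ?normal_pdf_ge0// (le_trans v0).
- apply: continuous_subspaceT => x; apply: cvgM; first exact: cvg_id.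
  exact: continuous_gauss_pdf.
- by rewrite -[X in _ --> X]oppr0; apply: cvgN; exact: cvg_gauss_pdf.
- by move=> x vx; have [? _] := is_derive_gauss_pdf x; exact: derivableN.
- by apply: cvg_at_right_filter; apply: cvgN; exact: continuous_gauss_pdf.
- move=> x _; rewrite derive1E; have d := is_derive_gauss_pdf x.
  by rewrite (@deriveN _ _ _ pdf)// derive_val mulNr opprK.
Qed.

Lemma gauss_half_integral2 (v : R) : 0 <= v ->
  (\int[mu]_(x in `[v, +oo[) (x ^+ 2 * pdf x)%:E =
   (v * pdf v + (2^-1 - half_normal_cdf v))%:E)%E.
Proof.
move=> v0.
(* Integration by parts in the form of an antiderivative: the derivative of [x * pdf x] is
   [pdf x - x^2 * pdf x]. *)
pose F x := half_normal_cdf x - x * pdf x.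
have dF (x : R) : 0 < x -> is_derive x 1 F (x ^+ 2 * pdf x).
  move=> x0; have d1 := is_derive_half_normal_cdf x0.
  have d2 := is_derive_gauss_pdf x.
  have d3 : is_derive x (1:R) (fun x : R => x * pdf x) (pdf x - x ^+ 2 * pdf x).
    by apply: is_derive_eq; rewrite /GRing.scale/=; ring.
  rewrite (_ : x ^+ 2 * pdf x = pdf x - (pdf x - x ^+ 2 * pdf x)); last by ring.
  exact: is_deriveB.
rewrite (@ge0_continuous_FTC2y _ (fun x => x ^+ 2 * pdf x) F _ (2^-1)).
- by rewrite -EFinB /F; congr (_%:E); ring.
- by move=> x vx; rewrite mulr_ge0 ?normal_pdf_ge0// sqr_ge0.
- apply: continuous_subspaceT => x; apply: cvgM; first exact: exprn_continuous.
  exact: continuous_gauss_pdf.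
- rewrite -[2^-1]subr0; apply: cvgB; first exact: cvg_half_normal_cdf.
  exact: cvg_gauss_pdf_tail.
- by move=> x vx; have [] := dF x (le_lt_trans v0 vx).
- apply: cvgB; first exact: half_normal_cdf_right.
  apply: cvg_at_right_filter; apply: cvgM; first exact: cvg_id.
  exact: continuous_gauss_pdf.
- move=> x; rewrite in_itv/= andbT => vx.
  by rewrite derive1E; have [] := dF x (le_lt_trans v0 vx).
Qed.

End gaussian_moments.

(** * Two-sided tail moments and integrability under the normal law *)

Section gaussian_truncated.
Context {R : realType}.
Local Notation mu := (@lebesgue_measure R).
Local Notation gauss := (normal_prob (0 : R) 1).
Local Notation pdf := (normal_pdf (0 : R) 1).
Local Notation TR := (measurableTypeR R).

Lemma ge0_integralN (f : R -> \bar R) :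
  measurable_fun [set: R] f -> (forall x, 0 <= f x)%E ->
  (\int[mu]_x f (- x)%R = \int[mu]_x f x)%E.
Proof.
move=> mf f0.
rewrite [RHS](_ : _ = \int[pushforward mu (-%R : TR -> TR)]_x f x)%E.
  by rewrite ge0_integral_pushforward.
by apply: eq_measure_integral => A mA _; exact/esym/lebesgue_measureN.
Qed.

Lemma gauss_pdfN (x : R) : pdf (- x) = pdf x.
Proof. by rewrite !gauss_pdfE sqrrN. Qed.

Lemma ge0_gauss_integralN (f : R -> \bar R) :
  measurable_fun [set: R] f -> (forall x, 0 <= f x)%E ->
  (\int[gauss]_x f (- x)%R = \int[gauss]_x f x)%E.
Proof.
move=> mf f0; rewrite !ge0_integral_gauss//; last first.
  by apply: (@measurableT_comp _ _ _ TR TR); first exact: mf.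
rewrite -[RHS]ge0_integralN.
- by apply: eq_integral => x _; rewrite gauss_pdfN.
- apply: emeasurable_funM => //; apply/measurable_EFinP; exact: measurable_pdf.
- by move=> x; rewrite mule_ge0// lee_fin normal_pdf_ge0.
Qed.

(** The set [v < |x|] is the union of two disjoint tails, exchanged by the reflection [x -> - x]. *)
Lemma ge0_gauss_integral_even (f : R -> \bar R) (v : R) : 0 <= v ->
  measurable_fun [set: R] f -> (forall x, 0 <= f x)%E ->
  (forall x, f (- x)%R = f x) ->
  (\int[gauss]_x (((v < `|x|)%R%:R)%:E * f x) =
   2%:E * \int[mu]_(x in `[v, +oo[) (f x * (pdf x)%:E))%E.
Proof.
move=> v0 mf f0 fN.
have mp : measurable_fun [set: TR] (fun x : TR => (pdf x)%:E).
  by apply/measurable_EFinP; exact: measurable_pdf.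
have p0 x : (0 <= (pdf x)%:E)%E by rewrite lee_fin normal_pdf_ge0.
pose g (x : TR) : \bar R := (f x * (pdf x)%:E)%E.
have mg : measurable_fun [set: TR] g by apply: emeasurable_funM.
have g0 x : (0 <= g x)%E by rewrite mule_ge0.
have mi : measurable [set x : TR | v < `|x|].
  rewrite (_ : [set x | _] = `]v, +oo[ `|` `]-oo, (- v)[).
    exact: measurableU.
  apply/seteqP; split => x /=; rewrite !in_itv/= andbT ltr_normr ltrNr.
    by move=> /orP.
  by move=> h; apply/orP.
have mind : measurable_fun [set: TR] (fun x : TR => ((v < `|x|)%R%:R : R)%:E : \bar R).
  apply/measurable_EFinP.
  rewrite (_ : (fun x => _) = \1_[set x : TR | v < `|x|]); first exact: measurable_indic.
  by apply/funext => x; rewrite indicE; congr (_%:R); rewrite mem_setE.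
rewrite ge0_integral_gauss//; last 2 first.
- exact: emeasurable_funM.
- by move=> x; rewrite mule_ge0// lee_fin.
transitivity (\int[mu]_(x in `]v, +oo[ `|` `]-oo, (- v)%R[) g x)%E.
  rewrite [RHS]integral_mkcond; apply: eq_integral => x _; rewrite patchE -muleA.
  have -> : (x \in `]v, +oo[ `|` `]-oo, (- v)%R[)%classic = (v < `|x|).
    rewrite ltr_normr ltrNr; apply/idP/idP.
      by rewrite inE => -[|] /=; rewrite in_itv/= ?andbT => ->; rewrite ?orbT.
    by rewrite inE => /orP[h|h]; [left|right]; rewrite /= in_itv/= ?andbT.
  by case: ifP => _; rewrite ?mul1e ?mul0e.
rewrite ge0_integral_setU//; first last.
- apply/disj_setPS => x [] /=; rewrite !in_itv/= andbT => h1 h2.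
  by move: (lt_trans h1 h2); rewrite ltNge; lra.
- exact: measurable_funTS.
have -> : (\int[mu]_(x in `]-oo, (- v)%R[) g x = \int[mu]_(x in `]v, +oo[) g x)%E.
  rewrite integral_mkcond [RHS]integral_mkcond -[RHS]ge0_integralN.
  - apply: eq_integral => x _; rewrite !patchE.
    have -> : ((- x)%R \in `]v, +oo[%classic) = (x \in `]-oo, (- v)%R[%classic).
      by apply/idP/idP; rewrite !inE/= !in_itv/= andbT ltrNr.
    by rewrite /g fN gauss_pdfN.
  - by apply/(measurable_restrictT _ _).1 => //; exact: measurable_funTS.
  - by move=> x; rewrite patchE; case: ifP.
rewrite integral_itv_obnd_cbnd; last exact: measurable_funTS.
by rewrite mule_natl mule2n.
Qed.

Lemma gauss_trunc0 (v : R) : 0 <= v ->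
  (\int[gauss]_x (((v < `|x|)%R%:R)%:E) = (1 - erf (v / Num.sqrt 2))%:E)%E.
Proof.
move=> v0; have := @ge0_gauss_integral_even (fun=> 1%E) v v0.
under eq_integral do rewrite mule1.
move=> -> //; under eq_integral do rewrite mul1e.
rewrite gauss_half_integral0// half_normal_cdfE// -EFinM; by congr (_%:E); field.
Qed.

Lemma gauss_trunc1 (v : R) : 0 <= v ->
  (\int[gauss]_x (((v < `|x|)%R%:R)%:E * (`|x|)%:E) = (2 * pdf v)%:E)%E.
Proof.
move=> v0; rewrite (@ge0_gauss_integral_even (fun x => (`|x|)%:E))//.
- rewrite EFinM; congr (_ * _)%E; rewrite -gauss_half_integral1//.
  apply: eq_integral => x; rewrite inE/= in_itv/= andbT => vx.
  by rewrite ger0_norm// (le_trans v0).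
- by apply/measurable_EFinP; exact: (@normr_measurable R).
- by move=> x; rewrite normrN.
Qed.

Lemma gauss_trunc2 (v : R) : 0 <= v ->
  (\int[gauss]_x (((v < `|x|)%R%:R)%:E * (x ^+ 2)%:E) =
   (2 * v * pdf v + (1 - erf (v / Num.sqrt 2)))%:E)%E.
Proof.
move=> v0; rewrite (@ge0_gauss_integral_even (fun x => (x ^+ 2)%:E))//.
- rewrite gauss_half_integral2// half_normal_cdfE// -EFinM; by congr (_%:E); field.
- by apply/measurable_EFinP; exact: measurable_funX.
- by move=> x; rewrite lee_fin sqr_ge0.
- by move=> x; rewrite sqrrN.
Qed.

(** The integrand times the standard density is [sqrt 2] times the normal density of standard
    deviation [sqrt 2]. This weight dominates every function of at most quadratic growth. *)
Lemma gauss_integral_exp_sqr :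
  (\int[gauss]_x (expR (x ^+ 2 / 4))%:E = (Num.sqrt 2)%:E)%E.
Proof.
have s2 : Num.sqrt 2 != 0 :> R by rewrite gt_eqF// sqrtr_gt0.
rewrite ge0_integral_gauss; [|apply/measurable_EFinP|by move=> x; rewrite lee_fin expR_ge0]; last first.
  apply: measurableT_comp => //.
  by apply: measurable_funM => //; exact: measurable_funX.
transitivity (\int[mu]_x ((Num.sqrt 2)%:E * (normal_pdf 0 (Num.sqrt 2) x)%:E))%E.
  apply: eq_integral => x _; rewrite -!EFinM; congr (_%:E).
  rewrite gauss_pdfE normal_pdfE// /normal_peak /normal_fun subr0 sqr_sqrtr//.
  rewrite mulrCA -expRD (_ : _ + _ = - x ^+ 2 / (2 *+ 2)); last by field.
  rewrite mulrA; congr (_ * _).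
  rewrite -(mulr_natl (2 * pi)) (sqrtrM (2 * pi))// invfM mulrA mulfV// mul1r.
  by [].
rewrite ge0_integralZl//.
- by rewrite integral_normal_pdf mule1.
- by apply/measurable_EFinP; exact: measurable_normal_pdf.
- by move=> x _; rewrite lee_fin normal_pdf_ge0.
Qed.

Lemma gauss_integrable (f : R -> R) (C : R) : measurable_fun [set: R] f ->
  (forall x, `|f x| <= C * expR (x ^+ 2 / 4)) ->
  gauss.-integrable [set: R] (EFin \o f).
Proof.
move=> mf fC.
have me : measurable_fun [set: TR] (fun x : TR => expR (x ^+ 2 / 4)).
  apply: measurableT_comp => //.
  by apply: measurable_funM => //; exact: measurable_funX.
apply: (@le_integrable _ TR R gauss setT measurableT _
  (fun x => C%:E * (expR (x ^+ 2 / 4))%:E)%E).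
- exact/measurable_EFinP.
- move=> x _ /=; rewrite lee_fin; apply: (le_trans (fC x)).
  exact: ler_norm.
apply: integrableZl => //.
apply/integrableP; split; first exact/measurable_EFinP.
under eq_integral do rewrite /= ger0_norm ?expR_ge0//.
by rewrite gauss_integral_exp_sqr ltry.
Qed.

End gaussian_truncated.

(** * Moments of linear forms in a Gaussian family *)

Section gaussian_family_moments.
Context {R : realType} (I : finType).
Local Notation gauss := (normal_prob (0 : R) 1).
Local Notation TR := (measurableTypeR R).
Local Notation gam := (@gaussI R I).
Local Notation co := (@gco R I).

(** The l1 norm is the convenient size here: its exponential factors over the coordinates, hence is
    integrable, and it dominates all polynomials. *)
Definition l1z (z : gspace I) : R := \sum_i `|co z i|.

Lemma measurable_l1z : measurable_fun [set: gspace I] l1z.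
Proof.
apply: measurable_sum => i; apply: measurableT_comp; first exact: normr_measurable.
exact: measurable_gco.
Qed.

Lemma l1z_ge0 z : 0 <= l1z z. Proof. exact: sumr_ge0. Qed.

Lemma le_l1z z i : `|co z i| <= l1z z.
Proof. by rewrite /l1z (bigD1 i)//= lerDl sumr_ge0. Qed.

Lemma normr_le_exp_sqr (x : R) : `|x| <= 1 + x ^+ 2 / 4.
Proof. by rewrite -(real_normK (num_real x)); have := sqr_ge0 (`|x| / 2 - 1); nra. Qed.

Lemma gauss_integral_exp_norm_lty : (\int[gauss]_x (expR (`|x|))%:E < +oo)%E.
Proof.
apply: (@le_lt_trans _ _ (\int[gauss]_x ((expR 1)%:E * (expR (x ^+ 2 / 4))%:E))%E).
  apply: ge0_le_integral => //.
  all: try by move=> x _; rewrite ?mule_ge0 ?lee_fin ?expR_ge0.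
  - by apply/measurable_EFinP; apply: measurableT_comp => //; exact: normr_measurable.
  - apply: emeasurable_funM => //; apply/measurable_EFinP.
    by apply: measurableT_comp => //; apply: measurable_funM => //; exact: measurable_funX.
  - by move=> x _; rewrite -EFinM lee_fin -expRD ler_expR normr_le_exp_sqr.
rewrite ge0_integralZl//.
- by rewrite gauss_integral_exp_sqr -EFinM ltry.
- apply/measurable_EFinP; apply: measurableT_comp => //.
  by apply: measurable_funM => //; exact: measurable_funX.
Qed.

Lemma prodEFin (J : Type) (s : seq J) (f : J -> R) :
  (\prod_(j <- s) (f j)%:E = (\prod_(j <- s) f j)%:E)%E.
Proof. by elim/big_ind2 : _ => // x1 x2 y1 y2 -> ->; rewrite EFinM. Qed.

Lemma expR_sum_fin (f : I -> R) : expR (\sum_i f i) = \prod_i expR (f i).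
Proof. by elim/big_ind2 : _ => [|x1 x2 y1 y2 <- <-|//]; rewrite ?expR0 ?expRD. Qed.

Lemma integrable_exp_l1z : gam.-integrable setT (fun z => (expR (l1z z))%:E).
Proof.
apply/integrableP; split.
  by apply/measurable_EFinP; apply: measurableT_comp => //; exact: measurable_l1z.
under eq_integral do rewrite /= ger0_norm ?expR_ge0// /l1z expR_sum_fin -prodEFin.
rewrite (@ge0_integral_gaussI_prod _ _ (fun _ x => (expR `|x|)%:E)).
- rewrite (eq_bigr (fun=> (fine (\int[gauss]_x (expR (`|x|))%:E))%:E)).
    by rewrite prodEFin ltry.
  move=> i _; rewrite fineK// ge0_fin_numE ?gauss_integral_exp_norm_lty//.
  by apply: integral_ge0 => x _; rewrite lee_fin expR_ge0.
- by move=> i; apply/measurable_EFinP; apply: measurableT_comp => //; exact: normr_measurable.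
- by move=> i x; rewrite lee_fin expR_ge0.
Qed.

Lemma integrable_gaussI (f : gspace I -> R) (C : R) : measurable_fun [set: gspace I] f ->
  (forall z, `|f z| <= C * expR (l1z z)) -> gam.-integrable setT (EFin \o f).
Proof.
move=> mf fC.
apply: (@le_integrable _ _ R gam setT measurableT _ (fun z => C%:E * (expR (l1z z))%:E)%E).
- exact/measurable_EFinP.
- move=> z _ /=; rewrite lee_fin; apply: (le_trans (fC z)).
  exact: ler_norm.
apply: integrableZl => //.
exact: integrable_exp_l1z.
Qed.

Lemma le_expR1 (x : R) : x <= expR x.
Proof. by have := expR_ge1Dx x; lra. Qed.

Lemma le_expR2 (x : R) : 0 <= x -> x ^+ 2 <= 4 * expR x.
Proof.
move=> x0; have h := expR_ge1Dx (x / 2).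
have -> : expR x = expR (x / 2) * expR (x / 2) by rewrite -expRD; congr expR; field.
nra.
Qed.

Lemma le_expR3 (x : R) : 0 <= x -> x ^+ 3 <= 27 * expR x.
Proof.
move=> x0; have h := expR_ge1Dx (x / 3).
have -> : expR x = expR (x / 3) ^+ 3.
  by rewrite -expRM_natl; congr expR; field.
have -> : x ^+ 3 = 27 * (x / 3) ^+ 3 by field.
rewrite ler_pM2l//; apply: lerXn2r; rewrite ?nnegrE ?expR_ge0//; last by lra.
by rewrite divr_ge0.
Qed.

Lemma gauss_family_sign (e : I -> bool) :
  gauss_family gam (fun i z => (-1) ^+ e i * co z i).
Proof.
have [_ h] := @gauss_family_gco R I.
split => [i|B mB].
  by apply: measurable_funM => //; exact: measurable_gco.
pose B' i : set R := [set x | B i ((-1) ^+ e i * x)].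
have mB' i : measurable (B' i : set TR).
  have mm : measurable_fun [set: TR] (fun x : TR => (-1) ^+ e i * x : TR).
    exact: measurable_funM.
  by rewrite -[X in measurable X]setTI; exact: mm.
rewrite [LHS](h B')//; apply: eq_bigr => i _.
have gE (D : set R) : measurable (D : set TR) -> gauss D = (\int[gauss]_x (\1_D x)%:E)%E.
  by move=> mD; rewrite integral_indic ?setIT.
rewrite (gE (B' i))// (gE (B i))//.
have -> : (\int[gauss]_x (\1_(B' i) x)%:E = \int[gauss]_x (\1_(B i) ((-1) ^+ e i * x)%R)%:E)%E.
  apply: eq_integral => x _; rewrite !indicE.
  suff -> : (x \in B' i) = ((-1) ^+ e i * x \in B i) by [].
  by apply/idP/idP => /set_mem hx; exact/mem_set.
case: (e i); rewrite ?expr1 ?expr0; last by under eq_integral do rewrite mul1r.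
under eq_integral do rewrite mulN1r.
apply: (@ge0_gauss_integralN _ (fun x => (\1_(B i) x)%:E)).
- apply/measurable_EFinP; have mi : measurable_fun [set: TR] (\1_(B i) : TR -> R) by exact: measurable_indic. exact: mi.
- by move=> x; rewrite lee_fin.
Qed.

(* Flipping one coordinate preserves the law, so functions that are odd in it
   have zero mean. *)
Lemma gaussI_odd (e : I -> bool) (phi : (I -> R) -> R) :
  gam.-integrable setT (fun z => (phi (co z))%:E) ->
  (forall x, phi (fun i => (-1) ^+ e i * x i) = - phi x) ->
  (\int[gam]_z phi (co z))%R = 0.
Proof.
move=> iphi odd.
have mphi : measurable_fun [set: gspace I] (fun z => phi (co z)).
  by apply/measurable_EFinP; exact: measurable_int iphi.
pose p x := (Num.max (phi x) 0)%:E.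
pose q x := (Num.max (- phi x) 0)%:E.
have mp : measurable_fun [set: gspace I] (fun z => p (co z)).
  by apply/measurable_EFinP; exact: measurable_maxr.
have E : (\int[gam]_z q (co z) = \int[gam]_z p (co z))%E.
  rewrite -(ge0_integral_gauss_family (gauss_family_sign e) mp).
    by apply: eq_integral => z _; rewrite /p odd.
  by move=> x; rewrite lee_fin le_max lexx orbT.
rewrite /Rintegral integralE.
rewrite (_ : (fun z => _)^\+ = fun z => p (co z))%E; last first.
  by apply/funext => z; rewrite funeposE /p -EFin_max.
rewrite (_ : (fun z => _)^\- = fun z => q (co z))%E; last first.
  by apply/funext => z; rewrite funenegE /q -EFin_max.
rewrite E subee//.
have : (\int[gam]_z p (co z) < +oo)%E.
  have := integral_funepos_lt_pinfty measurableT iphi.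
  rewrite (_ : (fun z => _)^\+ = fun z => p (co z))%E//.
  by apply/funext => z; rewrite funeposE /p -EFin_max.
rewrite ge0_fin_numE//.
by apply: integral_ge0 => z _; rewrite lee_fin le_max lexx orbT.
Qed.

Lemma integrable_gco i : gam.-integrable setT (fun z => (co z i)%:E).
Proof.
apply: (@integrable_gaussI (fun z => co z i) 1); first exact: measurable_gco.
by move=> z; rewrite mul1r (le_trans (le_l1z z i))// le_expR1.
Qed.

Lemma integrable_gco2 i j : gam.-integrable setT (fun z => (co z i * co z j)%:E).
Proof.
apply: (@integrable_gaussI (fun z => co z i * co z j) 4).
  by apply: measurable_funM; exact: measurable_gco.
move=> z; apply: le_trans (le_expR2 (l1z_ge0 z)).
by rewrite normrM expr2 ler_pM// le_l1z.
Qed.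

Lemma gauss_integral_sqr : (\int[gauss]_x (x ^+ 2)%:E = 1)%E.
Proof.
transitivity (\int[gauss]_x (((0 < `|x|)%R%:R)%:E * (x ^+ 2)%:E))%E.
  apply: eq_integral => x _; rewrite normr_gt0; have [->|x0] := eqVneq x 0.
    by rewrite expr0n /= mule0.
  by rewrite mul1e.
rewrite gauss_trunc2// mulr0 mul0r add0r mul0r /erf lexx.
rewrite (_ : Rintegral _ _ _ = 0) ?mulr0 ?subr0//.
by rewrite set_itv1 /Rintegral integral_set1.
Qed.

(** Off the diagonal the product is odd in coordinate [i]; on the diagonal it is a product of
    one-dimensional functions, all but one of them equal to 1. *)
Lemma Rintegral_gco2 i j : (\int[gam]_z (co z i * co z j))%R = (i == j)%:R.
Proof.
have [<-|ij] := eqVneq i j; last first.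
  apply: (@gaussI_odd (fun k => k == i) (fun x => x i * x j)); first exact: integrable_gco2.
  by move=> x; rewrite eqxx eq_sym (negbTE ij) expr1 expr0 mul1r mulN1r mulNr.
rewrite /Rintegral.
have -> : (\int[gam]_z (co z i * co z i)%:E =
    \int[gam]_z \prod_k (if k == i then (co z k) ^+ 2 else 1)%:E)%E.
  apply: eq_integral => z _; rewrite prodEFin (bigD1 i)//= eqxx big1 ?mulr1 ?expr2//.
  by move=> k /negbTE ->.
rewrite (@ge0_integral_gaussI_prod _ _ (fun k x => (if k == i then x ^+ 2 else 1)%:E)).
- rewrite big1// => k _; case: (k == i); first exact: gauss_integral_sqr.
  by rewrite integral_cst//= mul1e; exact: (@probability_setT _ _ _ gauss).
- by move=> k; apply/measurable_EFinP; case: (k == i); first exact: measurable_funX.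
- by move=> k x; rewrite lee_fin; case: (k == i); rewrite ?sqr_ge0.
Qed.

Definition lin (u : I -> R) (z : I -> R) := \sum_i u i * z i.

Lemma measurable_lin u : measurable_fun [set: gspace I] (fun z => lin u (co z)).
Proof. by apply: measurable_sum => i; apply: measurable_funM => //; exact: measurable_gco. Qed.

Lemma le_lin u z : `|lin u (co z)| <= (\sum_i `|u i|) * l1z z.
Proof.
apply: (le_trans (ler_norm_sum _ _ _)); rewrite mulr_suml ler_sum// => i _.
by rewrite normrM ler_wpM2l// le_l1z.
Qed.

Lemma integrable_lin u : gam.-integrable setT (fun z => (lin u (co z))%:E).
Proof.
under eq_fun do rewrite /lin -sumEFin.
apply: integrable_sum => // i _.
by under eq_fun do rewrite EFinM; apply: integrableZl => //; exact: integrable_gco.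
Qed.

Lemma Rintegral_lin u : (\int[gam]_z lin u (co z))%R = 0.
Proof.
apply: (@gaussI_odd (fun=> true) (lin u)); first exact: integrable_lin.
by move=> x; rewrite /lin -sumrN; apply: eq_bigr => i _; rewrite expr1; ring.
Qed.

Lemma integrable_lin2 u v : gam.-integrable setT (fun z => (lin u (co z) * lin v (co z))%:E).
Proof.
apply: (@integrable_gaussI (fun z => lin u (co z) * lin v (co z))
  (4 * ((\sum_i `|u i|) * (\sum_i `|v i|)))).
  by apply: measurable_funM; exact: measurable_lin.
move=> z; rewrite normrM mulrAC.
apply: (@le_trans _ _ ((\sum_i `|u i|) * l1z z * ((\sum_i `|v i|) * l1z z))).
  by rewrite ler_pM// le_lin.
rewrite mulrACA -expr2 mulrC ler_wpM2r ?mulr_ge0 ?sumr_ge0//.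
exact/le_expR2/l1z_ge0.
Qed.

Lemma Rintegral_lin2 u v :
  (\int[gam]_z (lin u (co z) * lin v (co z)))%R = \sum_i u i * v i.
Proof.
rewrite /Rintegral.
have E z : (lin u (co z) * lin v (co z))%:E =
    (\sum_i \sum_j ((u i * v j)%:E * (co z i * co z j)%:E))%E.
  rewrite /lin mulr_suml -sumEFin; apply: eq_bigr => i _.
  rewrite mulr_sumr -sumEFin; apply: eq_bigr => j _.
  by rewrite -EFinM; congr (_%:E); ring.
under eq_integral do rewrite E.
have ii i j : gam.-integrable setT (fun z => ((u i * v j)%:E * (co z i * co z j)%:E)%E).
  by apply: integrableZl => //; exact: integrable_gco2.
rewrite integral_sum//; last first.
  by move=> i; apply: integrable_sum.
rewrite (eq_bigr (fun i => (u i * v i)%:E)).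
  by rewrite sumEFin.
move=> i _; rewrite integral_sum//.
have G j : (\int[gam]_z ((u i * v j)%:E * (co z i * co z j)%:E) = (u i * v j * (i == j)%:R)%:E)%E.
  rewrite integralZl//; last exact: integrable_gco2.
  rewrite [RHS]EFinM; congr (_ * _)%E; rewrite -Rintegral_gco2 /Rintegral fineK//.
  by apply: integrable_fin_num => //; exact: integrable_gco2.
rewrite (eq_bigr _ (fun j _ => G j)) sumEFin (bigD1 i)//= eqxx mulr1 big1 ?addr0// => j ji.
by rewrite eq_sym (negbTE ji) mulr0.
Qed.

End gaussian_family_moments.

(** * Gordon's comparison inequality *)

Section smoothstep.
Context {R : realType}.
Implicit Types x w : R.

Definition clip x : R := Num.max 0 (Num.min x 1).
(** The first two derivatives of the quintic [10 c^3 - 15 c^4 + 6 c^5] vanish at 0 and 1, so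
    freezing its argument outside [[0, 1]] keeps the second derivative Lipschitz. [smoothstep1] and
    [smoothstep2] are these derivatives. *)
Definition smoothstep x := clip x ^+ 3 * (10 - 15 * clip x + 6 * clip x ^+ 2).
Definition smoothstep1 x := 30 * (clip x * (1 - clip x)) ^+ 2.
Definition smoothstep2 x := 60 * (clip x * (1 - clip x)) * (1 - 2 * clip x).

Lemma clip_ge0 x : 0 <= clip x. Proof. by rewrite le_max lexx. Qed.
Lemma clip_le1 x : clip x <= 1.
Proof. by rewrite ge_max ler01 ge_min lexx orbT. Qed.

(** Either the clipped point moves by exactly [w], or the move meets an endpoint, and then the
    distance from [clip x] to that endpoint is at most [|w|] or [clip x] is an endpoint itself. *)
Lemma clipP x w : let d := clip (x + w) - clip x in
  `|d| <= `|w| /\ (d = w \/ clip x * (1 - clip x) <= `|w|).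
Proof.
rewrite /clip /=; case: (ltrP x 1) => x1; case: (ltrP (x + w) 1) => xw1.
- case: (ltrP 0 x) => x0; case: (ltrP 0 (x + w)) => xw0.
  + by rewrite addrC addKr; split=> //; left.
  + have w0 : w <= 0 by lra.
    by rewrite !ler0_norm; [split; [lra|right; nra]|lra|lra].
  + have w0 : 0 <= w by lra.
    by rewrite !ger0_norm; [split; [lra|right; lra]|lra|lra].
  + by rewrite subrr normr0; split => //; right; rewrite mul0r.
- rewrite [Num.max 0 1]max_r//.
  have w0 : 0 <= w by lra.
  rewrite [X in _ <= X]ger0_norm// [X in _ \/ _ <= X]ger0_norm//.
  case: (ltrP 0 x) => x0; rewrite ger0_norm; try lra; (split; first lra); right; nra.
- rewrite [Num.max 0 1]max_r//.
  have w0 : w <= 0 by lra.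
  rewrite [X in _ <= X]ler0_norm// [X in _ \/ _ <= X]ler0_norm//.
  by case: (ltrP 0 (x + w)) => xw0; rewrite ler0_norm; try lra; (split; first lra); right; lra.
- by rewrite subrr normr0; split => //; right; rewrite [Num.max 0 1]max_r// subrr mulr0.
Qed.

Lemma smoothstep_le0 x : x <= 0 -> smoothstep x = 0.
Proof.
move=> x0; rewrite /smoothstep (_ : clip x = 0) ?expr0n ?mul0r//.
by rewrite /clip min_l ?max_l//; lra.
Qed.

Lemma smoothstep_ge1 x : 1 <= x -> smoothstep x = 1.
Proof.
move=> x1; rewrite /smoothstep (_ : clip x = 1); first by ring.
by rewrite /clip min_r// max_r.
Qed.

Lemma smoothstep_ge0 x : 0 <= smoothstep x.
Proof.
have c0 := clip_ge0 x; have c1 := clip_le1 x; rewrite /smoothstep.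
apply: mulr_ge0; first exact: exprn_ge0.
nra.
Qed.

Lemma smoothstep_le1 x : smoothstep x <= 1.
Proof.
have c0 := clip_ge0 x; have c1 := clip_le1 x; rewrite /smoothstep.
set c := clip x in c0 c1 *.
rewrite -subr_ge0 (_ : _ - _ = (1 - c) ^+ 3 * (1 + 3 * c + 6 * c ^+ 2)); last by ring.
by apply: mulr_ge0; [apply: exprn_ge0; lra|nra].
Qed.

Lemma smoothstep1_ge0 x : 0 <= smoothstep1 x.
Proof. by rewrite mulr_ge0// sqr_ge0. Qed.

(** The quintic has an exact expansion in the clipped increment [d], with cubic remainder
    [r * d ^+ 3]; what is left is the cost of replacing [d] by [w]. The value 200 is a crude common
    bound for all five estimates. *)
Lemma smoothstep_taylor x w : let L := 200 in
  [/\ `|smoothstep1 x * w| <= L * `|w|,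
      `|smoothstep2 x * (w * w)| <= L * `|w| ^+ 2,
      `|smoothstep (x + w) - smoothstep x| <= L * `|w|,
      `|smoothstep (x + w) - smoothstep x - smoothstep1 x * w| <= L * `|w| ^+ 2 &
      `|smoothstep (x + w) - smoothstep x - smoothstep1 x * w
        - 2^-1 * (smoothstep2 x * (w * w))| <= L * `|w| ^+ 3].
Proof.
have c0 := clip_ge0 x; have c1 := clip_le1 x.
have b0 := clip_ge0 (x + w); have b1 := clip_le1 (x + w).
have /= [dw dK] := clipP x w.
rewrite /smoothstep /smoothstep1 /smoothstep2.
set c := clip x in c0 c1 dw dK *; set b := clip (x + w) in b0 b1 dw dK *.
set d := b - c in dw dK.
have bE : b = c + d by rewrite /d addrC subrK.
set m := `|w| in dw dK *.
have m0 : 0 <= m by exact: normr_ge0.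
have wE : w * w = m ^+ 2 by rewrite -expr2 /m real_normK// num_real.
pose k := c * (1 - c).
have k0 : 0 <= k by rewrite /k; nra.
have k1 : k <= 1 / 4 by rewrite /k; have := sqr_ge0 (c - 1 / 2); nra.
pose r := 10 - 60 * k + (30 * c - 15) * d + 6 * d ^+ 2.
have d1 : `|d| <= 1 by rewrite ler_norml; apply/andP; split; rewrite /d; lra.
have rE : `|r| <= 46.
  have [dl du] : -1 <= d /\ d <= 1 by move: d1; rewrite ler_norml => /andP.
  by rewrite ler_norml; apply/andP; split; rewrite /r; nra.
have e1 : c * (1 - c) = k by [].
rewrite e1.
pose p1 := 30 * k ^+ 2; pose p2 := 60 * k * (1 - 2 * c).
have p1E : `|p1| <= 2 by rewrite ger0_norm /p1; nra.
have p2E : `|p2| <= 60 * k.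
  by rewrite /p2 ler_norml; apply/andP; split; nra.
have p2E' : `|p2| <= 15 by apply: (le_trans p2E); lra.
have TE : b ^+ 3 * (10 - 15 * b + 6 * b ^+ 2) - c ^+ 3 * (10 - 15 * c + 6 * c ^+ 2) =
    p1 * d + 2^-1 * p2 * d ^+ 2 + r * d ^+ 3.
  by rewrite bE /p1 /p2 /r /k; field.
have dn0 := normr_ge0 d.
have rd3 : `|r * d ^+ 3| <= 46 * m ^+ 3.
  by rewrite normrM normrX ler_pM// ?exprn_ge0// lerXn2r ?nnegrE.
have d2m : `|d| ^+ 2 <= m ^+ 2 by rewrite lerXn2r ?nnegrE.
have dcm : `|d| ^+ 2 <= m by rewrite expr2; nra.
have rd2 : `|r * d ^+ 3| <= 46 * m ^+ 2.
  rewrite normrM normrX ler_pM// ?exprn_ge0//.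
  by apply: le_trans d2m; rewrite exprS; nra.
have rd1 : `|r * d ^+ 3| <= 46 * m.
  rewrite normrM normrX ler_pM// ?exprn_ge0//.
  by apply: le_trans dcm; rewrite exprS; nra.
have h2 : `|2^-1 * p2 * d ^+ 2| <= 8 * m ^+ 2.
  rewrite normrM normrX normrM [`|2^-1|]ger0_norm// ler_pM ?mulr_ge0 ?exprn_ge0//.
  lra.
have h2' : `|2^-1 * p2 * d ^+ 2| <= 8 * m.
  rewrite normrM normrX normrM [`|2^-1|]ger0_norm// ler_pM ?mulr_ge0 ?exprn_ge0//.
  lra.
have dwm : `|d - w| <= 2 * m.
  by apply: (le_trans (ler_normB _ _)); rewrite -/m; lra.
(* Either [d = w] and nothing is lost, or [k <= m], and then the powers of [k] in the derivatives
   supply the missing powers of [m]. The same dichotomy gives [g4]. *)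
have g3 : `|p1 * (d - w)| <= 60 * m ^+ 3 /\ `|p1 * (d - w)| <= 15 * m ^+ 2.
  case: dK => [->|kc]; first by rewrite subrr mulr0 normr0 !mulr_ge0 ?exprn_ge0.
  rewrite normrM [`|p1|]ger0_norm; last by rewrite /p1; nra.
  have km : k ^+ 2 <= m ^+ 2 by rewrite lerXn2r ?nnegrE.
  have km' : k ^+ 2 <= 1 / 4 * m by rewrite expr2; nra.
  have k20 := sqr_ge0 k.
  split.
    rewrite (_ : 60 * m ^+ 3 = 30 * m ^+ 2 * (2 * m)); last by ring.
    by rewrite ler_pM// /p1; nra.
  rewrite (_ : 15 * m ^+ 2 = 30 * (1 / 4 * m) * (2 * m)); last by field.
  by rewrite ler_pM// /p1; nra.
have g4 : `|2^-1 * p2 * (d ^+ 2 - w * w)| <= 30 * m ^+ 3.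
  case: dK => [->|kc]; first by rewrite expr2 subrr mulr0 normr0 mulr_ge0 ?exprn_ge0.
  rewrite normrM (normrM 2^-1) [`|2^-1|]ger0_norm//.
  rewrite (_ : 30 * m ^+ 3 = 30 * m * m ^+ 2); last by ring.
  apply: ler_pM => //.
    by lra.
  rewrite wE ler_norml -(real_normK (num_real d)); apply/andP; split.
    by have := sqr_ge0 `|d|; lra.
  by have := sqr_ge0 m; lra.
split.
- by rewrite normrM -/m ler_wpM2r//; apply: (le_trans p1E); lra.
- rewrite normrM wE [`|m ^+ 2|]ger0_norm ?sqr_ge0// ler_wpM2r ?sqr_ge0//.
  by apply: (le_trans p2E'); lra.
- rewrite TE; apply: (le_trans (ler_normD _ _)).
  have := ler_normD (p1 * d) (2^-1 * p2 * d ^+ 2).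
  have : `|p1 * d| <= 2 * m by rewrite normrM ler_pM.
  lra.
- rewrite TE -/p1 (_ : _ - _ = p1 * (d - w) + 2^-1 * p2 * d ^+ 2 + r * d ^+ 3); last by ring.
  apply: (le_trans (ler_normD _ _)).
  have := ler_normD (p1 * (d - w)) (2^-1 * p2 * d ^+ 2).
  have := g3.2; have := sqr_ge0 m; lra.
- rewrite TE -/p1 -/p2 (_ : _ - _ = p1 * (d - w) + 2^-1 * p2 * (d ^+ 2 - w * w) + r * d ^+ 3); last by ring.
  apply: (le_trans (ler_normD _ _)).
  have := ler_normD (p1 * (d - w)) (2^-1 * p2 * (d ^+ 2 - w * w)).
  have := g3.1; have := exprn_ge0 3 m0; lra.
Qed.

End smoothstep.

(** * Bounded functions with a uniform second-order expansion *)

Section smooth_class.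
Context {R : realType} (Idx : finType).
Implicit Types w x : Idx -> R.

Definition nrm1 w : R := \sum_a `|w a|.
Definition dot1 (g : Idx -> R) w : R := \sum_a g a * w a.
Definition dot2 (s : Idx -> Idx -> R) w : R := \sum_a \sum_b s a b * (w a * w b).

(* [G] and [S] are the gradient and the Hessian of [f]; the last field is
   Taylor's formula with a cubic remainder. *)
Record smooth2 (f : (Idx -> R) -> R) (G : (Idx -> R) -> Idx -> R)
    (S : (Idx -> R) -> Idx -> Idx -> R) (L : R) : Prop := Smooth2 {
  s2L : 0 <= L ;
  s2f : forall x, `|f x| <= L ;
  s2G : forall x w, `|dot1 (G x) w| <= L * nrm1 w ;
  s2S : forall x w, `|dot2 (S x) w| <= L * nrm1 w ^+ 2 ;
  s2d1 : forall x w, `|f (x \+ w) - f x| <= L * nrm1 w ;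
  s2d2 : forall x w, `|f (x \+ w) - f x - dot1 (G x) w| <= L * nrm1 w ^+ 2 ;
  s2d3 : forall x w,
    `|f (x \+ w) - f x - dot1 (G x) w - 2^-1 * dot2 (S x) w| <= L * nrm1 w ^+ 3
}.

Lemma nrm1_ge0 w : 0 <= nrm1 w. Proof. exact: sumr_ge0. Qed.

Lemma dot1D (a b : R) (g g' : Idx -> R) w :
  dot1 (fun i => a * g i + b * g' i) w = a * dot1 g w + b * dot1 g' w.
Proof.
rewrite /dot1 !mulr_sumr -big_split/=; apply: eq_bigr => i _; ring.
Qed.

Lemma smooth2_cst (c : R) : smooth2 (fun=> c) (fun _ _ => 0) (fun _ _ _ => 0) `|c|.
Proof.
have d1 w : dot1 (fun=> 0) w = 0 by rewrite /dot1 big1// => i _; rewrite mul0r.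
have d2 w : dot2 (fun _ _ => 0) w = 0.
  by rewrite /dot2 big1// => i _; rewrite big1// => j _; rewrite mul0r.
by split => // *; rewrite ?d1 ?d2 ?subrr ?mulr0 ?normr0 ?mulr_ge0 ?exprn_ge0 ?nrm1_ge0// ?subrr ?normr0 ?mulr_ge0 ?exprn_ge0 ?nrm1_ge0.
Qed.

Lemma smooth2_onem f G S L : smooth2 f G S L ->
  smooth2 (fun x => 1 - f x) (fun x i => - G x i) (fun x i j => - S x i j) (1 + L).
Proof.
move=> [L0 h1 h2 h3 h4 h5 h6].
have d1 x w : dot1 (fun i => - G x i) w = - dot1 (G x) w.
  by rewrite /dot1 -sumrN; apply: eq_bigr => i _; rewrite mulNr.
have d2 x w : dot2 (fun i j => - S x i j) w = - dot2 (S x) w.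
  by rewrite /dot2 -sumrN; apply: eq_bigr => i _; rewrite -sumrN; apply: eq_bigr => j _; rewrite mulNr.
have LE k w : L * nrm1 w ^+ k <= (1 + L) * nrm1 w ^+ k.
  by rewrite ler_wpM2r ?exprn_ge0 ?nrm1_ge0// lerDr.
have LE1 w := LE 1%N w; rewrite /= in LE1.
split.
- lra.
- by move=> x; apply: (le_trans (ler_normB _ _)); rewrite normr1 lerD2l.
- by move=> x w; rewrite d1 normrN; apply: le_trans (LE1 w).
- by move=> x w; rewrite d2 normrN; apply: le_trans (LE 2%N w).
- move=> x w; rewrite (_ : _ - _ = - (f (x \+ w) - f x)); last by ring.
  by rewrite normrN; apply: le_trans (LE1 w).
- move=> x w; rewrite d1 (_ : _ - _ = - (f (x \+ w) - f x - dot1 (G x) w)); last by ring.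
  by rewrite normrN; apply: le_trans (LE 2%N w).
- move=> x w; rewrite d1 d2.
  rewrite (_ : _ - _ = - (f (x \+ w) - f x - dot1 (G x) w - 2^-1 * dot2 (S x) w)); last by ring.
  by rewrite normrN; apply: le_trans (LE 3%N w).
Qed.

(** Each remainder of the product telescopes into products of remainders of the factors, as in
    Leibniz' rule. The factor 4 comes from the Hessian: one unit for each factor's own Hessian and
    two for the mixed gradients. *)
Lemma smooth2_mul f Gf Sf L g Gg Sg M : smooth2 f Gf Sf L -> smooth2 g Gg Sg M ->
  smooth2 (fun x => f x * g x) (fun x i => f x * Gg x i + g x * Gf x i)
    (fun x i j => f x * Sg x i j + g x * Sf x i j + (Gf x i * Gg x j + Gg x i * Gf x j))
    (4 * (L * M)).
Proof.
move=> [L0 f1 f2 f3 f4 f5 f6] [M0 g1 g2 g3 g4 g5 g6].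
have d2 x w : dot2 (fun i j => f x * Sg x i j + g x * Sf x i j + (Gf x i * Gg x j + Gg x i * Gf x j)) w =
   f x * dot2 (Sg x) w + g x * dot2 (Sf x) w + 2 * (dot1 (Gf x) w * dot1 (Gg x) w).
  have -> : 2 * (dot1 (Gf x) w * dot1 (Gg x) w) =
      dot1 (Gf x) w * dot1 (Gg x) w + dot1 (Gg x) w * dot1 (Gf x) w by ring.
  rewrite /dot2 /dot1 !mulr_suml !mulr_sumr -!big_split/=; apply: eq_bigr => i _.
  rewrite !mulr_sumr -!big_split/=; apply: eq_bigr => j _; ring.
have n0 w := nrm1_ge0 w.
have B (a b c e : R) k l w : `|a| <= c * nrm1 w ^+ k -> `|b| <= e * nrm1 w ^+ l ->
    `|a * b| <= (c * e) * nrm1 w ^+ (k + l).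
  move=> h1 h2; rewrite normrM exprD mulrACA; exact: ler_pM.
have f1' x w : `|f x| <= L * nrm1 w ^+ 0 by rewrite expr0 mulr1.
have g1' x w : `|g x| <= M * nrm1 w ^+ 0 by rewrite expr0 mulr1.
have nk w k : 0 <= nrm1 w ^+ k by rewrite exprn_ge0.
have LM0 w k : 0 <= L * M * nrm1 w ^+ k by rewrite !mulr_ge0.
split.
- by rewrite !mulr_ge0.
- move=> x; have := B _ _ _ _ _ _ (fun=> 0) (f1' x _) (g1' x _).
  rewrite expr0 mulr1; have : 0 <= L * M by rewrite mulr_ge0.
  lra.
- move=> x w; rewrite dot1D.
  have := B _ _ _ _ 0%N 1%N w (f1' x w) (g2 x w).
  have := B _ _ _ _ 0%N 1%N w (g1' x w) (f2 x w).
  have := ler_normD (f x * dot1 (Gg x) w) (g x * dot1 (Gf x) w).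
  rewrite !add0n !expr1 (mulrC M L); have := LM0 w 1%N; rewrite expr1; lra.
- move=> x w; rewrite d2.
  have := B _ _ _ _ 0%N 2%N w (f1' x w) (g3 x w).
  have := B _ _ _ _ 0%N 2%N w (g1' x w) (f3 x w).
  have := B _ _ _ _ 1%N 1%N w (f2 x w) (g2 x w).
  have := ler_normD (f x * dot2 (Sg x) w + g x * dot2 (Sf x) w) (2 * (dot1 (Gf x) w * dot1 (Gg x) w)).
  have := ler_normD (f x * dot2 (Sg x) w) (g x * dot2 (Sf x) w).
  rewrite (normrM 2) [`|2|]ger0_norm// !add0n (mulrC M L); have := LM0 w 2%N; rewrite /addn /=; lra.
- move=> x w; rewrite (_ : _ - _ = f (x \+ w) * (g (x \+ w) - g x) + g x * (f (x \+ w) - f x)); last by ring.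
  have := B _ _ _ _ 0%N 1%N w (f1' (x \+ w) w) (g4 x w).
  have := B _ _ _ _ 0%N 1%N w (g1' x w) (f4 x w).
  have := ler_normD (f (x \+ w) * (g (x \+ w) - g x)) (g x * (f (x \+ w) - f x)).
  rewrite !add0n !expr1 (mulrC M L); have := LM0 w 1%N; rewrite expr1; lra.
- move=> x w; rewrite dot1D.
  rewrite (_ : _ - _ = f (x \+ w) * (g (x \+ w) - g x - dot1 (Gg x) w) +
    (f (x \+ w) - f x) * dot1 (Gg x) w + g x * (f (x \+ w) - f x - dot1 (Gf x) w)); last by ring.
  have := B _ _ _ _ 0%N 2%N w (f1' (x \+ w) w) (g5 x w).
  have := B _ _ _ _ 1%N 1%N w (f4 x w) (g2 x w).
  have := B _ _ _ _ 0%N 2%N w (g1' x w) (f5 x w).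
  set A1 := f _ * _; set A2 := (_ - _) * _; set A3 := g x * _.
  have := ler_normD (A1 + A2) A3; have := ler_normD A1 A2.
  rewrite !add0n (mulrC M L); have := LM0 w 2%N; rewrite /addn /=; lra.
- move=> x w; rewrite dot1D d2.
  rewrite (_ : _ - _ = f (x \+ w) * (g (x \+ w) - g x - dot1 (Gg x) w - 2^-1 * dot2 (Sg x) w) +
    (f (x \+ w) - f x - dot1 (Gf x) w) * dot1 (Gg x) w +
    2^-1 * ((f (x \+ w) - f x) * dot2 (Sg x) w) +
    g x * (f (x \+ w) - f x - dot1 (Gf x) w - 2^-1 * dot2 (Sf x) w)); last by field.
  have := B _ _ _ _ 0%N 3%N w (f1' (x \+ w) w) (g6 x w).
  have := B _ _ _ _ 2%N 1%N w (f5 x w) (g2 x w).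
  have := B _ _ _ _ 1%N 2%N w (f4 x w) (g3 x w).
  have := B _ _ _ _ 0%N 3%N w (g1' x w) (f6 x w).
  set A1 := f _ * _; set A2 := _ * dot1 _ _; set A3 := _ * dot2 _ _; set A4 := g x * _.
  have := ler_normD (A1 + A2 + 2^-1 * A3) A4; have := ler_normD (A1 + A2) (2^-1 * A3).
  have := ler_normD A1 A2.
  rewrite (normrM 2^-1) [`|2^-1|]ger0_norm// !add0n (mulrC M L); have := LM0 w 3%N; rewrite /addn /=; lra.
Qed.

Lemma dot1_single (a : Idx) (c : R) w : dot1 (fun i => (i == a)%:R * c) w = c * w a.
Proof.
rewrite /dot1 (bigD1 a)//= eqxx mul1r big1 ?addr0// => i /negbTE ->.
by rewrite !mul0r.
Qed.

Lemma dot2_single (a : Idx) (c : R) w :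
  dot2 (fun i j => (i == a)%:R * ((j == a)%:R * c)) w = c * (w a * w a).
Proof.
rewrite /dot2 (bigD1 a)//= [X in _ + X]big1 ?addr0; last first.
  by move=> i /negbTE ->; rewrite big1// => j _; rewrite !mul0r.
rewrite (bigD1 a)//= eqxx !mul1r big1 ?addr0// => j /negbTE ->.
by rewrite mul0r mulr0 mul0r.
Qed.

Lemma smooth2_smoothstep (a : Idx) (k : R) :
  smooth2 (fun x => smoothstep (x a - k))
    (fun x i => (i == a)%:R * smoothstep1 (x a - k))
    (fun x i j => (i == a)%:R * ((j == a)%:R * smoothstep2 (x a - k))) 200.
Proof.
have n w : `|w a| <= nrm1 w by rewrite /nrm1 (bigD1 a)//= lerDl sumr_ge0.
have nk w m : 200 * `|w a| ^+ m <= 200 * nrm1 w ^+ m.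
  by rewrite ler_wpM2l// lerXn2r ?nnegrE ?nrm1_ge0.
have n1 w := nk w 1%N.
have E x w : (x \+ w) a - k = x a - k + w a by rewrite /= addrAC.
split => //.
- move=> x; rewrite ger0_norm ?smoothstep_ge0//.
  by apply: (le_trans (smoothstep_le1 _)); lra.
- move=> x w; rewrite dot1_single; have [+ _ _ _ _] := smoothstep_taylor (x a - k) (w a).
  by move=> /le_trans; apply; exact: n1.
- move=> x w; rewrite dot2_single; have [_ + _ _ _] := smoothstep_taylor (x a - k) (w a).
  by move=> /le_trans; apply; exact: nk.
- move=> x w; rewrite E; have [_ _ + _ _] := smoothstep_taylor (x a - k) (w a).
  by move=> /le_trans; apply; exact: n1.
- move=> x w; rewrite E dot1_single; have [_ _ _ + _] := smoothstep_taylor (x a - k) (w a).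
  by move=> /le_trans; apply; exact: nk.
- move=> x w; rewrite E dot1_single dot2_single; have [_ _ _ _ +] := smoothstep_taylor (x a - k) (w a).
  by move=> /le_trans; apply; exact: nk.
Qed.

End smooth_class.

(** * The smoothed min-max functional *)

Section gordon_functional.
Context {R : realType} (A H : finType).
Local Notation Idx := (A * H)%type.

(** The comparison uses only the sign of the second derivatives between different blocks; the signs
    of the values and of the gradient make the property stable under products. *)
Definition cross_increasing (f : (Idx -> R) -> R) := exists G S L,
  [/\ smooth2 f G S L, forall x, 0 <= f x, forall x a, 0 <= G x a &
      forall x a b, a.1 != b.1 -> 0 <= S x a b].

(** The derivatives live in block [c] alone, so [1 - f] has no mixed derivatives between blocks;
    those of the whole functional arise only from products of increasing factors. *)
Definition block_decreasing (c : A) (f : (Idx -> R) -> R) := exists G S L,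
  [/\ smooth2 f G S L, forall x, 0 <= f x <= 1, forall x a, G x a <= 0,
      forall x a, a.1 != c -> G x a = 0 &
      forall x a b, (a.1 != c) || (b.1 != c) -> S x a b = 0].

Lemma cross_increasing1 : cross_increasing (fun=> 1).
Proof. by eexists _, _, _; split; first exact: smooth2_cst. Qed.

Lemma cross_increasing_mul f g : cross_increasing f -> cross_increasing g ->
  cross_increasing (fun x => f x * g x).
Proof.
move=> [G [S [L [sf f0 G0 S0]]]] [G' [S' [L' [sg g0 G0' S0']]]].
eexists _, _, _; split; first exact: (smooth2_mul sf sg).
- by move=> x; rewrite mulr_ge0.
- by move=> x a; rewrite addr_ge0// mulr_ge0.
- by move=> x a b ab; rewrite !addr_ge0// mulr_ge0// ?S0 ?S0'.
Qed.

Lemma block_decreasing1 c : block_decreasing c (fun=> 1).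
Proof. by eexists _, _, _; split; [exact: smooth2_cst|move=> x; rewrite ler01 lexx|..]. Qed.

Lemma block_decreasing_mul c f g : block_decreasing c f -> block_decreasing c g ->
  block_decreasing c (fun x => f x * g x).
Proof.
move=> [G [S [L [sf f0 G0 Gc Sc]]]] [G' [S' [L' [sg g0 G0' Gc' Sc']]]].
eexists _, _, _; split; first exact: (smooth2_mul sf sg).
- by move=> x; have /andP[? ?] := f0 x; have /andP[? ?] := g0 x; rewrite mulr_ge0//= mulr_ile1.
- move=> x a; have /andP[? _] := f0 x; have /andP[? _] := g0 x.
  by have := G0 x a; have := G0' x a; nra.
- by move=> x a ac /=; rewrite Gc// Gc'// !mulr0 addr0.
- move=> x a b ab /=; rewrite Sc// Sc'// !mulr0 add0r.
  by case/orP: ab => h; rewrite (Gc _ _ h) (Gc' _ _ h) ?mul0r ?mulr0 ?addr0.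
Qed.

Lemma block_decreasing_step c h k :
  block_decreasing c (fun x => 1 - smoothstep (x (c, h) - k)).
Proof.
eexists _, _, _; split; first exact: (smooth2_onem (smooth2_smoothstep (c, h) k)).
- by move=> x; rewrite subr_ge0 smoothstep_le1 lerBlDr lerDl smoothstep_ge0.
- by move=> x a; rewrite oppr_le0 mulr_ge0// smoothstep1_ge0.
- move=> x a ac /=; rewrite (_ : (a == (c, h)) = false) ?mul0r ?oppr0//.
  by apply/negbTE; apply: contraNN ac => /eqP ->.
- move=> x a b /=; case/orP => ac.
    rewrite (_ : (a == (c, h)) = false) ?mul0r ?oppr0//.
    by apply/negbTE; apply: contraNN ac => /eqP ->.
  rewrite (_ : (b == (c, h)) = false) ?mul0r ?mulr0 ?oppr0//.
  by apply/negbTE; apply: contraNN ac => /eqP ->.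
Qed.

Lemma cross_increasing_onem c f : block_decreasing c f ->
  cross_increasing (fun x => 1 - f x).
Proof.
move=> [G [S [L [sf f0 G0 Gc Sc]]]].
eexists _, _, _; split; first exact: (smooth2_onem sf).
- by move=> x; rewrite subr_ge0; have /andP[] := f0 x.
- by move=> x a; rewrite oppr_ge0.
- move=> x a b ab /=; rewrite Sc ?oppr0//.
  by have [<-|//] := eqVneq a.1 c; rewrite eq_sym ab orbT.
Qed.

(* A smoothed indicator of the event that every block [c] contains some [h] with
   [k < x (c, h)]. *)
Definition gordonF (k : R) (x : Idx -> R) : R :=
  \prod_(c : A) (1 - \prod_(h : H) (1 - smoothstep (x (c, h) - k))).

Lemma cross_increasing_gordonF k : cross_increasing (gordonF k).
Proof.
rewrite /gordonF; elim: (index_enum A) => [|c s ih].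
  by under eq_fun do rewrite big_nil; exact: cross_increasing1.
under eq_fun do rewrite big_cons.
apply: cross_increasing_mul ih; apply: (@cross_increasing_onem c).
elim: (index_enum H) => [|h r ih].
  by under eq_fun do rewrite big_nil; exact: block_decreasing1.
under eq_fun do rewrite big_cons.
by apply: block_decreasing_mul ih; exact: block_decreasing_step.
Qed.

Lemma gordonF_ge0 k x : 0 <= gordonF k x.
Proof.
apply: prodr_ge0 => c _; rewrite subr_ge0; apply: prodr_ile1 => h _.
by rewrite subr_ge0 smoothstep_le1 lerBlDr lerDl smoothstep_ge0.
Qed.

Lemma gordonF_le1 k x : gordonF k x <= 1.
Proof.
apply: prodr_ile1 => c _; rewrite subr_ge0 lerBlDr lerDl; apply/andP; split.
  apply: prodr_ile1 => h _.
  by rewrite subr_ge0 smoothstep_le1 lerBlDr lerDl smoothstep_ge0.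
by apply: prodr_ge0 => h _; rewrite subr_ge0 smoothstep_le1.
Qed.

(** The smoothing has width 1: level [k + 1] in every block forces the value 1, whereas by
    [gordonF_gt0] a nonzero value gives back only level [k]. *)
Lemma gordonF_eq1 k x : (forall c, exists h, k + 1 <= x (c, h)) -> gordonF k x = 1.
Proof.
move=> e; rewrite /gordonF big1// => c _; have [h hx] := e c.
rewrite (bigD1 h)//= smoothstep_ge1 ?subrr ?mul0r ?subr0//; lra.
Qed.

Lemma gordonF_gt0 k x c : gordonF k x != 0 -> exists h, k < x (c, h).
Proof.
move=> F0; apply: contrapT => /forallNP e; move/eqP: F0; apply.
rewrite /gordonF (bigD1 c)//= big1 ?subrr ?mul0r// => h _.
by rewrite smoothstep_le0 ?subr0//; have /negP := e h; rewrite -leNgt; lra.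
Qed.

End gordon_functional.

Section probability_mean.
Context d (T : measurableType d) (R : realType) (P : probability T R).

Lemma integrable_bounded (f : T -> R) (M : R) : measurable_fun [set: T] f ->
  (forall x, `|f x| <= M) -> P.-integrable setT (EFin \o f).
Proof.
move=> mf fM; apply: measurable_bounded_integrable => //.
  by apply: le_lt_trans (probability_le1 P measurableT) _; rewrite ltry.
exists M; split; first exact: num_real.
by move=> y My x _; exact: le_trans (fM x) (ltW My).
Qed.

Lemma Rintegral_cst_prob (c : R) : (\int[P]_x c)%R = c.
Proof.
apply: etrans (Rintegral_cst P measurableT c) _.
transitivity (c * fine (1%E : \bar R)); last by rewrite mulr1.
by congr (_ * fine _); exact: probability_setT.
Qed.

Lemma integral_cst_prob (c : \bar R) : (\int[P]_x c = c)%E.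
Proof.
apply: etrans (integral_cst P measurableT c) _; rewrite -[RHS]mule1.
by congr (_ * _)%E; exact: probability_setT.
Qed.

Lemma EFin_Rintegral (f : T -> R) : P.-integrable setT (EFin \o f) ->
  ((\int[P]_x f x)%R)%:E = (\int[P]_x (f x)%:E)%E.
Proof. by move=> fi; rewrite /Rintegral fineK//; exact: integrable_fin_num. Qed.

Lemma integrable_sumr (J : Type) (s : seq J) (f : J -> T -> R) :
  (forall j, P.-integrable setT (EFin \o f j)) ->
  P.-integrable setT (EFin \o (fun x => \sum_(j <- s) f j x)).
Proof.
move=> fi.
rewrite (_ : _ \o _ = (fun x => (\sum_(j <- s) (f j x)%:E)%E)).
  by apply: integrable_sum => // j _; exact: fi.
by apply/funext => x /=; rewrite sumEFin.
Qed.

Lemma Rintegral_sumr (J : Type) (s : seq J) (f : J -> T -> R) :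
  (forall j, P.-integrable setT (EFin \o f j)) ->
  (\int[P]_x (\sum_(j <- s) f j x))%R = \sum_(j <- s) (\int[P]_x f j x)%R.
Proof.
move=> fi; elim: s => [|j s ih].
  by under eq_Rintegral do rewrite big_nil; rewrite Rintegral_cst_prob big_nil.
under eq_Rintegral do rewrite big_cons.
by rewrite RintegralD//; [rewrite ih big_cons|exact: integrable_sumr].
Qed.

End probability_mean.

(** * Interpolation between two Gaussian processes *)

Section gordon.
Context {R : realType} (I A H : finType).
Local Notation TR := (measurableTypeR R).
Local Notation gam := (@gaussI R I).
Local Notation gsp := (@gspace R I).
Local Notation co := (@gco R I).
Local Notation Idx := (A * H)%type.
Implicit Types u v : Idx -> I -> R.

Definition linI u (z : I -> R) : Idx -> R := fun a => lin (u a) z.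
Definition cov u (a b : Idx) : R := \sum_i u a i * u b i.

Lemma measurable_clip : measurable_fun [set: TR] (@clip R : TR -> TR).
Proof. by apply: measurable_maxr => //; exact: measurable_minr. Qed.

Lemma measurable_smoothstep : measurable_fun [set: TR] (@smoothstep R : TR -> TR).
Proof.
have mc := measurable_clip.
apply: measurable_funM; first exact: measurable_funX.
apply: measurable_funD; last by apply: measurable_funM => //; exact: measurable_funX.
by apply: measurable_funB => //; exact: measurable_funM.
Qed.

Lemma measurable_gordonF k d (T : measurableType d) (X : Idx -> T -> R) :
  (forall a, measurable_fun [set: T] (X a : T -> TR)) ->
  measurable_fun [set: T] (fun w => gordonF k (fun a => X a w)).
Proof.
move=> mX; apply: measurable_prod => c _; apply: measurable_funB => //.
apply: measurable_prod => h _; apply: measurable_funB => //.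
have mXk : measurable_fun [set: T] (fun w => X (c, h) w - k : TR) by apply: measurable_funB => //; exact: mX.
exact: (measurableT_comp measurable_smoothstep mXk).
Qed.

Definition absI u : R := \sum_a \sum_i `|u a i|.

Lemma nrm1_linI u (r : R) (z : gsp) : 0 <= r ->
  nrm1 (fun a => r * linI u (co z) a) <= r * (absI u * l1z z).
Proof.
move=> r0; rewrite /nrm1 /absI mulr_suml mulr_sumr ler_sum// => a _.
by rewrite normrM ger0_norm// ler_wpM2l// le_lin.
Qed.

Lemma integrable_l1z3 : gam.-integrable setT (EFin \o (fun z => l1z z ^+ 3)).
Proof.
apply: (@integrable_gaussI _ _ (fun z => l1z z ^+ 3) 27).
  by apply: measurable_funX; exact: measurable_l1z.
move=> z; rewrite ger0_norm ?exprn_ge0 ?l1z_ge0//.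
exact/le_expR3/l1z_ge0.
Qed.

Section mean_taylor.
Variables (f : (Idx -> R) -> R) (G : (Idx -> R) -> Idx -> R).
Variables (S : (Idx -> R) -> Idx -> Idx -> R) (L : R).
Hypothesis sf : smooth2 f G S L.
Hypothesis mf : forall X : Idx -> gsp -> R,
  (forall a, measurable_fun [set: gsp] (X a : gsp -> TR)) ->
  measurable_fun [set: gsp] (fun z => f (fun a => X a z)).

Lemma measurable_shift u x r :
  measurable_fun [set: gsp] (fun z => f (x \+ (fun a => r * linI u (co z) a))).
Proof.
apply: mf => a; apply: measurable_funD => //; apply: measurable_funM => //.
exact: measurable_lin.
Qed.

Lemma integrable_shift u x r :
  gam.-integrable setT (EFin \o (fun z => f (x \+ (fun a => r * linI u (co z) a)))).
Proof.
apply: (@integrable_bounded _ _ _ gam _ L); first exact: measurable_shift.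
by move=> z; exact: (s2f sf).
Qed.

(** The linear term is centred, the quadratic term averages to the covariance, and the cubic
    remainder is at most a multiple of the integrable [l1z z ^+ 3]. *)
Lemma mean_taylor u x r : 0 <= r ->
  `|(\int[gam]_z f (x \+ (fun a => (r : R) * linI u (co z) a)))%R
    - (f x + 2^-1 * r ^+ 2 * \sum_a \sum_b S x a b * cov u a b)|
  <= L * absI u ^+ 3 * (\int[gam]_z l1z z ^+ 3)%R * r ^+ 3.
Proof.
move=> r0.
pose w z : Idx -> R := fun a => r * linI u (co z) a.
pose g i := \sum_a G x a * u a i.
pose T1 z := r * lin g (co z).
pose T2 z := \sum_a \sum_b (S x a b * (lin (u a) (co z) * lin (u b) (co z))).
have T1E z : dot1 (G x) (w z) = T1 z.
  rewrite /dot1 /T1 /w /linI /lin mulr_sumr.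
  under eq_bigr do rewrite !mulr_sumr.
  rewrite exchange_big/=; apply: eq_bigr => i _; rewrite /g mulr_suml mulr_sumr.
  by apply: eq_bigr => a _; ring.
have T2E z : dot2 (S x) (w z) = r ^+ 2 * T2 z.
  rewrite /dot2 /T2 mulr_sumr; apply: eq_bigr => a _; rewrite mulr_sumr.
  by apply: eq_bigr => b _; rewrite /w /linI; ring.
have iT1 : gam.-integrable setT (EFin \o T1).
  rewrite (_ : _ \o _ = (fun z => r%:E * (lin g (co z))%:E)%E); last by apply/funext.
  by apply: integrableZl => //; exact: integrable_lin.
have iS a b : gam.-integrable setT (EFin \o (fun z => S x a b * (lin (u a) (co z) * lin (u b) (co z)))).
  rewrite (_ : _ \o _ = (fun z => (S x a b)%:E * (lin (u a) (co z) * lin (u b) (co z))%:E)%E); last by apply/funext.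
  by apply: integrableZl => //; exact: integrable_lin2.
have iT2 : gam.-integrable setT (EFin \o T2).
  by apply: integrable_sumr => a; exact: integrable_sumr.
have ET1 : (\int[gam]_z T1 z)%R = 0.
  by rewrite RintegralZl ?Rintegral_lin ?mulr0//; exact: integrable_lin.
have ET2 : (\int[gam]_z T2 z)%R = \sum_a \sum_b S x a b * cov u a b.
  rewrite Rintegral_sumr; last by move=> a; exact: integrable_sumr.
  apply: eq_bigr => a _; rewrite Rintegral_sumr//; apply: eq_bigr => b _.
  by rewrite RintegralZl ?Rintegral_lin2//; exact: integrable_lin2.
pose D z := f (x \+ w z) - f x - T1 z - 2^-1 * (r ^+ 2 * T2 z).
have mD : measurable_fun [set: gsp] D.
  have m1 : measurable_fun [set: gsp] T1 by apply/measurable_EFinP; exact: measurable_int iT1.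
  have m2 : measurable_fun [set: gsp] T2 by apply/measurable_EFinP; exact: measurable_int iT2.
  apply: measurable_funB; last by apply: measurable_funM => //; exact: measurable_funM.
  by apply: measurable_funB => //; apply: measurable_funB => //; exact: measurable_shift.
have l30 z : 0 <= l1z z ^+ 3 by rewrite exprn_ge0// l1z_ge0.
have DB z : `|D z| <= L * absI u ^+ 3 * r ^+ 3 * l1z z ^+ 3.
  have := s2d3 sf x (w z); rewrite T1E T2E => /le_trans; apply.
  rewrite -!mulrA ler_wpM2l ?(s2L sf)//.
  rewrite (_ : _ * (_ * _) = (r * (absI u * l1z z)) ^+ 3); last by ring.
  by rewrite lerXn2r ?nnegrE ?nrm1_ge0 ?nrm1_linI// !mulr_ge0 ?l1z_ge0// sumr_ge0// => a _; exact: sumr_ge0.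
pose cB := L * absI u ^+ 3 * r ^+ 3.
have iB : gam.-integrable setT (EFin \o (fun z => cB * l1z z ^+ 3)).
  rewrite (_ : _ \o _ = (fun z => cB%:E * (l1z z ^+ 3)%:E)%E); last by apply/funext.
  by apply: integrableZl => //; exact: integrable_l1z3.
have iD : gam.-integrable setT (EFin \o D).
  apply: (le_integrable measurableT _ _ iB); first exact/measurable_EFinP.
  by move=> z _ /=; rewrite lee_fin; apply: (le_trans (DB z)); exact: ler_norm.
have iF := integrable_shift u x r.
have iT : gam.-integrable setT (EFin \o (fun z => 2^-1 * r ^+ 2 * T2 z)).
  rewrite (_ : _ \o _ = (fun z => (2^-1 * r ^+ 2)%:E * (T2 z)%:E)%E); last by apply/funext.
  exact: integrableZl.
have -> : (\int[gam]_z f (x \+ w z))%R =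
    (\int[gam]_z D z)%R + (f x + 2^-1 * r ^+ 2 * \sum_a \sum_b S x a b * cov u a b).
  rewrite -ET2 -[f x in RHS](Rintegral_cst_prob gam) -RintegralZl//.
  have ic : gam.-integrable setT (EFin \o (fun _ : gsp => f x)).
    exact: (@integrable_bounded _ _ _ gam _ `|f x|).
  rewrite -RintegralD//.
  rewrite -[X in _ = X + _]addr0 -ET1 -RintegralD// -RintegralD//.
  - by apply: eq_Rintegral => z _; rewrite /D; ring.
  - exact: (integrableD measurableT iD iT1).
  - exact: (integrableD measurableT ic iT).
rewrite addrK; apply: (le_trans (le_normr_Rintegral measurableT iD)).
rewrite mulrAC -RintegralZl//; last exact: integrable_l1z3.
apply: le_Rintegral => //.
- exact: (@integrable_norm _ _ _ gam).
Qed.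

End mean_taylor.

(** A Gaussian vector of variance [a + b] splits into independent parts of variances [a] and [b].
    With [a + b] as scale this is [gauss_family_stable]; a zero total variance makes both sides
    constant. *)
Lemma gaussI_split (phi : (I -> R) -> \bar R) (a b : R) : 0 <= a -> 0 <= b ->
  (forall x, 0 <= phi x)%E ->
  (forall d (T : measurableType d) (X : I -> T -> R),
    (forall i, measurable_fun [set: T] (X i : T -> TR)) ->
    measurable_fun [set: T] (fun w => phi (X ^~ w))) ->
  (\int[gam]_z phi (fun i => Num.sqrt (a + b) * co z i)%R =
   \int[gam]_z \int[gam]_y phi (fun i => Num.sqrt a * co z i + Num.sqrt b * co y i)%R)%E.
Proof.
move=> a0 b0 phi0 mphi.
have [ab0|abN0] := eqVneq (a + b) 0.
  have [-> ->] : a = 0 /\ b = 0 by split; lra.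
  apply: eq_integral => z _; rewrite addr0 sqrtr0.
  transitivity (\int[gam]_y phi (fun i => 0 * co z i)%R)%E.
    exact/esym/integral_cst_prob.
  by apply: eq_integral => y _; congr phi; apply/funext => i; rewrite !mul0r addr0.
have ab : 0 < a + b by rewrite lt_def abN0 addr_ge0.
pose c := Num.sqrt (a / (a + b)); pose e := Num.sqrt (b / (a + b)).
have ce : c ^+ 2 + e ^+ 2 = 1.
  have h1 : 0 <= a / (a + b) by rewrite divr_ge0// ltW.
  have h2 : 0 <= b / (a + b) by rewrite divr_ge0// ltW.
  by rewrite /c /e (sqr_sqrtr h1) (sqr_sqrtr h2) -mulrDl divff.
have fam := @gauss_family_stable R I (fun=> c) (fun=> e) (fun=> sqrtr_ge0 _) (fun=> sqrtr_ge0 _) (fun=> ce).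
pose psi (x : I -> R) := phi (fun i => Num.sqrt (a + b) * x i).
have mpsi : measurable_fun [set: gsp] (fun z => psi (co z)).
  by apply: mphi => i; apply: measurable_funM => //; exact: measurable_gco.
rewrite -[LHS](ge0_integral_gauss_family fam mpsi (fun x => phi0 _)).
rewrite fubini_tonelli1; last 2 first.
- apply: (mphi _ _ (fun i (w : gsp * gsp) => Num.sqrt (a + b) * (c * co w.1 i + e * co w.2 i))) => i.
  by apply: measurable_funM => //; exact: (fam.1 i).
- by move=> x; exact: phi0.
apply: eq_integral => z _; apply: eq_integral => y _; congr phi; apply/funext => i /=.
rewrite mulrDr !mulrA -!sqrtrM ?ltW//.
by rewrite ![(a + b) * _]mulrC !divfK.
Qed.

Variables (k : R) (u v : Idx -> I -> R).
Hypothesis cov_block : forall a b, a.1 = b.1 -> cov u a b = cov v a b.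
Hypothesis cov_cross : forall a b, a.1 != b.1 -> cov v a b <= cov u a b.
Local Notation F := (@gordonF R A H k).

(** The second-order terms agree inside blocks, where the covariances coincide, and are ordered
    across blocks, where the Hessian is nonnegative. The constant does not depend on the base point
    [x], which allows integration over it. *)
Lemma gordon_step : exists2 C : R, 0 <= C & forall x r, 0 <= r ->
  (\int[gam]_z (F (x \+ (fun a => r * linI v (co z) a)))%:E <=
   \int[gam]_z (F (x \+ (fun a => r * linI u (co z) a)))%:E + (C * r ^+ 3)%:E)%E.
Proof.
have [G [S [L [sF F0 G0 S0]]]] := cross_increasing_gordonF A H k.
have mF (X : Idx -> gsp -> R) :
    (forall a, measurable_fun [set: gsp] (X a : gsp -> TR)) ->
    measurable_fun [set: gsp] (fun z => F (fun a => X a z)).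
  exact: measurable_gordonF.
pose M := (\int[gam]_z l1z z ^+ 3)%R.
have M0 : 0 <= M by apply: Rintegral_ge0 => z _; rewrite exprn_ge0// l1z_ge0.
have abs0 w : 0 <= absI w by rewrite sumr_ge0// => a _; exact: sumr_ge0.
exists (L * absI u ^+ 3 * M + L * absI v ^+ 3 * M).
  by rewrite addr_ge0// !mulr_ge0 ?exprn_ge0// (s2L sF).
move=> x r r0.
have iu := integrable_shift sF mF u x r.
have iv := integrable_shift sF mF v x r.
rewrite -(EFin_Rintegral iu) -(EFin_Rintegral iv) -EFinD lee_fin.
have := mean_taylor sF mF u x r0; have := mean_taylor sF mF v x r0.
rewrite -/M => /ler_normlP[hv1 hv2] /ler_normlP[hu1 hu2].
suff hS : 2^-1 * r ^+ 2 * (\sum_a \sum_b S x a b * cov v a b) <=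
   2^-1 * r ^+ 2 * (\sum_a \sum_b S x a b * cov u a b).
  rewrite mulrDl; lra.
rewrite ler_wpM2l ?mulr_ge0 ?sqr_ge0//.
apply: ler_sum => a _; apply: ler_sum => b _.
have [ab|ab] := eqVneq a.1 b.1; first by rewrite cov_block.
by rewrite ler_wpM2l ?S0// cov_cross.
Qed.

(** Gaussian interpolation: [Phi] starts at the process of [u] for [t = 0] and ends at that of [v]
    for [t = 1]. *)
Let W (r s : R) (z y : I -> R) : Idx -> R := fun a => r * linI u z a + s * linI v y a.
Let Phi (t : R) : \bar R :=
  (\int[gam]_z \int[gam]_y (F (W (Num.sqrt (1 - t)) (Num.sqrt t) (co z) (co y)))%:E)%E.

Lemma linI_comb w (r s : R) (z y : I -> R) a :
  linI w (fun i => r * z i + s * y i) a = r * linI w z a + s * linI w y a.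
Proof.
rewrite /linI /lin !mulr_sumr -big_split/=; apply: eq_bigr => i _; ring.
Qed.

Lemma linI_scale w (r : R) (z : I -> R) a : linI w (fun i => r * z i) a = r * linI w z a.
Proof. by rewrite /linI /lin mulr_sumr; apply: eq_bigr => i _; ring. Qed.

Lemma measurable_linI w d (T : measurableType d) (X : I -> T -> R) a :
  (forall i, measurable_fun [set: T] (X i : T -> TR)) ->
  measurable_fun [set: T] (fun t => linI w (X ^~ t) a : TR).
Proof. by move=> mX; apply: measurable_sum => i; apply: measurable_funM => //; exact: mX. Qed.

Let F0 x : (0 <= (F x)%:E)%E. Proof. by rewrite lee_fin gordonF_ge0. Qed.

Let mco1 d (T : measurableType d) i : measurable_fun [set: (gsp * T)%type] (fun z : gsp * T => co z.1 i : TR).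
Proof. exact: (measurableT_comp (measurable_gco i) measurable_fst). Qed.

Let mco2 d (T : measurableType d) i : measurable_fun [set: (T * gsp)%type] (fun z : T * gsp => co z.2 i : TR).
Proof. exact: (measurableT_comp (measurable_gco i) measurable_snd). Qed.

(** At time [t] an increment of variance [s] is detached from the [u] part; [Phi_split_v] detaches
    one from the [v] part at time [t + s]. Both leave the same base point, so only the laws of the
    increments have to be compared. *)
Lemma Phi_split_u (t s : R) : 0 <= t -> 0 <= s -> t + s <= 1 ->
  (Phi t = \int[gam]_z \int[gam]_y \int[gam]_x
    (F (W (Num.sqrt (1 - t - s)) (Num.sqrt t) (co z) (co y) \+
        (fun a => Num.sqrt s * linI u (co x) a)))%:E)%E.
Proof.
move=> t0 s0 ts.
pose phi (x : I -> R) : \bar R := (\int[gam]_y (F (W 1 (Num.sqrt t) x (co y)))%:E)%E.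
have phi0 x : (0 <= phi x)%E by apply: integral_ge0.
have mphi d (T : measurableType d) (X : I -> T -> R) :
    (forall i, measurable_fun [set: T] (X i : T -> TR)) ->
    measurable_fun [set: T] (fun w => phi (X ^~ w)).
  move=> mX.
  pose h (z : T * gsp) : \bar R := (F (W 1 (Num.sqrt t) (X ^~ z.1) (co z.2)))%:E.
  have mh : measurable_fun setT h.
    apply/measurable_EFinP; apply: measurable_gordonF => a.
    apply: measurable_funD; apply: measurable_funM => //; apply: measurable_linI.
      by move=> i; exact: (measurableT_comp (mX i) measurable_fst).
    by move=> i; exact: mco2.
  have := measurable_fun_fubini_tonelli_F h mh (fun z => F0 _).
  by move=> /(_ gam).
have := @gaussI_split phi (1 - t - s) s _ s0 phi0 mphi.
rewrite subrK => /(_ (ltac:(lra))).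
have E1 (z : gsp) : phi (fun i => Num.sqrt (1 - t) * co z i) =
    (\int[gam]_y (F (W (Num.sqrt (1 - t)) (Num.sqrt t) (co z) (co y)))%:E)%E.
  apply: eq_integral => y _; congr (F _)%:E; apply/funext => a.
  by rewrite /W linI_scale mul1r.
under eq_integral do rewrite E1.
rewrite -/(Phi t) => ->.
apply: eq_integral => z _.
pose h (p : gsp * gsp) : \bar R := (F (W (Num.sqrt (1 - t - s)) (Num.sqrt t) (co z) (co p.2) \+
        (fun a => Num.sqrt s * linI u (co p.1) a)))%:E.
transitivity (\int[gam]_x \int[gam]_y h (x, y))%E.
  apply: eq_integral => x _; apply: eq_integral => y _; congr (F _)%:E; apply/funext => a.
  by rewrite /W /= linI_comb mul1r addrAC.
rewrite (@fubini_tonelli _ _ _ _ _ gam gam h)//; last by move=> p; exact: F0.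
apply/measurable_EFinP; apply: measurable_gordonF => a.
apply: measurable_funD; last by apply: measurable_funM => //; apply: measurable_linI => i; exact: mco1.
apply: measurable_funD; first exact: measurable_cst.
by apply: measurable_funM => //; apply: measurable_linI => i; exact: mco2.
Qed.

Lemma Phi_split_v (t s : R) : 0 <= t -> 0 <= s -> t + s <= 1 ->
  (Phi (t + s) = \int[gam]_z \int[gam]_y \int[gam]_x
    (F (W (Num.sqrt (1 - t - s)) (Num.sqrt t) (co z) (co y) \+
        (fun a => Num.sqrt s * linI v (co x) a)))%:E)%E.
Proof.
move=> t0 s0 ts; apply: eq_integral => z _.
pose phi (y : I -> R) : \bar R := (F (W (Num.sqrt (1 - t - s)) 1 (co z) y))%:E.
have mphi d (T : measurableType d) (X : I -> T -> R) :
    (forall i, measurable_fun [set: T] (X i : T -> TR)) ->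
    measurable_fun [set: T] (fun w => phi (X ^~ w)).
  move=> mX; apply/measurable_EFinP; apply: measurable_gordonF => a.
  apply: measurable_funD; first exact: measurable_cst.
  by apply: measurable_funM => //; exact: measurable_linI.
have := @gaussI_split phi t s t0 s0 (fun=> F0 _) mphi.
have E1 (y : gsp) : phi (fun i => Num.sqrt (t + s) * co y i) =
    (F (W (Num.sqrt (1 - (t + s))) (Num.sqrt (t + s)) (co z) (co y)))%:E.
  by congr (F _)%:E; apply/funext => a; rewrite /W linI_scale mul1r opprD addrA.
under eq_integral do rewrite E1.
move=> ->; apply: eq_integral => y _; apply: eq_integral => x _; congr (F _)%:E.
by apply/funext => a; rewrite /W /= linI_comb mul1r addrA.
Qed.

Lemma Phi_step : exists2 C : R, 0 <= C & forall t s, 0 <= t -> 0 <= s -> t + s <= 1 ->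
  (Phi (t + s) <= Phi t + (C * Num.sqrt s ^+ 3)%:E)%E.
Proof.
have [C C0 step] := gordon_step; exists C => // t s t0 s0 ts.
rewrite (Phi_split_u t0 s0 ts) (Phi_split_v t0 s0 ts).
set r := Num.sqrt s; set e := (C * r ^+ 3)%:E.
have r0 : 0 <= r by exact: sqrtr_ge0.
have e0 : (0 <= e)%E by rewrite lee_fin mulr_ge0// exprn_ge0.
pose X w (z y x : gsp) := (F (W (Num.sqrt (1 - t - s)) (Num.sqrt t) (co z) (co y) \+
        (fun a => r * linI w (co x) a)))%:E.
have mX3 w : measurable_fun [set: (gsp * gsp) * gsp] (fun p : (gsp * gsp) * gsp => X w p.1.1 p.1.2 p.2).
  apply/measurable_EFinP; apply: measurable_gordonF => a.
  apply: measurable_funD; last by apply: measurable_funM => //; apply: measurable_linI => i; exact: mco2.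
  apply: measurable_funD; apply: measurable_funM => //; apply: measurable_linI => i.
    exact: (measurableT_comp (mco1 i) measurable_fst).
  exact: (measurableT_comp (mco2 i) measurable_fst).
have mX2 w : measurable_fun [set: gsp * gsp] (fun p : gsp * gsp => \int[gam]_x X w p.1 p.2 x)%E.
  have := measurable_fun_fubini_tonelli_F _ (mX3 w) (fun z => F0 _).
  by move=> /(_ gam).
have X30 w z y : (0 <= \int[gam]_x X w z y x)%E.
  by apply: integral_ge0 => x _; exact: F0.
have X20 w p : (0 <= \int[gam]_x X w p.1 p.2 x)%E by exact: X30.
have X10 w z : (0 <= \int[gam]_y \int[gam]_x X w z y x)%E.
  by apply: integral_ge0 => y _; exact: X30.
have mX1 w : measurable_fun [set: gsp] (fun z : gsp => \int[gam]_y \int[gam]_x X w z y x)%E.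
  have := measurable_fun_fubini_tonelli_F _ (mX2 w) (X20 w).
  by move=> /(_ gam).
have mX2' w z : measurable_fun [set: gsp] (fun y : gsp => \int[gam]_x X w z y x)%E.
  exact: (measurableT_comp (mX2 w) (measurable_pair1 z)).
have cst_int (h : gsp -> \bar R) : measurable_fun [set: gsp] h -> (forall z, 0 <= h z)%E ->
    (\int[gam]_z (h z + e) = \int[gam]_z h z + e)%E.
  move=> mh h0; rewrite ge0_integralD//.
  by congr (_ + _)%E; exact: integral_cst_prob.
rewrite -(cst_int _ (mX1 u) (X10 u)).
apply: ge0_le_integral => //;
  [by move=> z _; exact: X10|exact: (mX1 v)|exact: emeasurable_funD|].
move=> z _; rewrite -(cst_int _ (mX2' u z) (X30 u z)).
apply: ge0_le_integral => //;
  [by move=> y _; exact: X30|exact: (mX2' v z)|exact: emeasurable_funD|].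
by move=> y _; exact: step.
Qed.

Theorem gordon : (\int[gam]_z (F (linI v (co z)))%:E <= \int[gam]_z (F (linI u (co z)))%:E)%E.
Proof.
have [C C0 step] := Phi_step.
have P0 : Phi 0 = (\int[gam]_z (F (linI u (co z)))%:E)%E.
  apply: eq_integral => z _.
  transitivity (\int[gam]_y (F (linI u (co z)))%:E)%E.
    apply: eq_integral => y _; congr (F _)%:E; apply/funext => a.
    by rewrite /W subr0 sqrtr1 sqrtr0 mul1r mul0r addr0.
  exact: integral_cst_prob.
have P1 : Phi 1 = (\int[gam]_z (F (linI v (co z)))%:E)%E.
  transitivity (\int[gam]_z \int[gam]_y (F (linI v (co y)))%:E)%E.
    apply: eq_integral => z _; apply: eq_integral => y _; congr (F _)%:E; apply/funext => a.
    by rewrite /W subrr sqrtr1 sqrtr0 mul1r mul0r add0r.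
  exact: integral_cst_prob.
rewrite -P0 -P1; apply/lee_addgt0Pr => e e0.
(* With [M + 1] steps of size [s] the accumulated error is [C * sqrt s], and this choice makes it at
   most [e]. *)
pose M := Num.trunc ((C / e) ^+ 2).
pose s : R := M.+1%:R^-1.
have s0 : 0 < s by rewrite invr_gt0.
have iter j : (j <= M.+1)%N -> (Phi (j%:R * s) <= Phi 0 + (j%:R * (C * Num.sqrt s ^+ 3))%:E)%E.
  elim: j => [|j ih] jM; first by rewrite !mul0r adde0.
  rewrite -natr1 mulrDl mul1r; apply: (le_trans (step _ _ _ _ _)).
  - by rewrite mulr_ge0// ltW.
  - exact: ltW.
  - by rewrite -[X in _ + X]mul1r -mulrDl natr1 /s ler_pdivrMr// mul1r ler_nat.
  have ih' := ih (ltnW jM).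
  set X := C * Num.sqrt s ^+ 3 in ih' *.
  have -> : ((j%:R + 1) * X)%:E = ((j%:R * X)%:E + X%:E)%E by rewrite -EFinD mulrDl mul1r.
  move: (Phi 0) (Phi (j%:R * s)) (X%:E) ih' => a b x ih'.
  by rewrite addeA; exact: (leeD2r x ih').
have := iter M.+1 (leqnn _); rewrite /s mulfV// -/s => /le_trans; apply.
apply: leeD2l; rewrite lee_fin.
have -> : M.+1%:R = s^-1 by rewrite /s invrK.
have ss : Num.sqrt s ^+ 2 = s by rewrite sqr_sqrtr// ltW.
rewrite exprSr ss (_ : _ * _ = C * Num.sqrt s); last by field; rewrite gt_eqF.
rewrite -(@ler_pXn2r _ 2)// ?nnegrE; [|by rewrite mulr_ge0 ?sqrtr_ge0|exact: ltW].
rewrite exprMn ss /s ler_pdivrMr// -ler_pdivrMl ?exprn_gt0// mulrC -expr_div_n.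
by apply/ltW/truncnS_gt; rewrite sqr_ge0.
Qed.

End gordon.

(** * Chernoff bounds *)

Section chernoff.
Context {R : realType}.
Local Notation gauss := (normal_prob (0 : R) 1).
Local Notation TR := (measurableTypeR R).

(** Both signs come from [exp u (1 - u) <= 1]: iterate it for [u >= 0], and compare with
    [(1 - u) (1 + u + u^2) = 1 - u^3 >= 1] for [u < 0]. *)
Lemma expR_le_quadratic (u : R) : expR u <= 1 + u + u ^+ 2 * expR `|u|.
Proof.
have [u0|u0] := leP 0 u.
  rewrite ger0_norm//.
  have h : expR u * (1 - u) <= 1.
    have := expR_ge1Dx (- u); rewrite expRN => h.
    have := ler_wpM2l (expR_ge0 u) h; rewrite divff ?gt_eqF ?expR_gt0//.
  have e0 := expR_ge0 u; nra.
rewrite ltr0_norm//.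
have v0 : 0 < - u by rewrite oppr_gt0.
have h : expR u * (1 - u) <= 1.
  have := expR_ge1Dx (- u); rewrite expRN => h.
  have := ler_wpM2l (expR_ge0 u) h; rewrite divff ?gt_eqF ?expR_gt0//.
have h1 : 1 <= expR (- u) by have := expR_ge1Dx (- u); lra.
have h2 : u ^+ 2 <= u ^+ 2 * expR (- u) by rewrite ler_peMr// sqr_ge0.
have e0 := expR_gt0 u.
have : (1 - u) * (1 + u + u ^+ 2 - expR u) >= 0.
  have : (1 - u) * (1 + u + u ^+ 2) >= 1 by nra.
  nra.
rewrite pmulr_rge0; last by lra.
lra.
Qed.

Lemma sqr_le_exp_sqr (x : R) : (1 + x ^+ 2) ^+ 2 <= 256 * expR (x ^+ 2 / 8).
Proof.
have h := expR_ge1Dx (x ^+ 2 / 16).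
have -> : expR (x ^+ 2 / 8) = expR (x ^+ 2 / 16) ^+ 2.
  by rewrite [RHS]expr2 -expRD; congr expR; field.
have x0 := sqr_ge0 x.
rewrite (_ : 256 = 16 ^+ 2); last by ring.
rewrite -exprMn lerXn2r ?nnegrE ?mulr_ge0 ?expR_ge0//; lra.
Qed.

Lemma le1Dsqr_exp (x : R) : 1 + x ^+ 2 <= 4 * expR (x ^+ 2 / 4).
Proof. by have := expR_ge1Dx (x ^+ 2 / 4); lra. Qed.

Section mgf.
Variables (psi : R -> R) (C : R).
Hypothesis C0 : 0 < C.
Hypothesis mpsi : measurable_fun [set: TR] psi.
Hypothesis psiC : forall x, `|psi x| <= C * (1 + x ^+ 2).

Lemma integrable_quadratic : gauss.-integrable [set: R] (EFin \o psi).
Proof.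
apply: (@gauss_integrable _ _ (C * 4)) => // x.
apply: (le_trans (psiC x)); rewrite -mulrA ler_wpM2l ?(ltW C0)//.
exact: le1Dsqr_exp.
Qed.

(** The bound on [t * C] keeps [exp |t psi|] below [2 exp(x^2 / 8)]; with [sqr_le_exp_sqr] the
    quadratic error is [512 C^2 t^2 exp(x^2 / 4)], whose mean carries a factor [sqrt 2 <= 2]. *)
Lemma gauss_mgf (t : R) : 0 <= t -> t * C <= 1 / 8 ->
  (\int[gauss]_x (expR (t * psi x))%:E <=
   (expR (t * (\int[gauss]_x psi x)%R + 1024 * C ^+ 2 * t ^+ 2))%:E)%E.
Proof.
move=> t0 tC.
have e18 : expR (1 / 8) <= 2 :> R.
  have := expR_ge1Dx (- (1 / 8) : R); rewrite expRN => h.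
  have h3 := expR_gt0 (1 / 8 : R).
  have := ler_wpM2l (ltW h3) h; rewrite divff ?gt_eqF//; lra.
have bnd x : expR (t * psi x) <= 1 + t * psi x + 512 * C ^+ 2 * t ^+ 2 * expR (x ^+ 2 / 4).
  apply: (le_trans (expR_le_quadratic _)); rewrite lerD2l.
  have x0 := sqr_ge0 x.
  have a1 : `|t * psi x| <= (1 + x ^+ 2) / 8.
    rewrite normrM ger0_norm//; have := ler_wpM2l t0 (psiC x); nra.
  have a2 : (t * psi x) ^+ 2 <= t ^+ 2 * C ^+ 2 * (1 + x ^+ 2) ^+ 2.
    rewrite exprMn -mulrA ler_wpM2l ?sqr_ge0// -exprMn -(real_normK (num_real (psi x))).
    by rewrite lerXn2r ?nnegrE ?mulr_ge0// ?ltW//; lra.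
  have a3 : expR `|t * psi x| <= 2 * expR (x ^+ 2 / 8).
    apply: (@le_trans _ _ (expR (1 / 8) * expR (x ^+ 2 / 8))).
      rewrite -expRD ler_expR; lra.
    by rewrite ler_wpM2r ?expR_ge0.
  apply: (@le_trans _ _ ((t ^+ 2 * C ^+ 2 * (256 * expR (x ^+ 2 / 8))) * (2 * expR (x ^+ 2 / 8)))).
    apply: ler_pM => //; rewrite ?sqr_ge0 ?expR_ge0//.
    apply: (le_trans a2); rewrite ler_wpM2l ?sqr_le_exp_sqr//; last by rewrite mulr_ge0 ?sqr_ge0.
  have -> : expR (x ^+ 2 / 4) = expR (x ^+ 2 / 8) * expR (x ^+ 2 / 8).
    by rewrite -expRD; congr expR; field.
  by rewrite le_eqVlt; apply/orP; left; apply/eqP; ring.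
have ie : gauss.-integrable [set: R] (EFin \o (fun x : R => expR (x ^+ 2 / 4))).
  apply: (@gauss_integrable _ _ 1).
    apply: measurableT_comp => //.
    by apply: measurable_funM => //; exact: measurable_funX.
  by move=> x; rewrite mul1r ger0_norm// expR_ge0.
have ip := integrable_quadratic.
set K := 512 * C ^+ 2 * t ^+ 2 in bnd *.
have K0 : 0 <= K.
  by apply: mulr_ge0; last exact: sqr_ge0; apply: mulr_ge0; [exact: ler0n|exact: sqr_ge0].
pose g x := 1 + t * psi x + K * expR (x ^+ 2 / 4).
have i1 : gauss.-integrable [set: R] (EFin \o (fun=> 1 : R)).
  by apply: (@integrable_bounded _ TR R gauss _ 1) => // x; rewrite normr1.
have i2 : gauss.-integrable [set: R] (EFin \o (fun x => t * psi x)).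
  rewrite (_ : _ \o _ = (fun x => t%:E * (psi x)%:E)%E); last by apply/funext.
  by apply: (@integrableZl _ TR).
have i3 : gauss.-integrable [set: R] (EFin \o (fun x => K * expR (x ^+ 2 / 4))).
  rewrite (_ : _ \o _ = (fun x => K%:E * (expR (x ^+ 2 / 4))%:E)%E); last by apply/funext.
  by apply: (@integrableZl _ TR).
have i12 : gauss.-integrable [set: R] (EFin \o (fun x => 1 + t * psi x)).
  exact: (@integrableD _ TR _ gauss _ measurableT _ _ i1 i2).
have ig : gauss.-integrable [set: R] (EFin \o g).
  exact: (@integrableD _ TR _ gauss _ measurableT _ _ i12 i3).
apply: (@le_trans _ _ (\int[gauss]_x (g x)%:E)%E).
  have mexp : measurable_fun [set: TR] (fun x : TR => (expR (t * psi x))%:E).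
    by apply/measurable_EFinP; apply: measurableT_comp => //; exact: measurable_funM.
  apply: (@ge0_le_integral _ TR) => //; last 2 first.
  - exact: (measurable_int gauss ig).
  - by move=> x _; rewrite lee_fin.
rewrite -(@EFin_Rintegral _ TR R gauss _ ig) lee_fin.
have -> : (\int[gauss]_x g x)%R = 1 + t * (\int[gauss]_x psi x)%R + K * Num.sqrt 2.
  rewrite (@RintegralD _ TR R gauss _ _ _ measurableT i12 i3).
  rewrite (@RintegralD _ TR R gauss _ _ _ measurableT i1 i2).
  rewrite (@Rintegral_cst_prob _ TR R gauss).
  rewrite (@RintegralZl _ TR R gauss _ _ _ measurableT ip).
  rewrite (@RintegralZl _ TR R gauss _ _ _ measurableT ie).
  by congr (_ + _ * _); rewrite /Rintegral gauss_integral_exp_sqr.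
apply: (@le_trans _ _ (1 + (t * (\int[gauss]_x psi x)%R + 1024 * C ^+ 2 * t ^+ 2))); last exact: expR_ge1Dx.
rewrite -addrA !lerD2l (_ : 1024 * _ * _ = K * 2); last by rewrite /K; ring.
rewrite ler_wpM2l// -[leRHS]ger0_norm// -sqrtr_sqr ler_sqrt// expr2; lra.
Qed.

End mgf.

(** The constants depend on [C] and [e] only. [D] holds the active coordinates; [N] may exceed its
    size, which gives a rate in [N] even when few coordinates matter. *)
Lemma chernoff_gaussI (C e : R) : 0 < C -> 0 < e -> exists2 t, 0 < t &
  exists2 c, 0 < c & forall (I : finType) (D : {set I}) (psi : I -> R -> R) (N : nat),
  (forall i, measurable_fun [set: TR] (psi i)) ->
  (forall i x, `|psi i x| <= C * (1 + x ^+ 2)) ->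
  (forall i x, i \notin D -> psi i x = 0) -> (#|D| <= N)%N ->
  (\int[@gaussI R I]_z (expR (t * (\sum_i psi i (gco z i)
      - \sum_i (\int[gauss]_x psi i x)%R - e * N%:R)))%:E <= (expR (- c * N%:R))%:E)%E.
Proof.
move=> C0 e0; have [K KE] : {K | K = 1024 * C ^+ 2} by exists (1024 * C ^+ 2).
have K0 : 0 < K by rewrite KE; apply: mulr_gt0; [rewrite ltr0n|exact: exprn_gt0].
(* The first bound admits [t] in [gauss_mgf]; the second limits the quadratic cost [K t^2] per
   coordinate to half of the gain [t e], and the other half is the rate. *)
pose t := Num.min (1 / (8 * C)) (e / (2 * K)).
have t0 : 0 < t by rewrite lt_min !divr_gt0// mulr_gt0.
have tC : t * C <= 1 / 8.
  have : t <= 1 / (8 * C) by rewrite ge_min lexx.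
  by rewrite ler_pdivlMr ?mulr_gt0//; lra.
have tK : K * t <= e / 2.
  have : t <= e / (2 * K) by rewrite ge_min lexx orbT.
  by rewrite ler_pdivlMr ?mulr_gt0//; lra.
exists t => //; exists (t * e / 2); first by rewrite divr_gt0// mulr_gt0.
move=> I D psi N mpsi psiC psiD DN.
set m := \sum_i (\int[gauss]_x psi i x)%R.
have Ez z : (expR (t * (\sum_i psi i (gco z i) - m - e * N%:R)))%:E =
   ((expR (- t * (m + e * N%:R)))%:E * \prod_i (expR (t * psi i (gco z i)))%:E)%E.
  rewrite prodEFin -expR_sum_fin -EFinM -expRD; congr (expR _)%:E.
  by rewrite -mulr_sumr; ring.
under eq_integral do rewrite Ez.
rewrite ge0_integralZl; [|exact: measurableT| | |by rewrite lee_fin expR_ge0]; last 2 first.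
- apply: measurable_fun_prode => i; apply/measurable_EFinP; apply: measurableT_comp => //.
  by apply: measurable_funM => //; exact: (measurableT_comp (mpsi i) (measurable_gco i)).
- by move=> z _; apply: prode_ge0' => i; rewrite lee_fin expR_ge0.
rewrite (@ge0_integral_gaussI_prod _ _ (fun i x => (expR (t * psi i x))%:E)); last 2 first.
- move=> i; apply/measurable_EFinP; apply: measurableT_comp => //.
  by apply: measurable_funM => //; exact: mpsi.
- by move=> i x; rewrite lee_fin expR_ge0.
pose b i := expR (t * (\int[gauss]_x psi i x)%R + (i \in D)%:R * (K * t ^+ 2)).
have bP i : (\int[gauss]_x (expR (t * psi i x))%:E <= (b i)%:E)%E.
  rewrite /b; case: (boolP (i \in D)) => iD.
    rewrite mul1r KE; exact: (gauss_mgf C0 (mpsi i) (psiC i) (ltW t0) tC).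
  rewrite mul0r addr0.
  have -> : (\int[gauss]_x psi i x)%R = 0.
    under eq_Rintegral do rewrite psiD//.
    exact: (@Rintegral_cst_prob _ TR R gauss).
  under eq_integral do rewrite psiD// mulr0 expR0.
  by rewrite mulr0 expR0 (@integral_cst_prob _ TR R gauss).
have prodle : (\prod_i \int[gauss]_x (expR (t * psi i x))%:E <= (\prod_i b i)%:E)%E.
  rewrite -prodEFin.
  suff : ((0 <= \prod_i \int[gauss]_x (expR (t * psi i x))%:E) &&
     (\prod_i \int[gauss]_x (expR (t * psi i x))%:E <= \prod_i (b i)%:E))%E by case/andP.
  elim/big_ind2 : _ => [|x1 x2 y1 y2 /andP[h1 h2] /andP[h3 h4]|i _].
  - by rewrite lexx lee01.
  - by rewrite mule_ge0//= lee_pmul.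
  - by rewrite bP integral_ge0// => x _; rewrite lee_fin expR_ge0.
apply: (le_trans (lee_wpmul2l _ prodle)); first by rewrite lee_fin expR_ge0.
rewrite -EFinM lee_fin /b -expR_sum_fin -expRD ler_expR.
rewrite big_split/= -mulr_sumr -/m -mulr_suml.
have -> : \sum_i (i \in D)%:R = #|D|%:R :> R.
  by rewrite -sum1_card natr_sum [RHS]big_mkcond/=; apply: eq_bigr => i _; case: (i \in D).
have DN' : #|D|%:R <= N%:R :> R by rewrite ler_nat.
have : #|D|%:R * (K * t ^+ 2) <= N%:R * (t * (e / 2)).
  apply: ler_pM => //; first by rewrite mulr_ge0 ?sqr_ge0// ltW.
  by rewrite expr2 mulrCA ler_wpM2l// ltW.
lra.
Qed.

End chernoff.

(** * Euclidean geometry and the descent cone *)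

Section euclidean.
Context {R : realType}.

Definition dotv n (u v : 'rV[R]_n) : R := \sum_j u 0 j * v 0 j.
Definition nrm2 n (u : 'rV[R]_n) : R := Num.sqrt (dotv u u).

Section dot_theory.
Variable n : nat.
Implicit Types u v w : 'rV[R]_n.

Lemma dotvC u v : dotv u v = dotv v u.
Proof. by apply: eq_bigr => j _; rewrite mulrC. Qed.

Lemma dotvDl u v w : dotv (u + v) w = dotv u w + dotv v w.
Proof. by rewrite -big_split/=; apply: eq_bigr => j _; rewrite mxE mulrDl. Qed.

Lemma dotvZl (a : R) u w : dotv (a *: u) w = a * dotv u w.
Proof. by rewrite mulr_sumr; apply: eq_bigr => j _; rewrite mxE mulrA. Qed.

Lemma dotvDr u v w : dotv w (u + v) = dotv w u + dotv w v.
Proof. by rewrite dotvC dotvDl !(dotvC w). Qed.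

Lemma dotvZr (a : R) u w : dotv w (a *: u) = a * dotv w u.
Proof. by rewrite dotvC dotvZl dotvC. Qed.

Lemma dotvNl u w : dotv (- u) w = - dotv u w.
Proof. by rewrite -scaleN1r dotvZl mulN1r. Qed.

Lemma dotv_ge0 u : 0 <= dotv u u.
Proof. by apply: sumr_ge0 => j _; rewrite -expr2 sqr_ge0. Qed.

Lemma nrm2_ge0 u : 0 <= nrm2 u. Proof. exact: sqrtr_ge0. Qed.

Lemma nrm2_sqr u : nrm2 u ^+ 2 = dotv u u.
Proof. by rewrite sqr_sqrtr// dotv_ge0. Qed.

Lemma nrm2_eq0 u : nrm2 u = 0 -> u = 0.
Proof.
move=> u0; have /eqP : dotv u u = 0 by rewrite -nrm2_sqr u0 expr0n.
rewrite psumr_eq0; last by move=> j _; rewrite -expr2 sqr_ge0.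
move=> /allP h; apply/rowP => j; rewrite mxE.
by have /implyP/(_ isT) := h j (mem_index_enum j); rewrite -expr2 sqrf_eq0 => /eqP.
Qed.

Lemma nrm20 : nrm2 (0 : 'rV[R]_n) = 0.
Proof. by rewrite /nrm2 /dotv big1 ?sqrtr0// => j _; rewrite mxE mul0r. Qed.

Lemma nrm2Z (a : R) u : nrm2 (a *: u) = `|a| * nrm2 u.
Proof. by rewrite /nrm2 dotvZl dotvZr mulrA -expr2 sqrtrM ?sqr_ge0// sqrtr_sqr. Qed.

Lemma nrm2_unit u : nrm2 u != 0 -> nrm2 ((nrm2 u)^-1 *: u) = 1.
Proof. by move=> u0; rewrite nrm2Z ger0_norm ?invr_ge0 ?nrm2_ge0// mulVf. Qed.

Lemma cauchy_schwarz u v : dotv u v <= nrm2 u * nrm2 v.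
Proof.
have [u0|u0] := eqVneq (nrm2 u) 0.
  by rewrite (nrm2_eq0 u0) nrm20 mul0r /dotv big1// => j _; rewrite mxE mul0r.
have h := dotv_ge0 (dotv u u *: v - dotv u v *: u).
have a0 : 0 < dotv u u by rewrite -nrm2_sqr exprn_gt0// lt_def u0 nrm2_ge0.
have E : dotv (dotv u u *: v - dotv u v *: u) (dotv u u *: v - dotv u v *: u) =
    dotv u u * (dotv u u * dotv v v - dotv u v ^+ 2).
  rewrite -[- (dotv u v *: u)]scaleNr dotvDl !dotvDr !dotvZl !dotvZr (dotvC v u); ring.
rewrite E pmulr_rge0// in h.
rewrite /nrm2 -sqrtrM ?dotv_ge0//; apply: (le_trans (ler_norm _)).
by rewrite -sqrtr_sqr ler_sqrt ?mulr_ge0 ?dotv_ge0// -subr_ge0.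
Qed.

Lemma cauchy_schwarzN u v : - dotv u v <= nrm2 u * nrm2 v.
Proof.
have := cauchy_schwarz (- u) v; rewrite dotvNl => /le_trans; apply.
by rewrite -scaleN1r nrm2Z normrN1 mul1r.
Qed.

Lemma nrm2D u v : nrm2 (u + v) <= nrm2 u + nrm2 v.
Proof.
rewrite -(@ler_pXn2r _ 2)// ?nnegrE ?addr_ge0 ?nrm2_ge0//.
rewrite nrm2_sqr dotvDl !dotvDr (dotvC v u) sqrrD !nrm2_sqr.
have := cauchy_schwarz u v; lra.
Qed.

Lemma le_coord_nrm2 u j : `|u 0 j| <= nrm2 u.
Proof.
rewrite -sqrtr_sqr ler_sqrt ?dotv_ge0// /dotv (bigD1 j)//= expr2 lerDl.
by apply: sumr_ge0 => k _; rewrite -expr2 sqr_ge0.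
Qed.

(** The net points have to lie in [K] itself, so each grid cell that meets [K] contributes a chosen
    representative instead of its centre. *)
Lemma finite_net (K : set 'rV[R]_n) (eta : R) : 0 < eta ->
  (forall u, K u -> nrm2 u <= 1) ->
  exists (N : finType) (a : N -> 'rV[R]_n), (forall k, K (a k)) /\
    forall u, K u -> exists k, nrm2 (a k - u) <= eta.
Proof.
move=> eta0 K1.
(* With this side length the diagonal [sqrt n * del] is at most [eta]; the successor avoids a zero
   denominator. *)
pose del := eta / n.+1%:R.
have del0 : 0 < del by rewrite divr_gt0.
pose M := (Num.truncn (2 / del)).+1.
pose cell (u : 'rV[R]_n) : {ffun 'I_n -> 'I_M.+1} :=
  [ffun j => inord (Num.truncn ((u 0 j + 1) / del))].
pose N : finType := {c : {ffun 'I_n -> 'I_M.+1} | `[< exists u, K u /\ cell u = c >]}.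
have rep (k : N) : exists u, K u /\ cell u = val k by have := valP k; move/asboolP.
pose a (k : N) := projT1 (cid (rep k)).
have aP k : K (a k) /\ cell (a k) = val k := projT2 (cid (rep k)).
exists N, a; split; first by move=> k; have [] := aP k.
move=> u Ku.
have cu : `[< exists u', K u' /\ cell u' = cell u >] by apply/asboolP; exists u.
exists (exist _ (cell u) cu); set k := exist _ _ _.
have [Kk ck] := aP k; rewrite [val k]/= in ck.
have cellE v j : K v -> (cell v j : nat) = Num.truncn ((v 0 j + 1) / del).
  move=> Kv; rewrite ffunE inordK//.
  have v1 : `|v 0 j| <= 1 by exact: le_trans (le_coord_nrm2 _ _) (K1 _ Kv).
  rewrite ltnS /M; apply: ltnW; rewrite ltnS; apply: le_truncn.
  by rewrite ler_pM2r ?invr_gt0//; have := ler_norm (v 0 j); lra.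
have dj j : `|(a k - u) 0 j| <= del.
  rewrite !mxE.
  have E : Num.truncn ((a k 0 j + 1) / del) = Num.truncn ((u 0 j + 1) / del).
    by rewrite -!cellE// ck.
  have pos v : K v -> 0 <= (v 0 j + 1) / del.
    move=> Kv; rewrite divr_ge0 ?(ltW del0)//.
    have v1 : `|v 0 j| <= 1 by exact: le_trans (le_coord_nrm2 _ _) (K1 _ Kv).
    by have /ler_normlP[? ?] := v1; lra.
  have /andP[h1 h2] := truncn_itv (pos _ Kk).
  have /andP[h3 h4] := truncn_itv (pos _ Ku).
  rewrite E in h1 h2; rewrite -natr1 in h2 h4.
  rewrite ler_pdivlMr// in h1; rewrite ler_pdivlMr// in h3.
  rewrite ltr_pdivrMr// in h2; rewrite ltr_pdivrMr// in h4.
  by rewrite ler_norml; apply/andP; split; lra.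
rewrite /nrm2 -[leRHS]ger0_norm ?(ltW eta0)// -sqrtr_sqr ler_sqrt ?sqr_ge0//.
apply: (@le_trans _ _ (\sum_(j < n) del ^+ 2)).
  apply: ler_sum => j _; rewrite -expr2 -(real_normK (num_real _)).
  by rewrite lerXn2r ?nnegrE ?(ltW del0).
rewrite sumr_const card_ord -mulr_natl.
rewrite /del expr_div_n mulrA ler_pdivrMr ?exprn_gt0// mulrC ler_wpM2l ?sqr_ge0//.
by rewrite expr2 -[leLHS]mulr1 ler_pM// ?ler_nat// ler1n.
Qed.

End dot_theory.
End euclidean.

(** * The descent cone and the recovery event *)

Section descent_cone.
Context {R : realType}.

Lemma nrm2_sqrD n (u v : 'rV[R]_n) (t : R) :
  nrm2 (u + t *: v) ^+ 2 = nrm2 u ^+ 2 + 2 * t * dotv u v + t * (t * dotv v v).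
Proof. by rewrite !nrm2_sqr dotvDl !dotvDr !dotvZl !dotvZr (dotvC v u); ring. Qed.

Lemma continuous_sumr (T : topologicalType) (J : Type) (s : seq J) (p : pred J) (f : J -> T -> R) :
  (forall j, continuous (f j)) -> continuous (fun x => \sum_(j <- s | p j) f j x).
Proof.
move=> cf; elim: s => [|j s ih] x.
  by under eq_fun do rewrite big_nil; exact: cst_continuous.
under eq_fun do rewrite big_cons; case: (p j); last exact: ih.
by apply: continuousD; [exact: cf|exact: ih].
Qed.

Lemma closed_le0 (T : topologicalType) (f : T -> R) : continuous f ->
  closed [set x | f x <= 0].
Proof.
move=> cf; have -> : [set x | f x <= 0] = f @^-1` [set y | y <= 0] by [].
by apply: closed_comp; [move=> x _; exact: cf|exact: closed_le].
Qed.

Lemma nrm2_min n (D : set 'rV[R]_n) (f : 'rV[R]_n -> R) (B : R) :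
  closed D -> (forall h, D h -> nrm2 h <= B) -> D !=set0 -> continuous f ->
  exists c, D c /\ forall t, D t -> f c <= f t.
Proof.
move=> cD DB D0 cf.
have bD : bounded_set D.
  exists B; split; first exact: num_real.
  move=> M BM h Dh /=; rewrite -[`|h|]/(mx_norm h) mx_normrE; apply/bigmax_leP.
  have [h0 _] := D0.
  have B0 : 0 <= B by exact: le_trans (nrm2_ge0 _) (DB _ Dh).
  split; first exact: le_trans B0 (ltW BM).
  move=> [i j] _ /=; rewrite (ord1 i); apply: le_trans (ltW BM).
  exact: le_trans (le_coord_nrm2 _ _) (DB _ Dh).
have [c cD' cmin] := EVT_min_rV D0 (bounded_closed_compact bD cD) (continuous_subspaceT cf).
exists c; split; first exact: set_mem.
by move=> t Dt; apply: cmin; exact/mem_set.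
Qed.

Lemma continuous_dotvv n : continuous (fun h : 'rV[R]_n => dotv h h).
Proof. by apply: continuous_sumr => j x; apply: continuousM; exact: coord_continuous. Qed.

Lemma continuous_nrm2 n : continuous (@nrm2 R n).
Proof.
move=> x; apply: (@continuous_comp _ _ _ (fun h : 'rV[R]_n => dotv h h) (@Num.sqrt R)).
  exact: continuous_dotvv.
exact: sqrt_continuous.
Qed.

Lemma continuous_mulmx_row m n (M : 'M[R]_(n, m)) i :
  continuous (fun h : 'rV[R]_n => (h *m M) 0 i).
Proof.
have -> : (fun h : 'rV[R]_n => (h *m M) 0 i) = (fun h => \sum_j h 0 j * M j i).
  by apply/funext => h; rewrite mxE.
apply: continuous_sumr => j x; apply: continuousM; last exact: cst_continuous.
exact: coord_continuous.
Qed.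

Lemma continuous_dot_mulmx m n (M : 'M[R]_(n, m)) (c : 'rV[R]_m) :
  continuous (fun h : 'rV[R]_n => dotv (h *m M + c) (h *m M + c)).
Proof.
apply: continuous_sumr => j x.
have cj : {for x, continuous (fun h : 'rV[R]_n => (h *m M + c) 0 j)}.
  have -> : (fun h : 'rV[R]_n => (h *m M + c) 0 j) = (fun h => (h *m M) 0 j + c 0 j).
    by apply/funext => h; rewrite mxE.
  by apply: continuousD; [exact: continuous_mulmx_row|exact: cst_continuous].
exact: continuousM.
Qed.

Section cone.
Variables (n : nat) (S : {set 'I_n}) (sigma : 'I_n -> bool).
Implicit Types h : 'rV[R]_n.
Local Notation sg i := ((-1) ^+ sigma i : R).

(** The one-sided derivative of the l1 norm in direction [h] at a point with signs [sigma] on [S]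
    and zeros elsewhere. *)
Definition cone_fun h : R := \sum_(i | i \notin S) `|h 0 i| + \sum_(i in S) sg i * h 0 i.
Definition cone : set 'rV[R]_n := [set h | cone_fun h <= 0].
Definition usphere (k : nat) : set 'rV[R]_k := [set h | nrm2 h = 1].

Lemma sg_sqr i : sg i * sg i = 1.
Proof. by rewrite -expr2 sqrr_sign. Qed.

Lemma cone_funZ (a : R) h : 0 <= a -> cone_fun (a *: h) = a * cone_fun h.
Proof.
move=> a0; rewrite /cone_fun mulrDr !mulr_sumr; congr (_ + _); apply: eq_bigr => i _.
  by rewrite mxE normrM ger0_norm.
by rewrite mxE; ring.
Qed.

Lemma coneZ (a : R) h : 0 <= a -> cone h -> cone (a *: h).
Proof. by move=> a0 ch; rewrite /cone/= cone_funZ// mulr_ge0_le0. Qed.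

Lemma coneD h h' : cone h -> cone h' -> cone (h + h').
Proof.
rewrite /cone/= => ch ch'; apply: le_trans (_ : cone_fun h + cone_fun h' <= 0); last by lra.
rewrite /cone_fun addrACA lerD//.
  by rewrite -big_split/=; apply: ler_sum => i _; rewrite mxE ler_normD.
by rewrite -big_split/=; apply: ler_sum => i _; rewrite mxE mulrDr.
Qed.

Lemma cone0 : cone 0.
Proof. by have := @coneZ 0 0 (lexx 0); rewrite /cone /= scale0r /cone_fun !big1 ?addr0// => i _; rewrite mxE ?normr0 ?mulr0. Qed.

Lemma continuous_cone_fun : continuous cone_fun.
Proof.
move=> x; apply: continuousD; apply: continuous_sumr => i y.
  apply: (@continuous_comp _ _ _ (fun h : 'rV[R]_n => h 0 i) (@Num.norm _ R)).
    exact: coord_continuous.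
  exact: norm_continuous.
apply: (@continuousM R _ (fun=> sg i) (fun h : 'rV[R]_n => h 0 i)); [exact: cst_continuous|exact: coord_continuous].
Qed.

Lemma closed_cone : closed cone.
Proof. exact/closed_le0/continuous_cone_fun. Qed.

Lemma closed_usphere k : closed (@usphere k).
Proof.
have -> : @usphere k = [set h | nrm2 h - 1 <= 0] `&` [set h | 1 - nrm2 h <= 0].
  apply/seteqP; split => h /=; first by move=> ->; rewrite subrr.
  by move=> [h1 h2]; apply/eqP; rewrite eq_le; apply/andP; split; lra.
apply: closedI; apply: closed_le0 => x.
  by apply: continuousB; [exact: continuous_nrm2|exact: cst_continuous].
by apply: continuousB; [exact: cst_continuous|exact: continuous_nrm2].
Qed.

Variables (m : nat).
Implicit Types A : 'M[R]_(m, n).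

Definition cone_kernel_trivial A := forall h, cone h -> h *m A^T = 0 -> h = 0.

Lemma l1norm_split (x : 'cV[R]_n) :
  l1norm x = \sum_(i in S) `|x i ord0| + \sum_(i | i \notin S) `|x i ord0|.
Proof. by rewrite /l1norm (bigID (mem S)). Qed.

(** Convexity bounds the change of the norm below by [cone_fun]. Conversely, at a point with large
    enough entries on [S] the bound is an equality, so a kernel vector in the cone yields a
    competitor of no larger norm. *)
Lemma sparse_success_iff A :
  (forall x : 'cV[R]_n, sparse_with_signs S sigma x -> l1_unique_solution A (A *m x) x) <->
  cone_kernel_trivial A.
Proof.
split=> [succ h ch Ah|triv x [xS xN]].
  apply: contrapT => hN0.
  (* Strictly larger than every entry of [h], so that adding [h] flips no sign on [S]. *)
  pose M := 1 + \sum_i `|h 0 i|.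
  pose x : 'cV[R]_n := \col_i (if i \in S then sg i * M else 0).
  have M0 i : `|h 0 i| < M.
    rewrite /M (bigD1 i)//= ltr_pwDl// lerDl; exact: sumr_ge0.
  have M00 : 0 < M by rewrite ltr_pwDl// sumr_ge0.
  have xs : sparse_with_signs S sigma x.
    split=> i iS; rewrite mxE ?iS ?(negbTE iS)//.
    by rewrite mulrA sg_sqr mul1r.
  have [_ /(_ (x + h^T))] := succ x xs.
  have -> : A *m (x + h^T) = A *m x.
    by rewrite mulmxDr -[A *m h^T]trmxK trmx_mul trmxK Ah trmx0 addr0.
  have xh : x + h^T <> x.
    by move=> /eqP; rewrite addrC -subr_eq0 addrK => /eqP e; apply: hN0; rewrite -[h]trmxK e trmx0.
  move=> /(_ erefl xh); apply/negP; rewrite -leNgt !l1norm_split.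
  have sgn i : `|sg i| = 1 by rewrite normrX normrN1 expr1n.
  have -> : \sum_(i in S) `|(x + h^T) i ord0| = \sum_(i in S) (M + sg i * h 0 i).
    apply: eq_bigr => i iS; rewrite !mxE iS.
    have -> : sg i * M + h 0 i = sg i * (M + sg i * h 0 i).
      by rewrite [RHS]mulrDr mulrA sg_sqr mul1r.
    rewrite normrM sgn mul1r ger0_norm//.
    have : `|sg i * h 0 i| < M by rewrite normrM sgn mul1r.
    by rewrite ltr_norml => /andP[? _]; lra.
  have -> : \sum_(i in S) `|x i ord0| = \sum_(i in S) M.
    by apply: eq_bigr => i iS; rewrite mxE iS normrM sgn mul1r gtr0_norm.
  have -> : \sum_(i | i \notin S) `|x i ord0| = 0.
    by rewrite big1// => i iS; rewrite mxE (negbTE iS) normr0.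
  have -> : \sum_(i | i \notin S) `|(x + h^T) i ord0| = \sum_(i | i \notin S) `|h 0 i|.
    by apply: eq_bigr => i iS; rewrite !mxE (negbTE iS) add0r.
  rewrite big_split/= addr0 -addrA gerDl addrC; exact: ch.
split=> // u Au ux.
pose h := (u - x)^T.
have hE i : h 0 i = u i ord0 - x i ord0 by rewrite !mxE.
have Ah : h *m A^T = 0 by rewrite -trmx_mul mulmxBr Au subrr trmx0.
have hN0 : h <> 0.
  by move=> e; apply: ux; apply/eqP; rewrite -subr_eq0 -[u - x]trmxK -/h e trmx0.
have : ~ cone h by move=> ch; apply: hN0; exact: triv.
rewrite /cone/= => /negP; rewrite -ltNge => ch.
rewrite !l1norm_split.
have -> : \sum_(i in S) `|x i ord0| = \sum_(i in S) sg i * x i ord0.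
  apply: eq_bigr => i iS; have x0 := xS i iS.
  have e : x i ord0 = sg i * (sg i * x i ord0) by rewrite mulrA sg_sqr mul1r.
  by rewrite {1}e normrM normrX normrN1 expr1n mul1r gtr0_norm.
have -> : \sum_(i | i \notin S) `|x i ord0| = 0.
  by rewrite big1// => i iS; rewrite xN// normr0.
have le1 : \sum_(i in S) sg i * u i ord0 <= \sum_(i in S) `|u i ord0|.
  apply: ler_sum => i _; apply: le_trans (ler_norm _) _.
  by rewrite normrM normrX normrN1 expr1n mul1r.
have E2 : \sum_(i | i \notin S) `|u i ord0| = \sum_(i | i \notin S) `|h 0 i|.
  by apply: eq_bigr => i iS; rewrite hE xN// subr0.
have E3 : \sum_(i in S) sg i * h 0 i =
    \sum_(i in S) sg i * u i ord0 - \sum_(i in S) sg i * x i ord0.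
  by rewrite -sumrB; apply: eq_bigr => i _; rewrite hE mulrBr.
rewrite /cone_fun E3 in ch; rewrite E2; lra.
Qed.

Definition fnorm A : R := Num.sqrt (\sum_i \sum_j A i j ^+ 2).

Lemma nrm2_mulmx A h : nrm2 (h *m A^T) <= fnorm A * nrm2 h.
Proof.
rewrite /nrm2 /fnorm -sqrtrM; last by apply: sumr_ge0 => i _; apply: sumr_ge0 => j _; exact: sqr_ge0.
rewrite ler_sqrt; last first.
  by rewrite mulr_ge0 ?dotv_ge0//; apply: sumr_ge0 => i _; apply: sumr_ge0 => j _; exact: sqr_ge0.
rewrite /dotv mulr_suml; apply: ler_sum => i _.
pose r : 'rV[R]_n := row i A.
have -> : (h *m A^T) 0 i = dotv h r.
  by rewrite mxE; apply: eq_bigr => j _; rewrite !mxE.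
have -> : \sum_j A i j ^+ 2 = dotv r r.
  by apply: eq_bigr => j _; rewrite !mxE expr2.
rewrite -/(dotv h h) -!nrm2_sqr -expr2 -exprMn -(real_normK (num_real (dotv h r))).
rewrite lerXn2r ?nnegrE ?mulr_ge0 ?nrm2_ge0// ler_norml; apply/andP; split.
  by rewrite lerNl mulrC; exact: cauchy_schwarzN.
by rewrite mulrC; exact: cauchy_schwarz.
Qed.

(** Compactness of the cone cut by the unit sphere turns triviality into a positive lower bound, a
    form that can be checked on nets. *)
Lemma cone_kernel_trivialP A : cone_kernel_trivial A <->
  exists2 c : R, 0 < c & forall h, cone h -> nrm2 h = 1 -> c <= nrm2 (h *m A^T).
Proof.
split=> [triv|[c c0 hc] h ch Ah]; last first.
  apply: contrapT => hN0.
  have n0 : nrm2 h != 0 by apply/eqP => /nrm2_eq0.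
  have := hc ((nrm2 h)^-1 *: h).
  rewrite nrm2_unit// -scalemxAl Ah scaler0 nrm20 => /(_ _ erefl) h1.
  have : c <= 0 by apply: h1; apply: coneZ; rewrite ?invr_ge0 ?nrm2_ge0.
  by rewrite leNgt c0.
(* If the cone has no unit vector the bound is vacuous and any constant will do. *)
have [[h0 [ch0 nh0]]|noK] := pselect (exists h, cone h /\ nrm2 h = 1); last first.
  by exists 1 => // h ch nh; case: noK; exists h.
pose f (h : 'rV[R]_n) := dotv (h *m A^T + 0) (h *m A^T + 0).
have [c [[cc cn] cmin]] := @nrm2_min n (cone `&` @usphere n) f 1
  (closedI closed_cone (@closed_usphere n))
  (fun h hh => (ltac:(by rewrite hh.2) : nrm2 h <= 1))
  (ex_intro _ h0 (conj ch0 nh0)) (@continuous_dot_mulmx _ _ _ _).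
exists (nrm2 (c *m A^T)).
  rewrite lt_def nrm2_ge0 andbT; apply/eqP => /nrm2_eq0 /(triv _ cc) c0.
  by move: cn; rewrite c0 /usphere/= nrm20 => /eqP; rewrite eq_sym oner_eq0.
move=> h ch nh; have := cmin h (conj ch nh); rewrite /f !addr0 => hle.
by rewrite /nrm2 ler_sqrt// dotv_ge0.
Qed.

(* Minimise [|A (h + h0)| + c/2 |h|] over the cone, where [h0] is a boundary
   direction whose opposite leaves the cone: at a minimiser the residual must
   vanish, otherwise moving along the direction given by the hypothesis
   decreases the first term at rate at least [c]. *)
Lemma cone_kernel_nontrivial A (c : R) (i0 : 'I_n) : i0 \in S -> 0 < c ->
  (forall b : 'rV[R]_m, nrm2 b = 1 ->
     exists h, [/\ cone h, nrm2 h = 1 & c <= dotv b (h *m A^T)]) ->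
  ~ cone_kernel_trivial A.
Proof.
move=> i0S c0 hyp triv.
(* On this line [cone_fun (a *: h0) = - a], so [h0] is in the cone and [- h0] is not. Shifting by it
   excludes the trivial minimiser. *)
pose h0 : 'rV[R]_n := \row_i (if i == i0 then - sg i0 else 0).
have h0E a : cone_fun (a *: h0) = - a.
  rewrite /cone_fun big1 ?add0r; last first.
    move=> i iS; rewrite !mxE; case: eqP => [ii|]; last by rewrite mulr0 normr0.
    by move: iS; rewrite ii i0S.
  rewrite (bigD1 i0)//= big1 ?addr0; last first.
    by move=> i /andP[_ /negbTE ii]; rewrite !mxE ii !mulr0.
  by rewrite !mxE eqxx mulrCA mulrN sg_sqr mulrN1.
have ch0 : cone h0 by have := h0E 1; rewrite scale1r /cone/= => ->; rewrite oppr_le0.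
pose a0 := h0 *m A^T.
pose f (h : 'rV[R]_n) := nrm2 (h *m A^T + a0) + c / 2 * nrm2 h.
have cf : continuous f.
  move=> x.
  have c1 : {for x, continuous (fun h : 'rV[R]_n => nrm2 (h *m A^T + a0))}.
    apply: (@continuous_comp _ _ _ (fun h : 'rV[R]_n => dotv (h *m A^T + a0) (h *m A^T + a0)) (@Num.sqrt R)).
      exact: continuous_dot_mulmx.
    exact: sqrt_continuous.
  have c2 : {for x, continuous (fun h : 'rV[R]_n => c / 2 * nrm2 h)}.
    by apply: (@continuousM R _ (fun=> c / 2) (@nrm2 R n)); [exact: cst_continuous|exact: continuous_nrm2].
  exact: (continuousD c1 c2).
(* Beyond this radius the penalty alone exceeds [f 0], so a minimum over the compact part is a
   minimum over the cone. *)
pose B := nrm2 a0 / (c / 2).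
have c20 : 0 < c / 2 by rewrite divr_gt0.
have B0 : 0 <= B by rewrite divr_ge0 ?nrm2_ge0// ltW.
have closedB : closed [set h : 'rV[R]_n | nrm2 h - B <= 0].
  by apply: closed_le0 => x; apply: continuousB; [exact: continuous_nrm2|exact: cst_continuous].
have in0 : (cone `&` [set h : 'rV[R]_n | nrm2 h - B <= 0]) 0.
  by split; [exact: cone0|rewrite /= nrm20 sub0r oppr_le0].
have [h1 [[ch1 _] hmin]] := @nrm2_min n (cone `&` [set h | nrm2 h - B <= 0]) f B
  (closedI closed_cone closedB)
  (fun h hh => (ltac:(by have := hh.2; rewrite /= subr_le0) : nrm2 h <= B))
  (ex_intro _ 0 in0) cf.
have f0 : f 0 = nrm2 a0 by rewrite /f mul0mx add0r nrm20 mulr0 addr0.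
have hmin' h : cone h -> f h1 <= f h.
  move=> ch; have [hB|hB] := leP (nrm2 h) B; first by apply: hmin; split => //=; rewrite subr_le0.
  apply: le_trans (hmin 0 in0) _; rewrite f0 /f.
  have : nrm2 a0 <= c / 2 * nrm2 h by rewrite mulrC -ler_pdivrMr// ltW.
  by have := nrm2_ge0 (h *m A^T + a0); lra.
pose r := h1 *m A^T + a0.
have [r0|rN0] := eqVneq (nrm2 r) 0.
  have : (h1 + h0) *m A^T = 0 by rewrite mulmxDl; exact: nrm2_eq0.
  move=> /(triv _ (coneD ch1 ch0)) e.
  have e1 : h1 = (-1) *: h0 by rewrite scaleN1r; apply/eqP; rewrite -addr_eq0 e.
  by move: ch1; rewrite /cone/= e1 h0E opprK; rewrite leNgt ltr01.
have rho0 : 0 < nrm2 r by rewrite lt_def rN0 nrm2_ge0.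
set rho := nrm2 r in rN0 rho0 *.
(* The unit vector opposite to the residual is used, so that [h] has a negative product with [r]. *)
have [|h [ch nh bh]] := hyp ((- rho^-1) *: r).
  by rewrite nrm2Z normrN ger0_norm ?invr_ge0 ?nrm2_ge0// mulVf.
rewrite dotvZl mulNr in bh.
have rh : dotv r (h *m A^T) <= - (c * rho).
  have : rho * c <= rho * - (rho^-1 * dotv r (h *m A^T)) by rewrite ler_pM2l.
  by rewrite mulrN mulrA mulfV// mul1r; lra.
pose q := dotv (h *m A^T) (h *m A^T).
have q0 : 0 <= q by exact: dotv_ge0.
(* A step short enough for the quadratic term [t * q] to be at most half of the linear gain
   [c * rho]; the 1 guards against [q = 0]. *)
pose t := c * rho / (2 * (q + 1)).
have t0 : 0 < t by rewrite divr_gt0 ?mulr_gt0//; lra.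
have tq : t * q <= c * rho / 2.
  rewrite /t mulrAC ler_pdivrMr ?mulr_gt0//; last by lra.
  have : 0 <= c * rho by rewrite mulr_ge0// ltW.
  nra.
have ct : cone (h1 + t *: h) by apply: coneD => //; apply: coneZ => //; exact: ltW.
have := hmin' _ ct; rewrite /f.
have -> : (h1 + t *: h) *m A^T + a0 = r + t *: (h *m A^T).
  by rewrite mulmxDl -scalemxAl /r addrAC.
have n1 : nrm2 (h1 + t *: h) <= nrm2 h1 + t.
  apply: (le_trans (nrm2D _ _)); rewrite nrm2Z nh mulr1 ger0_norm//; exact: ltW.
(* The residual falls by at least [3/4 t c], while the penalty grows by at most [t c / 2]; this
   contradicts minimality. *)
have n2 : nrm2 (r + t *: (h *m A^T)) <= rho - t * c * (3 / 4).
  have E : nrm2 (r + t *: (h *m A^T)) ^+ 2 = rho ^+ 2 + 2 * t * dotv r (h *m A^T) + t * (t * q).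
    exact: nrm2_sqrD.
  have h3 : nrm2 (r + t *: (h *m A^T)) ^+ 2 <= rho * (rho - 3 / 2 * (t * c)).
    rewrite E; have := ler_wpM2l (ltW t0) tq.
    have := ler_wpM2l (ltW t0) rh; nra.
  have pos : 0 <= rho - 3 / 2 * (t * c).
    by rewrite -(pmulr_rge0 _ rho0); apply: le_trans h3; exact: sqr_ge0.
  have tc0 : 0 < t * c by rewrite mulr_gt0.
  rewrite -(@ler_pXn2r _ 2)// ?nnegrE ?nrm2_ge0//; last by lra.
  by apply: (le_trans h3); nra.
rewrite -/r -/rho; have : 0 < t * c by rewrite mulr_gt0.
nra.
Qed.

End cone.
End descent_cone.

(** * Gaussian matrices *)

Section success_measurable.
Context {R : realType} d (T : measurableType d) (n m : nat).
Variables (S : {set 'I_n}) (sigma : 'I_n -> bool) (A : T -> 'M[R]_(m, n)).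
Hypothesis mA : forall i j, measurable_fun [set: T] (fun w => A w i j).

Lemma measurable_dotv_mulmx (a : 'rV[R]_n) :
  measurable_fun [set: T] (fun w => dotv (a *m (A w)^T) (a *m (A w)^T)).
Proof.
have mi i : measurable_fun [set: T] (fun w => (a *m (A w)^T) 0 i).
  have -> : (fun w => (a *m (A w)^T) 0 i) = (fun w => \sum_j a 0 j * A w i j).
    by apply/funext => w; rewrite mxE; apply: eq_bigr => j _; rewrite mxE.
  by apply: measurable_sum => j; apply: measurable_funM.
by apply: measurable_sum => i; apply: measurable_funM.
Qed.

(** The uniform lower bound of [cone_kernel_trivialP] can be tested with rational bounds on a
    sequence of finer finite nets, which leaves countable unions and intersections of measurable
    events. *)
Lemma measurable_cone_kernel_trivial :
  measurable [set w | cone_kernel_trivial S sigma (A w)].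
Proof.
pose K : set 'rV[R]_n := cone S sigma `&` usphere (k := n).
have K1 u : K u -> nrm2 u <= 1 by move=> [_ ->].
have net k := cid (@finite_net R n K k.+1%:R^-1 (ltac:(by rewrite invr_gt0)) K1).
pose N k : finType := projT1 (net k).
have net' k := cid (projT2 (net k)).
pose a k : N k -> 'rV[R]_n := projT1 (net' k).
have aP k : (forall t, K (a k t)) /\ (forall u, K u -> exists t, nrm2 (a k t - u) <= k.+1%:R^-1).
  exact: projT2 (net' k).
pose E j k (t : N k) := [set w | j.+1%:R^-1 <= dotv (a k t *m (A w)^T) (a k t *m (A w)^T)].
have mE j k t : measurable (E j k t).
  rewrite -[X in measurable X]setTI.
  have -> : E j k t = (fun w => dotv (a k t *m (A w)^T) (a k t *m (A w)^T)) @^-1` `[j.+1%:R^-1, +oo[.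
    by apply/seteqP; split => w /=; rewrite in_itv/= andbT.
  by apply: measurable_dotv_mulmx => //; exact: measurable_itv.
have -> : [set w | cone_kernel_trivial S sigma (A w)] =
    \bigcup_j \bigcap_k \bigcap_(t in [set: N k]) E j k t.
  apply/seteqP; split => w /=.
    move=> /cone_kernel_trivialP[c c0 hc].
    have c20 : 0 < c ^+ 2 by rewrite exprn_gt0.
    exists (Num.truncn (c ^+ 2)^-1) => // k _ t _; rewrite /E /= -nrm2_sqr.
    apply: (@le_trans _ _ (c ^+ 2)).
      rewrite -[leRHS]invrK lef_pV2 ?posrE ?invr_gt0//.
      by apply/ltW/truncnS_gt; rewrite invr_ge0 ltW.
    have [ct nt] := (aP k).1 t.
    by rewrite lerXn2r ?nnegrE ?nrm2_ge0 ?(ltW c0)//; exact: hc.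
  move=> [j _ hj]; apply/cone_kernel_trivialP.
  pose c := Num.sqrt (j.+1%:R^-1 : R).
  have c0 : 0 < c by rewrite sqrtr_gt0 invr_gt0.
  exists (c / 2); first by rewrite divr_gt0.
  move=> h ch nh.
  (* The net is chosen after [w]: its width times the Frobenius norm of [A w] is at most [c / 2]. *)
  pose k := Num.truncn (fnorm (A w) / (c / 2)).
  have [t ht] := (aP k).2 h (conj ch nh).
  have := hj k Logic.I t Logic.I; rewrite /E/= -nrm2_sqr => hE.
  have ca : c <= nrm2 (a k t *m (A w)^T).
    by rewrite -[leRHS]ger0_norm ?nrm2_ge0// -sqrtr_sqr ler_sqrt ?sqr_ge0.
  have fa : fnorm (A w) * nrm2 (a k t - h) <= c / 2.
    have f0 : 0 <= fnorm (A w) by exact: sqrtr_ge0.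
    apply: (@le_trans _ _ (fnorm (A w) * k.+1%:R^-1)); first by rewrite ler_wpM2l.
    rewrite ler_pdivrMr// mulrC -ler_pdivrMr ?divr_gt0//.
    by apply/ltW/truncnS_gt; rewrite divr_ge0// ltW// divr_gt0.
  have := nrm2D (h *m (A w)^T) ((a k t - h) *m (A w)^T).
  rewrite -mulmxDl addrC subrK.
  have := nrm2_mulmx (A w) (a k t - h); lra.
apply: bigcup_measurable => j _; apply: bigcapT_measurable => k.
by apply: fin_bigcap_measurable => // t _.
Qed.

End success_measurable.

Section small_events.
Context {R : realType} (I : finType).
Local Notation gam := (@gaussI R I).
Local Notation co := (@gco R I).
Local Notation gauss := (normal_prob (0 : R) 1).
Local Notation TR := (measurableTypeR R).

(* A dominating function stands for the indicator of [B], so that [B] itself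
   need not be measurable. *)
Definition small_event (B : set (I -> R)) (b : R) := exists ex : (I -> R) -> R,
  [/\ forall z, 0 <= ex z, measurable_fun [set: @gspace R I] (fun z => ex (co z)),
      forall z, B z -> 1 <= ex z & (\int[gam]_z (ex (co z))%:E <= b%:E)%E].

Lemma small_eventU B1 B2 b1 b2 : small_event B1 b1 -> small_event B2 b2 ->
  small_event (B1 `|` B2) (b1 + b2).
Proof.
move=> [e1 [p1 m1 c1 i1]] [e2 [p2 m2 c2 i2]].
exists (fun z => e1 z + e2 z); split.
- by move=> z; rewrite addr_ge0.
- exact: measurable_funD.
- by move=> z [/c1|/c2] h; [rewrite (le_trans h)// lerDl|rewrite (le_trans h)// lerDr].
- under eq_integral do rewrite EFinD.
  have m1' : measurable_fun [set: @gspace R I] (fun z => (e1 (co z))%:E) by exact/measurable_EFinP.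
  have m2' : measurable_fun [set: @gspace R I] (fun z => (e2 (co z))%:E) by exact/measurable_EFinP.
  rewrite ge0_integralD//; last by move=> z _; rewrite lee_fin.
    by rewrite EFinD leeD.
  by move=> z _; rewrite lee_fin.
Qed.

End small_events.

Lemma chernoff_small_event {R : realType} (C e : R) : 0 < C -> 0 < e ->
  exists2 c, 0 < c & forall (I : finType) (D : {set I}) (psi : I -> R -> R) (N : nat) (mean : R),
  (forall i, measurable_fun [set: measurableTypeR R] (psi i)) ->
  (forall i x, `|psi i x| <= C * (1 + x ^+ 2)) ->
  (forall i x, i \notin D -> psi i x = 0) -> (#|D| <= N)%N ->
  (\sum_i (\int[normal_prob (0 : R) 1]_x psi i x)%R <= mean) ->
  small_event [set z : I -> R | mean + e * N%:R <= \sum_i psi i (z i)] (expR (- c * N%:R)).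
Proof.
move=> C0 e0; have [t t0 [c c0 H]] := chernoff_gaussI C0 e0; exists c => //.
move=> I D psi N mean mpsi psiC psiD DN hm.
set s := \sum_i (\int[normal_prob (0 : R) 1]_x psi i x)%R in hm.
exists (fun z => expR (t * (\sum_i psi i (z i) - s - e * N%:R))); split.
- by move=> z; exact: expR_ge0.
- apply: measurableT_comp => //; apply: measurable_funM => //.
  apply: measurable_funB => //; apply: measurable_funB => //.
  by apply: measurable_sum => i; exact: (measurableT_comp (mpsi i) (measurable_gco i)).
- move=> z /= hz; rewrite -[leLHS]expR0 ler_expR mulr_ge0 ?(ltW t0)//; lra.
- exact: (H I D psi N mpsi psiC psiD DN).
Qed.

Lemma measurable_family {R : realType} (I : finType) d (T : measurableType d)
    (X : I -> T -> R) (phi : (I -> R) -> R) :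
  (forall i, measurable_fun [set: T] (X i : T -> measurableTypeR R)) ->
  measurable_fun [set: @gspace R I] (fun z => phi (gco z)) ->
  measurable_fun [set: T] (fun w => phi (X ^~ w)).
Proof.
move=> mX mphi.
pose Y w : @gspace R I := [tuple X (enum_val k) w | k < #|I|].
have mY : measurable_fun [set: T] Y.
  apply/measurable_fun_tnthP => k /=.
  rewrite (_ : _ \o _ = X (enum_val k))//.
  by apply/funext => w /=; rewrite tnth_mktuple.
have -> : (fun w => phi (X ^~ w)) = (fun z => phi (gco z)) \o Y.
  apply/funext => w /=; congr phi; apply/funext => i.
  by rewrite /gco tnth_mktuple enum_rankK.
exact: (measurableT_comp mphi mY).
Qed.

Section random_matrix.
Context {R : realType} d (T : measurableType d) (P : probability T R) (m n : nat).
Variable A : T -> 'M[R]_(m, n).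
Hypothesis iidA : iid_std_normal_matrix P A.
Local Notation gauss := (normal_prob (0 : R) 1).
Local Notation TR := (measurableTypeR R).

(** The scalar [g] and the vectors [g'] and [g''], adjoined to the entries of [A] so that both
    processes are linear forms in one Gaussian family. *)
Definition aux_index : finType := (unit + ('I_m + 'I_n))%type.
Definition mx_index : finType := (('I_m * 'I_n) + aux_index)%type.

Definition joint (i : mx_index) (w : T * @gspace R aux_index) : R :=
  match i with inl (a, b) => A w.1 a b | inr j => gco w.2 j end.

(** A box in the joint family is a product of a box for the entries of [A] and a box for the
    auxiliary variables, so the two box formulas multiply. *)
Lemma gauss_family_joint : gauss_family (P \x @gaussI R aux_index)%E joint.
Proof.
have [mA [nA pA]] := iidA.
split.
  move=> [[a b]|j] /=.
    exact: (measurableT_comp (mA a b) measurable_fst).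
  exact: (measurableT_comp (measurable_gco j) measurable_snd).
move=> B mB.
pose B1 := [set w | forall a b, B (inl (a, b)) (A w a b)].
pose B2 := [set z : @gspace R aux_index | forall j, B (inr j) (gco z j)].
have -> : [set w | forall i, B i (joint i w)] = B1 `*` B2.
  apply/seteqP; split => w /=.
    by move=> h; split => [a b|j]; [exact: (h (inl (a, b)))|exact: (h (inr j))].
  by move=> [h1 h2] [[a b]|j]; [exact: h1|exact: h2].
have mB1 : measurable B1.
  have := @measurable_forall R ('I_m * 'I_n)%type _ T (fun p w => A w p.1 p.2) (fun p => B (inl p)).
  rewrite (_ : [set w | forall i, B (inl i) (A w i.1 i.2)] = B1); last first.
    by apply/seteqP; split => w /= h; [move=> a b; exact: (h (a, b))|move=> [a b]; exact: h].
  by apply=> [[a b]|p]; [exact: mA|exact: mB].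
have mB2 : measurable B2.
  exact: (@measurable_forall R aux_index _ _ (fun j z => gco z j) (fun j => B (inr j)) (@measurable_gco R _) (fun j => mB _)).
apply: etrans (product_measure1E P (@gaussI R aux_index) mB1 mB2) _.
rewrite big_sumType/=; congr (_ * _)%E.
  rewrite [LHS](pA (fun a b => B (inl (a, b)))); last by move=> a b; exact: mB.
  rewrite pair_big/=; apply: eq_bigr => -[a b] _ /=.
  by apply: nA; exact: mB.
have [_ h] := @gauss_family_gco R aux_index.
by apply: (h (fun j => B (inr j))) => j; exact: mB.
Qed.

Section core.
Variables (NA NH : finType) (p : NA * NH -> 'rV[R]_m) (q : NA * NH -> 'rV[R]_n).
Hypotheses (p1 : forall a, nrm2 (p a) = 1) (q1 : forall a, nrm2 (q a) = 1).
Hypothesis pq : forall a b, a.1 = b.1 -> p a = p b \/ q a = q b.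

Definition mx_form (a : NA * NH) (i : mx_index) : R :=
  match i with
  | inl (i, j) => p a 0 i * q a 0 j
  | inr (inl _) => 1
  | inr (inr _) => 0
  end.

Definition vec_form (a : NA * NH) (i : mx_index) : R :=
  match i with
  | inr (inr (inl i)) => p a 0 i
  | inr (inr (inr j)) => q a 0 j
  | _ => 0
  end.

Lemma sum_mx_index (f : mx_index -> R) : \sum_i f i =
  \sum_i \sum_j f (inl (i, j)) + (f (inr (inl tt)) +
    (\sum_i f (inr (inr (inl i))) + \sum_j f (inr (inr (inr j))))).
Proof.
rewrite big_sumType/= [X in _ + X]big_sumType/= big_sumType/=.
congr (_ + (_ + _)); last by rewrite (bigD1 tt)//= big1 ?addr0// => -[].
by rewrite pair_big/=; apply: eq_bigr => -[].
Qed.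

Lemma cov_mx_form a b : cov mx_form a b = dotv (p a) (p b) * dotv (q a) (q b) + 1.
Proof.
rewrite /cov sum_mx_index/= mulr1 [X in _ + (_ + (X + _))]big1; last by move=> i _; rewrite mulr0.
rewrite [X in _ + (_ + (_ + X))]big1; last by move=> i _; rewrite mulr0.
rewrite !addr0; congr (_ + _); rewrite /dotv mulr_suml; apply: eq_bigr => i _.
by rewrite mulr_sumr; apply: eq_bigr => j _; ring.
Qed.

Lemma cov_vec_form a b : cov vec_form a b = dotv (p a) (p b) + dotv (q a) (q b).
Proof.
rewrite /cov sum_mx_index/= mulr0 add0r big1 ?add0r// => i _.
by rewrite big1// => j _; rewrite mulr0.
Qed.

Lemma dotv_unit k (u v : 'rV[R]_k) : nrm2 u = 1 -> nrm2 v = 1 -> dotv u v <= 1.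
Proof. by move=> u1 v1; have := cauchy_schwarz u v; rewrite u1 v1 mulr1. Qed.

(** The covariances differ by [(1 - p p') (1 - q q')]: nonnegative by Cauchy-Schwarz, and zero
    inside a block by [pq]. The scalar variable supplies the 1 that completes this product. *)
Lemma gordon_bilinear k :
  (\int[@gaussI R mx_index]_z (gordonF k (linI vec_form (gco z)))%:E <=
   \int[@gaussI R mx_index]_z (gordonF k (linI mx_form (gco z)))%:E)%E.
Proof.
have uu l (u : 'rV[R]_l) : nrm2 u = 1 -> dotv u u = 1 by move=> h; rewrite -nrm2_sqr h expr1n.
apply: gordon => a b ab; rewrite cov_mx_form cov_vec_form.
  by case: (pq ab) => ->; rewrite uu//; ring.
have := dotv_unit (p1 a) (p1 b); have := dotv_unit (q1 a) (q1 b); nra.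
Qed.

(** The chain is [1 - bY <= mean of F on the vectors <= mean of F on the matrix <= P E + bX]. Only
    the means of a bounded functional are compared, so no statement about the nets' sizes
    appears. *)
Lemma random_matrix_core k (E : set T) (BX BY : set (mx_index -> R)) (bX bY : R) :
  measurable E -> small_event BX bX -> small_event BY bY ->
  (forall z, ~ BY z -> gordonF k (linI vec_form z) = 1) ->
  (forall w, ~ BX (joint ^~ w) -> gordonF k (linI mx_form (joint ^~ w)) != 0 -> E w.1) ->
  ((1 - (bX + bY))%:E <= P E)%E.
Proof.
move=> mE [eX [pX mX cX iX]] [eY [pY mY cY iY]] hY hX.
pose G := @gaussI R mx_index.
pose F (x : NA * NH -> R) : \bar R := (gordonF k x)%:E.
have F0 x : (0 <= F x)%E by rewrite lee_fin gordonF_ge0.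
have mF u : measurable_fun [set: @gspace R mx_index] (fun z => F (linI u (gco z))).
  apply/measurable_EFinP; apply: measurable_gordonF => a.
  by apply: measurable_linI => i; exact: measurable_gco.
have step1 : (1 <= \int[G]_z F (linI vec_form (gco z)) + bY%:E)%E.
  apply: (@le_trans _ _ (\int[G]_z (F (linI vec_form (gco z)) + (eY (gco z))%:E))%E).
    rewrite -[leLHS](integral_cst_prob G); apply: ge0_le_integral => //.
    - by apply: emeasurable_funD => //; exact/measurable_EFinP.
    - move=> z _; rewrite -EFinD lee_fin.
      have [zB|zB] := pselect (BY (gco z)).
        by rewrite (le_trans (cY _ zB))// lerDr gordonF_ge0.
      by rewrite hY// lerDl.
  rewrite ge0_integralD//; last 2 first.
  - by move=> z _; rewrite lee_fin.
  - exact/measurable_EFinP.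
  by rewrite leeD2l.
have Q := gauss_family_joint.
pose PQ := (P \x @gaussI R aux_index)%E.
have mXF : measurable_fun [set: T * @gspace R aux_index] (fun w => F (linI mx_form (joint ^~ w))).
  apply/measurable_EFinP; apply: measurable_gordonF => a.
  by apply: measurable_linI => i; exact: Q.1.
have step2 : (\int[G]_z F (linI mx_form (gco z)) <= P E + bX%:E)%E.
  rewrite -(ge0_integral_gauss_family (phi := fun z => F (linI mx_form z)) Q)//.
  have meX : measurable_fun [set: T * @gspace R aux_index] (fun w => (eX (joint ^~ w))%:E).
    by apply/measurable_EFinP; exact: (measurable_family Q.1 mX).
  have mET : measurable (E `*` [set: @gspace R aux_index]) by exact: measurableX.
  have mind : measurable_fun [set: T * @gspace R aux_index]
      (fun w => (\1_(E `*` [set: @gspace R aux_index]) w)%:E : \bar R).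
    by apply/measurable_EFinP; exact: measurable_indic.
  apply: (@le_trans _ _ (\int[PQ]_w ((\1_(E `*` [set: @gspace R aux_index]) w)%:E
      + (eX (joint ^~ w))%:E))%E).
    apply: ge0_le_integral => //; first exact: emeasurable_funD.
    move=> w _; rewrite -EFinD lee_fin.
    have [wB|wB] := pselect (BX (joint ^~ w)).
      apply: (le_trans (gordonF_le1 _ _)); apply: (le_trans (cX _ wB)).
      by rewrite lerDr.
    have [->|FN0] := eqVneq (gordonF k (linI mx_form (joint ^~ w))) 0.
      by rewrite addr_ge0.
    apply: (le_trans (gordonF_le1 _ _)); rewrite indicE mem_set ?lerDl//.
    by split => //; exact: hX.
  rewrite ge0_integralD//; last by move=> w _; rewrite lee_fin.
  rewrite (ge0_integral_gauss_family (phi := fun z => (eX z)%:E) Q);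
    [|exact/measurable_EFinP|by move=> z; rewrite lee_fin].
  rewrite integral_indic// setIT.
  apply: leeD => //.
  have PE : PQ (E `*` [set: @gspace R aux_index]) = P E.
    apply: etrans (product_measure1E P (@gaussI R aux_index) mE measurableT) _.
    rewrite -[RHS]mule1; congr (_ * _)%E; exact: probability_setT.
  by rewrite -PE.
have h := le_trans step1 (leeD2r bY%:E (le_trans (gordon_bilinear k) step2)).
have PEfin : P E \is a fin_num by rewrite fin_num_measure.
rewrite -(fineK PEfin) -!EFinD !lee_fin in h *.
lra.
Qed.

End core.
End random_matrix.

(** * The error function *)

Section erf_theory.
Context {R : realType}.
Import gauss_integral_proof.
Local Notation J := (@integral0_gauss R).

Lemma erf_ge0E (t : R) : 0 <= t -> erf t = 2 / Num.sqrt pi * J t.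
Proof. by move=> t0; rewrite /erf t0. Qed.

Lemma spi_gt0 : 0 < 2 / Num.sqrt pi :> R.
Proof. by rewrite divr_gt0// sqrtr_gt0 pi_gt0. Qed.

Lemma integral0_gauss0 : J 0 = 0.
Proof. by rewrite /integral0_gauss set_itv1 Rintegral_set1. Qed.

Lemma integral0_gauss_lt (a b : R) : 0 <= a -> a < b -> J a < J b.
Proof.
move=> a0 ab.
have cJ := continuous_integral0_gauss (le_trans a0 (ltW ab)).
have [||c _ E] := @MVT _ J (@gauss_fun R) a b ab.
- move=> x; rewrite in_itv/= => /andP[ax _].
  exact: is_derive_integral0_gauss (le_lt_trans a0 ax).
- by apply: continuous_subspaceW cJ => x /=; rewrite !in_itv/= => /andP[ax ->]; rewrite (le_trans a0).
- rewrite -subr_gt0 E mulr_gt0 ?subr_gt0//; exact: expR_gt0.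
Qed.

Lemma erf_lt (a b : R) : 0 <= a -> a < b -> erf a < erf b.
Proof.
move=> a0 ab; rewrite !erf_ge0E//; last exact: le_trans (ltW ab).
by rewrite ltr_pM2l ?spi_gt0// integral0_gauss_lt.
Qed.

(** [erfinv] picks an unspecified preimage; this sign shows that a preimage of a nonnegative value
    is nonnegative, where [erf_lt] gives strict monotonicity. *)
Lemma erf_lt0 (t : R) : t < 0 -> erf t < 0.
Proof.
move=> t0; rewrite /erf leNgt t0/= mulrN oppr_lt0 mulr_gt0 ?spi_gt0//.
have ci (f : R -> R) : continuous f -> lebesgue_measure.-integrable `[t, 0] (EFin \o f).
  move=> cf; apply: continuous_compact_integrable; first exact: segment_compact.
  exact: continuous_subspaceT.
apply: (@lt_le_trans _ _ (Rintegral lebesgue_measure `[t, 0] (fun=> gauss_fun t))).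
  rewrite Rintegral_cst//= lebesgue_measure_itv/= lte_fin t0/= sub0r.
  by rewrite mulr_gt0 ?oppr_gt0// expR_gt0.
apply: le_Rintegral => //.
- by apply: ci => x; exact: cst_continuous.
- by apply: ci; exact: continuous_gauss_fun.
- move=> x; rewrite /= in_itv/= => /andP[tx x0]; rewrite ler_expR lerN2.
  by rewrite -(sqrrN t) -(sqrrN x) lerXn2r ?nnegrE ?oppr_ge0 ?lerN2// ltW.
Qed.

Lemma erf_surj (y : R) : 0 <= y < 1 -> exists2 t, 0 <= t & erf t = y.
Proof.
move=> /andP[y0 y1].
have h : (fun x => 2 / Num.sqrt pi * J x) x @[x --> +oo] --> (2 / Num.sqrt pi * (Num.sqrt pi / 2) : R).
  by apply: cvgMr; exact: cvg_integral0_gauss.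
have e1 : 2 / Num.sqrt pi * (Num.sqrt pi / 2) = 1 :> R.
  by field; rewrite gt_eqF// sqrtr_gt0 pi_gt0.
rewrite e1 in h.
move: h => /cvgrPdist_lt/(_ (1 - y)); rewrite subr_gt0 => /(_ y1) [M [_ HM]].
pose b := Num.max M 0 + 1.
have m0 : 0 <= Num.max M 0 by rewrite le_max lexx orbT.
have mM : M <= Num.max M 0 by rewrite le_max lexx.
have b0 : 0 < b by rewrite /b; lra.
have Mb : M < b by rewrite /b; lra.
have yb : y < 2 / Num.sqrt pi * J b by have := HM b Mb; rewrite ltr_norml => /andP[_]; lra.
have cb := continuous_integral0_gauss (ltW b0).
have cc : {within `[0, b], continuous (fun x => 2 / Num.sqrt pi * J x)}.
  by move=> x; apply: cvgMr; exact: cb.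
have [|c cin cE] := @IVT _ (fun x => 2 / Num.sqrt pi * J x) 0 b y (ltW b0) cc.
  have jb := le_trans y0 (ltW yb).
  by rewrite integral0_gauss0 mulr0 (min_l jb) (max_r jb) y0 (ltW yb).
move: cin; rewrite in_itv/= => /andP[c0 _].
by exists c => //; rewrite erf_ge0E.
Qed.

Lemma erfinvK (y : R) : 0 <= y < 1 -> erf (erfinv y) = y.
Proof.
move=> /erf_surj[t _ te]; rewrite /erfinv; exact: (@xgetPex _ 0 [set t | erf t = y] (ex_intro _ t te)).
Qed.

Lemma erfinv_ge0 (y : R) : 0 <= y < 1 -> 0 <= erfinv y.
Proof.
move=> y01; rewrite leNgt; apply/negP => /erf_lt0; rewrite erfinvK//.
by case/andP: y01 => y0 _; rewrite ltNge y0.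
Qed.

Lemma erfinv_le (x y : R) : 0 <= x -> x <= y -> y < 1 -> erfinv x <= erfinv y.
Proof.
move=> x0 xy y1.
have xi : 0 <= x < 1 by rewrite x0 (le_lt_trans xy).
have yi : 0 <= y < 1 by rewrite (le_trans x0).
rewrite leNgt; apply/negP => /(erf_lt (erfinv_ge0 yi)).
by rewrite !erfinvK// ltNge xy.
Qed.

(** This covers values outside the range too: there the default 0 is returned, whence the weak
    inequality. *)
Lemma erfinv_neg (y : R) : y < 0 -> erfinv y <= 0.
Proof.
move=> y0; rewrite /erfinv; case: xgetP => [t _ /= te|_]; last by [].
rewrite leNgt; apply/negP => t0.
have := erf_lt (lexx 0) t0; rewrite te (_ : erf 0 = 0) => [h|]; first by have := lt_trans h y0; rewrite ltxx.
by rewrite erf_ge0E// integral0_gauss0 mulr0.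
Qed.

End erf_theory.

(** * Concentration events *)

Section concentration_events.
Context {R : realType}.
Local Notation gauss := (normal_prob (0 : R) 1).
Local Notation TR := (measurableTypeR R).

Definition entry m n i j : mx_index m n := inl (i, j).
Definition scalar_coord m n : mx_index m n := inr (inl tt).
Definition row_coord m n i : mx_index m n := inr (inr (inl i)).
Definition col_coord m n j : mx_index m n := inr (inr (inr j)).

Lemma Rintegral_gauss_cst (c : R) : (\int[gauss]_x c)%R = c.
Proof. exact: (@Rintegral_cst_prob _ TR R gauss). Qed.

Lemma Rintegral_gauss_sqr : (\int[gauss]_x (x ^+ 2))%R = 1.
Proof. by rewrite /Rintegral gauss_integral_sqr. Qed.

Lemma measurable_sqr : measurable_fun [set: TR] (fun x : TR => x ^+ 2 : TR).
Proof. exact: measurable_funX. Qed.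

Lemma integrable_gauss_sqr : gauss.-integrable [set: TR] (EFin \o (fun x : TR => x ^+ 2)).
Proof.
apply: (@integrable_quadratic R (fun x => x ^+ 2) 1 ltr01 measurable_sqr).
by move=> x; rewrite ger0_norm ?sqr_ge0// mul1r lerDr.
Qed.

Lemma Rintegral_gauss_Nsqr : (\int[gauss]_x (- x ^+ 2))%R = -1.
Proof.
under eq_Rintegral do rewrite -mulN1r.
rewrite (@RintegralZl _ TR R gauss)//; last exact: integrable_gauss_sqr.
by rewrite Rintegral_gauss_sqr mulr1.
Qed.

Lemma small_event_le (I : finType) (B : set (I -> R)) (b b' : R) : b <= b' ->
  small_event B b -> small_event B b'.
Proof.
move=> bb [ex [h1 h2 h3 h4]]; exists ex; split => //.
by apply: (le_trans h4); rewrite lee_fin.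
Qed.

Lemma small_event_sub (I : finType) (B B' : set (I -> R)) (b : R) : B' `<=` B ->
  small_event B b -> small_event B' b.
Proof. by move=> BB [ex [h1 h2 h3 h4]]; exists ex; split => // z /BB; exact: h3. Qed.

(** The functions [f j] are transported along [phi]; by injectivity each fibre has at most one
    element, so every [psi i] is some [f j] or zero. *)
Lemma chernoff_family (C e : R) : 0 < C -> 0 < e ->
  exists2 c, 0 < c & forall (I J : finType) (phi : J -> I) (f : J -> R -> R) (N : nat) (mean : R),
  injective phi ->
  (forall j, measurable_fun [set: TR] (f j)) ->
  (forall j x, `|f j x| <= C * (1 + x ^+ 2)) -> (#|J| <= N)%N ->
  (\sum_j (\int[gauss]_x f j x)%R <= mean) ->
  small_event [set z : I -> R | mean + e * N%:R <= \sum_j f j (z (phi j))] (expR (- c * N%:R)).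
Proof.
move=> C0 e0; have [c c0 H] := chernoff_small_event C0 e0.
exists c => // I J phi f N mean phiI mf fC JN hmean.
pose psi i x := \sum_(j | phi j == i) f j x.
have psiE i : (exists j, phi j = i /\ psi i = f j) \/
    ((forall j, phi j != i) /\ psi i = (fun=> 0)).
  have [[j ji]|nj] := pselect (exists j, phi j = i); [left|right].
    exists j; split => //; apply/funext => x; rewrite /psi (big_pred1 j)// => k /=.
    by rewrite -ji (inj_eq phiI).
  have nj' j : phi j != i by apply/eqP => ji; apply: nj; exists j.
  by split => //; apply/funext => x; rewrite /psi big1// => j; rewrite (negbTE (nj' j)).
apply: small_event_sub (H _ [set phi j | j : J]%SET psi N mean _ _ _ _ _).
- by move=> z /= h; rewrite (le_trans h)// (partition_big phi xpredT)//=; apply: ler_sum => i _;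
    apply: ler_sum => j /eqP ->.
- by move=> i; case: (psiE i) => [[j [_ ->]]|[_ ->]]; [exact: mf|exact: measurable_cst].
- move=> i x; case: (psiE i) => [[j [_ ->]]|[_ ->]]; first exact: fC.
  by rewrite normr0 mulr_ge0 ?addr_ge0 ?sqr_ge0// ltW.
- move=> i x iN; case: (psiE i) => [[j [ji ->]]|[_ ->]]//.
  by case/negP: iN; rewrite -ji; apply/imsetP; exists j.
- exact: leq_trans (leq_imset_card _ _) _.
- apply: le_trans hmean; rewrite (partition_big phi xpredT)//=; apply: ler_sum => i _.
  case: (psiE i) => [[j [ji ->]]|[nj ->]].
    by rewrite (big_pred1 j)// => k /=; rewrite -ji (inj_eq phiI).
  rewrite Rintegral_gauss_cst big1// => j; by rewrite (negbTE (nj j)).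
Qed.

Lemma sqr_bound (x : R) : `|x ^+ 2| <= 1 * (1 + x ^+ 2).
Proof. by rewrite ger0_norm ?sqr_ge0// mul1r lerDr. Qed.

Lemma le_expRN (c : R) (n N : nat) : 0 < c -> (n <= N)%N -> expR (- c * N%:R) <= expR (- c * n%:R).
Proof. by move=> c0 nN; rewrite ler_expR !mulNr lerN2 ler_pM2l// ler_nat. Qed.

Lemma event_row_sqr (e : R) : 0 < e -> exists2 c, 0 < c & forall m n : nat, (m <= n)%N ->
  small_event [set z : mx_index m n -> R |
    m%:R + e * n%:R <= \sum_i z (row_coord n i) ^+ 2] (expR (- c * n%:R)).
Proof.
move=> e0; have [c c0 H] := chernoff_family (ltr01 : 0 < 1 :> R) e0.
exists c => // m n mn.
apply: (H _ _ (row_coord n) (fun _ x => x ^+ 2)).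
- by move=> i j [].
- by move=> ?; exact: measurable_sqr.
- by move=> _; exact: sqr_bound.
- by rewrite card_ord.
- by rewrite Rintegral_gauss_sqr sumr_const card_ord.
Qed.

Lemma event_row_Nsqr (e : R) : 0 < e -> exists2 c, 0 < c & forall m n : nat, (m <= n)%N ->
  small_event [set z : mx_index m n -> R |
    \sum_i z (row_coord n i) ^+ 2 <= m%:R - e * n%:R] (expR (- c * n%:R)).
Proof.
move=> e0; have [c c0 H] := chernoff_family (ltr01 : 0 < 1 :> R) e0.
exists c => // m n mn.
apply: small_event_sub (H _ _ (row_coord n) (fun _ x => - x ^+ 2) n (- m%:R) _ _ _ _ _).
- by move=> z /= h; rewrite sumrN; lra.
- by move=> i j [].
- by move=> ?; apply: measurable_funN; exact: measurable_sqr.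
- by move=> _ x; rewrite normrN; exact: sqr_bound.
- by rewrite card_ord.
- by rewrite Rintegral_gauss_Nsqr sumr_const card_ord mulNrn.
Qed.

(** A single variable exceeds the order [sqrt n] with exponentially small probability; it is
    obtained from the Chernoff bound with one active coordinate and [N = n]. *)
Lemma event_scalar (e : R) : 0 < e -> exists2 c, 0 < c & forall m n : nat, (0 < n)%N ->
  small_event [set z : mx_index m n -> R |
    1 + e * n%:R <= z (scalar_coord m n) ^+ 2] (expR (- c * n%:R)).
Proof.
move=> e0; have [c c0 H] := chernoff_family (ltr01 : 0 < 1 :> R) e0.
exists c => // m n n0.
apply: small_event_sub (H _ unit (fun=> scalar_coord m n) (fun _ x => x ^+ 2) n 1 _ _ _ _ _).
- by move=> z /= h; rewrite (bigD1 tt)//= big1 ?addr0// => -[].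
- by move=> [] [].
- by move=> ?; exact: measurable_sqr.
- by move=> _; exact: sqr_bound.
- by rewrite card_unit.
- by rewrite Rintegral_gauss_sqr sumr_const card_unit.
Qed.

Lemma event_entries : exists2 c : R, 0 < c & forall m n : nat,
  small_event [set z : mx_index m n -> R |
    (2 * (m * n) + n)%:R <= \sum_i \sum_j z (entry i j) ^+ 2] (expR (- c * n%:R)).
Proof.
have [c c0 H] := chernoff_family (ltr01 : 0 < 1 :> R) (ltr01 : 0 < 1 :> R).
exists c => // m n.
(* The count [m n] is padded by [n], which ensures a rate of order [n] whatever [m] is; mean plus
   deviation then reads [2 m n + n]. *)
apply: small_event_le (le_expRN c0 (leq_addl (m * n) n)) _.
apply: small_event_sub (H _ _ (fun p : 'I_m * 'I_n => entry p.1 p.2) (fun _ x => x ^+ 2)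
  (m * n + n)%N (m * n)%:R _ _ _ _ _).
- move=> z /= h; rewrite pair_big/= in h; apply: le_trans h.
  by rewrite mul1r -natrD ler_nat addnA addnn -mul2n.
- by move=> [a b] [a' b'] /= [-> ->].
- by move=> ?; exact: measurable_sqr.
- by move=> _; exact: sqr_bound.
- by rewrite card_prod !card_ord leq_addr.
- by rewrite Rintegral_gauss_sqr sumr_const card_prod !card_ord.
Qed.

Lemma event_cols (C e : R) : 0 < C -> 0 < e ->
  exists2 c, 0 < c & forall (m n : nat) (f : 'I_n -> R -> R) (mean : R),
  (forall j, measurable_fun [set: TR] (f j)) ->
  (forall j x, `|f j x| <= C * (1 + x ^+ 2)) ->
  (\sum_j (\int[gauss]_x f j x)%R <= mean) ->
  small_event [set z : mx_index m n -> R |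
    mean + e * n%:R <= \sum_j f j (z (col_coord m j))] (expR (- c * n%:R)).
Proof.
move=> C0 e0; have [c c0 H] := chernoff_family C0 e0.
exists c => // m n f mean mf fC hm.
apply: (H _ _ (@col_coord m n)) => //; first by move=> i j [].
by rewrite card_ord.
Qed.

End concentration_events.

(** * Means of truncated and signed quadratics *)

Section gaussian_means.
Context {R : realType}.
Local Notation gauss := (normal_prob (0 : R) 1).
Local Notation TR := (measurableTypeR R).
Local Notation pdf := (normal_pdf (0 : R) 1).

Lemma Rintegral_comb3 (f g h : TR -> TR) (a b c : R) :
  gauss.-integrable [set: TR] (EFin \o f) -> gauss.-integrable [set: TR] (EFin \o g) ->
  gauss.-integrable [set: TR] (EFin \o h) ->
  (\int[gauss]_x (a * f x + b * g x + c * h x))%R =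
  a * (\int[gauss]_x f x)%R + b * (\int[gauss]_x g x)%R + c * (\int[gauss]_x h x)%R.
Proof.
move=> if_ ig ih.
have iZ (k : R) (u : TR -> TR) : gauss.-integrable [set: TR] (EFin \o u) ->
    gauss.-integrable [set: TR] (EFin \o (fun x => k * u x)).
  move=> iu; rewrite (_ : _ \o _ = (fun x => k%:E * (u x)%:E)%E); last by apply/funext.
  by apply: (@integrableZl _ TR).
have iD : gauss.-integrable [set: TR] (EFin \o (fun x => a * f x + b * g x)).
  rewrite (_ : _ \o _ = (fun x => (a * f x)%:E + (b * g x)%:E)%E); last by apply/funext.
  by apply: (@integrableD _ TR) => //; exact: iZ.
rewrite (@RintegralD _ TR R gauss _ _ _ measurableT iD (iZ _ _ ih)).
rewrite (@RintegralD _ TR R gauss _ _ _ measurableT (iZ _ _ if_) (iZ _ _ ig)).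
by rewrite !(@RintegralZl _ TR R gauss).
Qed.

Lemma Rintegral_gauss_id : (\int[gauss]_x x)%R = 0.
Proof.
have mn : measurable_fun [set: TR] (fun x : TR => `|x| : TR) by exact: normr_measurable.
have bn (x : R) : `|x| <= 1 + x ^+ 2.
  by rewrite -(real_normK (num_real x)); have := sqr_ge0 (`|x| - 1); have := normr_ge0 x; nra.
(* Adding [|x|] makes the integrand nonnegative, so that the reflection formula for nonnegative
   functions applies. *)
have ip (k : R) : `|k| = 1 -> gauss.-integrable [set: TR] (EFin \o (fun x => `|x| + k * x)).
  move=> k1; apply: (@integrable_quadratic R (fun x => `|x| + k * x) 2).
  - by [].
  - by apply: measurable_funD => //; apply: measurable_funM.
  - move=> x; apply: (le_trans (ler_normD _ _)); rewrite normrM k1 normr_id mul1r.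
    by have := bn x; lra.
have e : (\int[gauss]_x (`|x| + 1 * x))%R = (\int[gauss]_x (`|x| + (-1) * x))%R.
  rewrite /Rintegral -(@ge0_gauss_integralN R (fun x => (`|x| + 1 * x)%:E)).
  - by congr fine; apply: eq_integral => x _; rewrite normrN mulrN mulNr.
  - by apply/measurable_EFinP; apply: measurable_funD => //; apply: measurable_funM.
  - by move=> x; rewrite lee_fin mul1r -lerBlDl sub0r lerNnormlW.
have i1 := ip 1 (normr1 _); have i2 := ip (-1) (normrN1 _).
have E : (\int[gauss]_x x)%R =
  (\int[gauss]_x (1 / 2 * (`|x| + 1 * x) + (-1) / 2 * (`|x| + (-1) * x) + 0 * (`|x| + 1 * x)))%R.
  by apply: eq_Rintegral => x _; field.
by rewrite E (Rintegral_comb3 _ _ _ i1 i2 i1) e; field.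
Qed.

Section column_functions.
Variables (v a b c a' b' c' : R).
Hypothesis v0 : 0 <= v.

Definition trunc (x : R) : R := (v < `|x|)%R%:R.

Definition gauss_tail := 1 - erf (v / Num.sqrt 2).

Definition trunc_quad (x : R) : R := trunc x * (a' * x ^+ 2 + b' * `|x| + c').
Definition signed_quad (s x : R) : R := a * x ^+ 2 + b * (s * x) + c.

Lemma measurable_trunc : measurable_fun [set: TR] (trunc : TR -> TR).
Proof.
have -> : trunc = \1_([set x : TR | v < `|x|]).
  apply/funext => x; rewrite /trunc indicE; congr (_%:R); congr nat_of_bool.
  by apply/idP/idP => [h|]; [exact/mem_set|move=> /set_mem].
apply: measurable_indic.
have -> : [set x : TR | v < `|x|] = [set: TR] `&` (fun x : TR => `|x|) @^-1` `]v, +oo[.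
  by rewrite setTI; apply/seteqP; split => x /=; rewrite in_itv/= andbT.
by apply: normr_measurable => //; exact: measurable_itv.
Qed.

Lemma trunc_le1 x : 0 <= trunc x <= 1.
Proof. by rewrite /trunc; case: (v < _); rewrite /= ?lexx ?ler01. Qed.

Lemma norm_le_quad (x : R) : `|x| <= 1 + x ^+ 2.
Proof.
by rewrite -(real_normK (num_real x)); have := sqr_ge0 (`|x| - 1); have := normr_ge0 x; nra.
Qed.

Lemma measurable_quad_norm : measurable_fun [set: TR] (fun x : TR => a' * x ^+ 2 + b' * `|x| + c' : TR).
Proof.
apply: measurable_funD => //; apply: measurable_funD; apply: measurable_funM => //.
Qed.

Lemma measurable_trunc_quad : measurable_fun [set: TR] (trunc_quad : TR -> TR).
Proof. by apply: measurable_funM; [exact: measurable_trunc|exact: measurable_quad_norm]. Qed.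

Lemma measurable_signed_quad s : measurable_fun [set: TR] (signed_quad s : TR -> TR).
Proof.
apply: measurable_funD => //; apply: measurable_funD; apply: measurable_funM => //.
Qed.

Lemma quad_bound (A B C x y : R) : `|y| = `|x| ->
  `|A * x ^+ 2 + B * y + C| <= (`|A| + `|B| + `|C|) * (1 + x ^+ 2).
Proof.
move=> yx; apply: (le_trans (ler_normD _ _)); apply: (le_trans (lerD (ler_normD _ _) (lexx _))).
rewrite (normrM A) (normrM B) yx (ger0_norm (sqr_ge0 x)).
have := norm_le_quad x; have := sqr_ge0 x; have := normr_ge0 A; have := normr_ge0 B; have := normr_ge0 C.
nra.
Qed.

Lemma trunc_quad_bound x : `|trunc_quad x| <= (`|a'| + `|b'| + `|c'|) * (1 + x ^+ 2).
Proof.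
rewrite /trunc_quad normrM; have /andP[t0 t1] := trunc_le1 x; rewrite (ger0_norm t0).
by apply: le_trans (quad_bound a' b' c' (normr_id x)); rewrite ler_piMl.
Qed.

Lemma signed_quad_bound s x : `|s| = 1 ->
  `|signed_quad s x| <= (`|a| + `|b| + `|c|) * (1 + x ^+ 2).
Proof. by move=> s1; apply: quad_bound; rewrite normrM s1 mul1r. Qed.


Lemma Rintegral_trunc_quad : (\int[gauss]_x trunc_quad x)%R =
  a' * (2 * v * pdf v + gauss_tail) + b' * (2 * pdf v) + c' * gauss_tail.
Proof.
have mt := measurable_trunc.
have iq (f : TR -> TR) : measurable_fun [set: TR] f -> (forall x, `|f x| <= 1 + x ^+ 2) ->
    gauss.-integrable [set: TR] (EFin \o (fun x => trunc x * f x)).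
  move=> mf bf; apply: (@integrable_quadratic R (fun x => trunc x * f x) 1); first exact: ltr01.
    exact: measurable_funM.
  move=> x; rewrite mul1r normrM; have /andP[t0 t1] := trunc_le1 x; rewrite (ger0_norm t0).
  by apply: le_trans (bf x); rewrite ler_piMl.
have -> : (\int[gauss]_x trunc_quad x)%R = (\int[gauss]_x
   (a' * (trunc x * x ^+ 2) + b' * (trunc x * `|x|) + c' * (trunc x * 1)))%R.
  by apply: eq_Rintegral => x _; rewrite /trunc_quad; ring.
rewrite Rintegral_comb3.
- congr (_ * _ + _ * _ + _ * _); rewrite /Rintegral.
  + by under eq_integral do rewrite EFinM; rewrite gauss_trunc2.
  + by under eq_integral do rewrite EFinM; rewrite gauss_trunc1.
  + by under eq_integral do rewrite mulr1; rewrite gauss_trunc0.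
- by apply: iq => [|x]; [exact: measurable_funX|rewrite ger0_norm ?sqr_ge0// lerDr].
- by apply: iq => [|x]; [exact: normr_measurable|rewrite normr_id norm_le_quad].
- by apply: iq => [|x]; [exact: measurable_cst|rewrite normr1 lerDl sqr_ge0].
Qed.

Lemma Rintegral_signed_quad s : (\int[gauss]_x signed_quad s x)%R = a + c.
Proof.
have iid : gauss.-integrable [set: TR] (EFin \o (fun x : TR => x)).
  apply: (@integrable_quadratic R (fun x => x) 1) => //.
  by move=> x; rewrite mul1r norm_le_quad.
have i1 : gauss.-integrable [set: TR] (EFin \o (fun x : TR => 1 : TR)).
  apply: (@integrable_quadratic R (fun x => 1) 1) => //.
  by move=> x; rewrite mul1r normr1 lerDl sqr_ge0.
have -> : (\int[gauss]_x signed_quad s x)%R = (\int[gauss]_x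
   (a * (x ^+ 2) + (b * s) * x + c * 1))%R.
  by apply: eq_Rintegral => x _; rewrite /signed_quad; ring.
rewrite (Rintegral_comb3 _ _ _ integrable_gauss_sqr iid i1).
by rewrite Rintegral_gauss_sqr Rintegral_gauss_id Rintegral_gauss_cst; ring.
Qed.

End column_functions.
End gaussian_means.

Section column_events.
Context {R : realType}.
Local Notation gauss := (normal_prob (0 : R) 1).
Local Notation TR := (measurableTypeR R).
Local Notation pdf := (normal_pdf (0 : R) 1).

(** A common form for every column statistic of the proof: squared distance, cone functional, inner
    product and squared norm of the trial vector all differ only in the six coefficients. *)
Definition col_quad n (S : {set 'I_n}) (sigma : 'I_n -> bool) (v a b c a' b' c' : R) j x : R :=
  if j \in S then signed_quad a b c ((-1) ^+ sigma j) x else trunc_quad v a' b' c' x.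

(** The limit of the mean of the sum of [col_quad], divided by [n]; the signed linear term on [S] is
    centred and leaves no trace. *)
Definition quad_mean (beta v a c a' b' c' : R) : R := beta * (a + c) +
  (1 - beta) * (a' * (2 * v * pdf v + gauss_tail v) + b' * (2 * pdf v) + c' * gauss_tail v).

Lemma event_quad (beta v a b c a' b' c' e : R) : 0 <= beta -> 0 <= v -> 0 < e ->
  exists2 t, 0 < t & exists N : nat, forall m n, (N <= n)%N ->
  forall (S : {set 'I_n}) sigma, #|S| = Num.truncn (beta * n%:R) ->
  small_event [set z : mx_index m n -> R | n%:R * (quad_mean beta v a c a' b' c' + e) <=
      \sum_j col_quad S sigma v a b c a' b' c' j (z (col_coord m j))] (expR (- t * n%:R)).
Proof.
move=> beta0 v0 e0.
pose C := (`|a| + `|b| + `|c|) + (`|a'| + `|b'| + `|c'|) + 1.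
have C0 : 0 < C by rewrite ltr_wpDl// !addr_ge0.
have e20 : 0 < e / 2 by rewrite divr_gt0.
have [t t0 H] := event_cols C0 e20.
pose M := a' * (2 * v * pdf v + gauss_tail v) + b' * (2 * pdf v) + c' * gauss_tail v.
(* Rounding [beta n] to the size of [S] shifts the mean by at most [D]. Half of the margin [e n]
   absorbs it for large [n], and the other half is left for the deviation. *)
pose D := `|a + c - M|.
exists t => //; exists (Num.truncn (D / (e / 2))).+1 => m n Nn S sigma cardS.
have Dn : D <= e / 2 * n%:R.
  rewrite mulrC -ler_pdivrMr//; apply: le_trans (ltW (truncnS_gt _)) _.
  by rewrite ler_nat.
apply: small_event_sub (H m n (col_quad S sigma v a b c a' b' c')
  (n%:R * quad_mean beta v a c a' b' c' + D) _ _ _).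
- by move=> z /= h; apply: le_trans h; lra.
- move=> j; rewrite /col_quad; case: (j \in S); first exact: measurable_signed_quad.
  exact: measurable_trunc_quad.
- move=> j x; have p0 : 0 <= 1 + x ^+ 2 by rewrite addr_ge0 ?sqr_ge0.
  rewrite /col_quad; case: (j \in S).
    apply: le_trans (signed_quad_bound a b c x _) _; first by rewrite normrX normrN1 expr1n.
    by rewrite ler_wpM2r// /C -[leRHS]addrA lerDl !addr_ge0.
  apply: le_trans (trunc_quad_bound v a' b' c' x) _.
  by rewrite ler_wpM2r// /C -[leRHS]addrA addrCA -addrA lerDl !addr_ge0.
- rewrite (bigID (mem S))/=.
  rewrite (eq_bigr (fun=> a + c)); last by move=> j jS; rewrite /col_quad jS Rintegral_signed_quad.
  rewrite [X in _ + X](eq_bigr (fun=> M)); last first.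
    by move=> j jS; rewrite /col_quad (negbTE jS) Rintegral_trunc_quad.
  rewrite !sumr_const.
  have cC : #|[pred i | i \notin S]| = (n - #|S|)%N.
    rewrite -[in RHS](finset.setCK S) -[X in (X - _)%N](card_ord n) -cardsCs.
    by rewrite -cardsE; apply: eq_card => i; rewrite !inE.
  rewrite (_ : #|(fun i => i \notin S)| = (n - #|S|)%N)//.
  have kn : (#|S| <= n)%N by rewrite -[X in (_ <= X)%N]card_ord max_card.
  rewrite -(mulr_natl (a + c)) -(mulr_natl M) natrB//.
  have /andP[k1 k2] : #|S|%:R <= beta * n%:R < #|S|.+1%:R.
    by rewrite cardS; apply: truncn_itv; rewrite mulr_ge0.
  set k : R := #|S|%:R in k1 k2 *.
  rewrite -natr1 -/k in k2.
  rewrite /quad_mean -/M.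
  have : (k - beta * n%:R) * (a + c - M) <= D.
    apply: le_trans (ler_norm _) _; rewrite normrM -/D ler_piMl ?normr_ge0//.
    by rewrite ler_norml; apply/andP; split; lra.
  lra.
Qed.

End column_events.

(** * Recovery above the threshold *)

Section bilinear_values.
Context {R : realType} (m n : nat) (NA NH : finType).
Variables (p : NA * NH -> 'rV[R]_m) (q : NA * NH -> 'rV[R]_n).

Definition row_part (z : mx_index m n -> R) : 'rV[R]_m := \row_i z (row_coord n i).
Definition col_part (z : mx_index m n -> R) : 'rV[R]_n := \row_j z (col_coord m j).
Definition mx_part (z : mx_index m n -> R) : 'M[R]_(m, n) := \matrix_(i, j) z (entry i j).

Lemma linI_vec_form z a :
  linI (vec_form p q) z a = dotv (p a) (row_part z) + dotv (q a) (col_part z).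
Proof.
rewrite /linI /lin sum_mx_index/= mul0r add0r big1 ?add0r; last first.
  by move=> i _; rewrite big1// => j _; rewrite mul0r.
by congr (_ + _); apply: eq_bigr => i _; rewrite mxE.
Qed.

Lemma linI_mx_form z a :
  linI (mx_form p q) z a = dotv (p a) (q a *m (mx_part z)^T) + z (scalar_coord m n).
Proof.
rewrite /linI /lin sum_mx_index/= mul1r [X in _ + (_ + (X + _))]big1; last by move=> i _; rewrite mul0r.
rewrite [X in _ + (_ + (_ + X))]big1; last by move=> i _; rewrite mul0r.
rewrite !addr0; congr (_ + _); apply: eq_bigr => i _.
by rewrite mxE mulr_sumr; apply: eq_bigr => j _; rewrite !mxE mulrA.
Qed.

Lemma dotv_row_part z : dotv (row_part z) (row_part z) = \sum_i z (row_coord n i) ^+ 2.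
Proof. by apply: eq_bigr => i _; rewrite !mxE expr2. Qed.

End bilinear_values.

Section gordon_matrix_side.
Context {R : realType} d (T : measurableType d) (m n : nat) (A : T -> 'M[R]_(m, n)).
Variables (NA NH : finType) (p : NA * NH -> 'rV[R]_m) (q : NA * NH -> 'rV[R]_n).

(** The level is [2 del] because the scalar variable may take up to [del] of it: its square is below
    [1 + del^2 / 2 <= del^2]. *)
Lemma gordonF_mx_form (del : R) w : 0 < del -> 2 <= del ^+ 2 ->
  let z := joint A ^~ w in
  z (scalar_coord m n) ^+ 2 < 1 + del ^+ 2 / 2 ->
  gordonF (2 * del) (linI (mx_form p q) z) != 0 ->
  forall a, exists h, del <= dotv (p (a, h)) (q (a, h) *m (A w.1)^T).
Proof.
move=> del0 del2 z zs gF a; have [h] := gordonF_gt0 a gF; rewrite linI_mx_form.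
have -> : mx_part z = A w.1 by apply/matrixP => i j; rewrite mxE.
move=> hl; exists h; suff : z (scalar_coord m n) < del by move: hl; lra.
rewrite ltNge; apply/negP => h1.
have : del ^+ 2 <= z (scalar_coord m n) ^+ 2.
  by rewrite lerXn2r ?nnegrE ?(ltW del0)// (le_trans (ltW del0)).
move: zs del2; lra.
Qed.

Lemma fnorm_joint w (r : R) : \sum_i \sum_j joint A (entry i j) w ^+ 2 < r ->
  fnorm (A w.1) <= Num.sqrt r.
Proof. by move=> h; rewrite ler_wsqrtr// ltW. Qed.

End gordon_matrix_side.

Section cone_polar.
Context {R : realType}.

(* [g - w] is the point nearest to [g] of the subdifferential of the l1 norm
   scaled by [- v'], hence has nonpositive product with [- h]; lowering the
   cutoff from [v'] to [v] only enlarges the right-hand side. *)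
Lemma cone_dot_bound n (S : {set 'I_n}) sigma (v v' : R) (h g : 'rV[R]_n) :
  0 <= v <= v' -> cone S sigma h -> nrm2 h = 1 ->
  - dotv h g <= Num.sqrt (\sum_j col_quad S sigma v 1 (2 * v') (v' ^+ 2) 1 (- 2 * v') (v' ^+ 2) j (g 0 j)).
Proof.
move=> /andP[v0 vv'] ch nh; have v'0 := le_trans v0 vv'.
pose w : 'rV[R]_n := \row_j (if j \in S then g 0 j + v' * (-1) ^+ sigma j
  else if `|g 0 j| <= v' then 0 else if 0 <= g 0 j then g 0 j - v' else g 0 j + v').
have wg : dotv h (w - g) <= 0.
  apply: (@le_trans _ _ (v' * cone_fun S sigma h)); last exact: mulr_ge0_le0.
  rewrite /dotv (bigID (mem S))/= addrC /cone_fun mulrDr !mulr_sumr; apply: lerD; apply: ler_sum => j jS.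
    apply: (le_trans (ler_norm _)); rewrite normrM mulrC ler_wpM2r ?normr_ge0//.
    rewrite !mxE (negbTE jS); case: ifPn => [gv|]; first by rewrite sub0r normrN.
    rewrite -ltNge => _; case: ifP => _.
      by rewrite addrC addKr normrN ger0_norm.
    by rewrite addrC addKr ger0_norm.
  by rewrite !mxE jS (addrC (g 0 j)) addrK; lra.
have -> : - dotv h g = - dotv h w + dotv h (w - g).
  by rewrite dotvDr (dotvC h (- g)) dotvNl (dotvC g h); ring.
apply: (@le_trans _ _ (nrm2 w)).
  have := cauchy_schwarzN h w; rewrite nh mul1r; lra.
rewrite /nrm2 ler_wsqrtr//; apply: ler_sum => j _; rewrite -expr2 mxE /col_quad.
case: (j \in S).
  have s2 := sqrr_sign R (sigma j); rewrite /signed_quad.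
  set s := (-1) ^+ sigma j in s2 *; set x := g 0 j.
  have -> : (x + v' * s) ^+ 2 = x ^+ 2 + 2 * v' * (s * x) + v' ^+ 2 * s ^+ 2 by ring.
  by rewrite s2 mulr1 mul1r.
set x := g 0 j; rewrite /trunc_quad /trunc.
have E : 1 * x ^+ 2 + - 2 * v' * `|x| + v' ^+ 2 = (`|x| - v') ^+ 2.
  by rewrite -(real_normK (num_real x)); ring.
rewrite E; case: ifPn => [_|]; first by rewrite expr0n /= mulr_ge0// sqr_ge0.
rewrite -ltNge => xv; rewrite (le_lt_trans vv' xv) mul1r.
case: ifP => [x0|/negbT]; first by rewrite ger0_norm.
by rewrite -ltNge => x0; rewrite (ltr0_norm x0) -[leRHS]sqrrN opprB opprK addrC.
Qed.

End cone_polar.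

Section large_n.
Context {R : realType}.

Lemma ex_large_nat (x : R) : exists N : nat, forall n, (N <= n)%N -> x <= n%:R.
Proof.
exists (Num.truncn x).+1 => n Nn; apply: le_trans (ltW (truncnS_gt _)) _.
by rewrite ler_nat.
Qed.

(** Halving the smaller rate leaves a spare factor [exp(- c n)], which for large [n] is at most 1/2
    and pays for having two terms. *)
Lemma expRN_add2 (c1 c2 : R) : 0 < c1 -> 0 < c2 -> exists2 c, 0 < c &
  exists N : nat, forall n, (N <= n)%N ->
  expR (- c1 * n%:R) + expR (- c2 * n%:R) <= expR (- c * n%:R).
Proof.
move=> c10 c20; pose c := Num.min c1 c2 / 2.
have c0 : 0 < c by rewrite divr_gt0// lt_min c10.
have [N HN] := ex_large_nat c^-1.
exists c => //; exists N => n /HN cn.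
have le ci : Num.min c1 c2 <= ci -> expR (- ci * n%:R) <= expR (- c * n%:R) * expR (- c * n%:R).
  move=> h; rewrite -expRD ler_expR; have : 2 * c * n%:R <= ci * n%:R; last by lra.
  by rewrite ler_wpM2r// /c mulrC divfK.
have m1 : Num.min c1 c2 <= c1 by rewrite ge_min lexx.
have m2 : Num.min c1 c2 <= c2 by rewrite ge_min lexx orbT.
apply: le_trans (lerD (le _ m1) (le _ m2)) _.
have : expR (- c * n%:R) <= 1 / 2; last by have := expR_gt0 (- c * n%:R); nra.
rewrite mulNr expRN div1r lef_pV2 ?posrE ?expR_gt0//.
have := expR_ge1Dx (c * n%:R); suff : 1 <= c * n%:R by lra.
by rewrite -ler_pdivrMl// mulr1.
Qed.

Lemma expRN_sum (cs : seq R) : (forall c, c \in cs -> 0 < c) -> exists2 c, 0 < c &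
  exists N : nat, forall n, (N <= n)%N ->
  \sum_(t <- cs) expR (- t * n%:R) <= expR (- c * n%:R).
Proof.
elim: cs => [_|t cs ih h].
  by exists 1 => //; exists 0%N => n _; rewrite big_nil expR_ge0.
have [|c1 c10 [N1 H1]] := ih; first by move=> x xs; apply: h; rewrite inE xs orbT.
have [c c0 [N H]] := expRN_add2 (h t (mem_head _ _)) c10.
exists c => //; exists (maxn N N1) => n; rewrite geq_max => /andP[nN nN1].
by rewrite big_cons; apply: le_trans (H n nN); rewrite lerD2l H1.
Qed.

Lemma truncn_leq_nat (x : R) n : 0 <= x <= 1 -> (Num.truncn (x * n%:R) <= n)%N.
Proof.
move=> /andP[x0 x1]; rewrite -(ler_nat R); apply: (@le_trans _ _ (x * n%:R)).
  by rewrite truncn_le// mulr_ge0.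
by rewrite ler_piMl.
Qed.

Lemma dotv_net n (a b g : 'rV[R]_n) (eta : R) : nrm2 (a - b) <= eta ->
  dotv b g - eta * nrm2 g <= dotv a g.
Proof.
move=> ab; have -> : dotv a g = dotv b g + dotv (a - b) g by rewrite -dotvDl addrC subrK.
have := cauchy_schwarzN (a - b) g; have := ler_wpM2r (nrm2_ge0 g) ab; lra.
Qed.

End large_n.

Section recovery.
Context {R : realType}.

Theorem sparse_recovery (alpha beta v v' : R) : 0 < alpha <= 1 -> 0 <= beta ->
  0 <= v <= v' -> quad_mean beta v 1 (v' ^+ 2) 1 (- 2 * v') (v' ^+ 2) < alpha ->
  exists2 c : R, 0 < c & exists N : nat, forall n, (N <= n)%N ->
  forall d (T : measurableType d) (P : probability T R)
    (A : T -> 'M[R]_(Num.truncn (alpha * n%:R), n)), iid_std_normal_matrix P A ->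
  forall (S : {set 'I_n}) sigma, #|S| = Num.truncn (beta * n%:R) ->
  ((1 - expR (- c * n%:R))%:E <= P [set w | cone_kernel_trivial S sigma (A w)])%E.
Proof.
move=> /andP[alpha0 alpha1] beta0 vv'; set F := quad_mean _ _ _ _ _ _ _ => Falpha.
have v0 : 0 <= v by case/andP: vv'.
(* The maximum with 0 makes [f1] positive whatever the sign of [F]. *)
pose F' : R := Num.max F 0.
have F'alpha : F' < alpha by rewrite gt_max Falpha.
have FF' : F <= F' by rewrite le_max lexx.
have F'0 : 0 <= F' by rewrite le_max lexx orbT.
(* On the side of [alpha] one [e] pays for the deviation of [|g'|^2] and one for rounding [alpha n]
   down; [F'] also receives [2 e], and a gap of [4 e] remains between [f1] and [a1]. *)
pose e : R := (alpha - F') / 8.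
have e0 : 0 < e by rewrite divr_gt0// subr_gt0.
have eE : alpha = F' + 8 * e by rewrite /e; field.
pose f1 : R := F' + 2 * e; pose a1 : R := alpha - 2 * e.
have f10 : 0 < f1 by rewrite /f1; lra.
have fa1 : f1 < a1 by rewrite /f1 /a1; lra.
have a10 : 0 < a1 by lra.
(* In units of [del = eps sqrt n] the gap is [8 del]: one is lost on the net for [p], two form the
   level, and the smoothing width 1 is at most one more. *)
pose eps : R := (Num.sqrt a1 - Num.sqrt f1) / 8.
have eps0 : 0 < eps by rewrite divr_gt0// subr_gt0 ltr_sqrt.
have sa0 : 0 < Num.sqrt a1 by rewrite sqrtr_gt0.
have sf0 : 0 < Num.sqrt f1 by rewrite sqrtr_gt0.
have epsE : Num.sqrt a1 - Num.sqrt f1 = 8 * eps by rewrite /eps; field.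
pose eta : R := eps / Num.sqrt a1.
have eta0 : 0 < eta by rewrite divr_gt0.
have etaE : eta * Num.sqrt a1 = eps by rewrite divfK// gt_eqF.
have eps20 : 0 < eps ^+ 2 / 2 by rewrite divr_gt0// exprn_gt0.
have [c1 c10 H1] := event_row_Nsqr e0.
have [c2 c20 [N2 H2]] := event_quad 1 (2 * v') (v' ^+ 2) 1 (- 2 * v') (v' ^+ 2) beta0 v0 e0.
have [c3 c30 H3] := event_scalar eps20.
have [c4 c40 H4] := @event_entries R.
have [|c c0 [N0 HN0]] := @expRN_sum R [:: c3; c4; c1; c2].
  by move=> x; rewrite !inE => /or4P[] /eqP ->.
have [N5 H5] := @ex_large_nat R e^-1.
have [N6 H6] := @ex_large_nat R (eps ^+ 2 / 2)^-1.
exists c => //; exists (maxn N0 (maxn N2 (maxn N5 (maxn N6 1)))) => n.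
rewrite !geq_max => /and5P[nN0 nN2 nN5 nN6 n1] d T P A iidA S sigma cardS.
have n0 : 0 < n%:R :> R by rewrite ltr0n.
have en1 : 1 <= e * n%:R by rewrite -ler_pdivrMl// mulr1 H5.
have epsn : 1 <= eps ^+ 2 / 2 * n%:R by rewrite -ler_pdivrMl// mulr1 H6.
pose m := Num.truncn (alpha * n%:R).
have mn : (m <= n)%N by apply: truncn_leq_nat; rewrite ltW.
have mlow : alpha * n%:R - 1 < m%:R.
  by rewrite ltrBlDr natr1; apply: truncnS_gt.
pose sn : R := Num.sqrt n%:R.
have sn0 : 0 < sn by rewrite sqrtr_gt0.
have sn2 : sn ^+ 2 = n%:R by rewrite sqr_sqrtr// ltW.
pose del : R := eps * sn.
have del0 : 0 < del by rewrite mulr_gt0.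
have epsdel : eps ^+ 2 / 2 * n%:R = del ^+ 2 / 2 by rewrite -sn2 /del; ring.
have del2 : 2 <= del ^+ 2 by move: epsn; rewrite epsdel ler_pdivlMr// mul1r.
have del1 : 1 <= del.
  by rewrite -(@ler_pXn2r _ 2)// ?nnegrE ?ler01 ?(ltW del0)// expr1n (le_trans _ del2)// ler1n.
pose Rn : R := Num.sqrt (2 * (m * n) + n)%:R.
have Rn0 : 0 < Rn by rewrite sqrtr_gt0 ltr0n addn_gt0 n1 orbT.
have K1 u : (cone S sigma `&` @usphere R n) u -> nrm2 u <= 1 by move=> [_ ->].
have S1 u : @usphere R m u -> nrm2 u <= 1 by move=> ->.
(* The width is tuned to the Frobenius bound [Rn], so that passing from the net to the cone costs
   [del / 2]. *)
have eK0 : 0 < del / (2 * Rn) by rewrite divr_gt0// mulr_gt0.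
have [NA [qN [qNK qNnet]]] := finite_net eK0 K1.
have [NH [pN [pNS pNnet]]] := finite_net eta0 S1.
(* Blocks are points of the cone: every [q] must find some [p], that is, [|A q|] must be large for
   all [q]. *)
pose p (a : NA * NH) := pN a.2; pose q (a : NA * NH) := qN a.1.
pose BY := [set z : mx_index m n -> R | \sum_i z (row_coord n i) ^+ 2 <= m%:R - e * n%:R] `|`
  [set z : mx_index m n -> R | n%:R * (F + e) <=
     \sum_j col_quad S sigma v 1 (2 * v') (v' ^+ 2) 1 (- 2 * v') (v' ^+ 2) j (z (col_coord m j))].
pose BX := [set z : mx_index m n -> R | 1 + eps ^+ 2 / 2 * n%:R <= z (scalar_coord m n) ^+ 2] `|`
  [set z : mx_index m n -> R | (2 * (m * n) + n)%:R <= \sum_i \sum_j z (entry i j) ^+ 2].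
have sBY := small_eventU (H1 m n mn) (H2 m n nN2 S sigma cardS).
have sBX := small_eventU (H3 m n n1) (H4 m n).
have mE : measurable [set w | cone_kernel_trivial S sigma (A w)].
  by apply: measurable_cone_kernel_trivial; exact: iidA.1.
have core := @random_matrix_core R d T P m n A iidA NA NH p q
  (fun a => pNS a.2) (fun a => (qNK a.1).2)
  (fun a b ab => or_intror (congr1 qN ab)) (2 * del) _ BX BY _ _ mE sBX sBY.
apply: le_trans (core _ _).
- rewrite lee_fin lerB//; apply: le_trans (HN0 n nN0).
  by rewrite !big_cons big_nil addr0 !addrA.
- move=> z /not_orP[/negP zr /negP zc]; rewrite -!ltNge in zr zc.
  set gm := row_part z; set gn := col_part z.
  have gm2 : n%:R * a1 <= nrm2 gm ^+ 2.
    rewrite nrm2_sqr dotv_row_part; apply: le_trans (ltW zr).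
    by rewrite /a1; clear -mlow en1; lra.
  have gmlow : sn * Num.sqrt a1 <= nrm2 gm.
    rewrite -(@ler_pXn2r _ 2)// ?nnegrE ?mulr_ge0 ?nrm2_ge0 ?(ltW sa0) ?(ltW sn0)//.
    by rewrite exprMn sn2 sqr_sqrtr// ltW.
  have gm0 : nrm2 gm != 0.
    by rewrite gt_eqF//; apply: lt_le_trans gmlow; rewrite mulr_gt0.
  have [hN hNP] := pNnet _ (nrm2_unit gm0).
  apply: gordonF_eq1 => cN; exists hN.
  rewrite linI_vec_form /p /q/= -/gm -/gn.
  have := dotv_net gm hNP; rewrite dotvZl -nrm2_sqr expr2 mulKf// => pg.
  have qg : - (sn * Num.sqrt f1) <= dotv (qN cN) gn.
    rewrite lerNl; apply: le_trans (cone_dot_bound gn vv' (qNK cN).1 (qNK cN).2) _.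
    rewrite /sn -sqrtrM ?(ltW n0)//; apply: ler_wsqrtr.
    under eq_bigr do rewrite mxE.
    by apply: le_trans (ltW zc) _; rewrite ler_wpM2l ?(ltW n0)// /f1; clear -FF' e0; lra.
  have eta1 : eta <= 1 by rewrite ler_pdivrMr// mul1r; clear -epsE sf0 eps0; lra.
  have : sn * Num.sqrt a1 * (1 - eta) <= nrm2 gm * (1 - eta).
    by rewrite ler_wpM2r// subr_ge0.
  have -> : sn * Num.sqrt a1 * (1 - eta) = sn * Num.sqrt a1 - del.
    by rewrite /del -etaE; ring.
  have : sn * Num.sqrt a1 - sn * Num.sqrt f1 = 8 * del by rewrite -mulrBr epsE /del; ring.
  clear -pg qg del1; lra.
- move=> w /not_orP[/negP zs /negP ze] gF; rewrite -!ltNge in zs ze.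
  apply/cone_kernel_trivialP; exists (del / 2); first by rewrite divr_gt0.
  move=> h ch nh; have [k hk] := qNnet h (conj ch nh).
  rewrite epsdel in zs; have [l hl] := gordonF_mx_form del0 del2 zs gF k.
  have fA := fnorm_joint ze.
  have qA : del <= nrm2 (qN k *m (A w.1)^T).
    have := cauchy_schwarz (pN l) (qN k *m (A w.1)^T); rewrite (pNS l) mul1r; exact: le_trans.
  have dA : nrm2 ((qN k - h) *m (A w.1)^T) <= del / 2.
    apply: (le_trans (nrm2_mulmx _ _)).
    apply: (@le_trans _ _ (Rn * (del / (2 * Rn)))).
      by apply: ler_pM => //; [exact: sqrtr_ge0|exact: nrm2_ge0].
    have RN : Rn != 0 by rewrite gt_eqF.
    by rewrite le_eqVlt; apply/orP; left; apply/eqP; field.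
  have := nrm2D (h *m (A w.1)^T) ((qN k - h) *m (A w.1)^T).
  rewrite -mulmxDl addrC subrK; clear -qA dA; lra.
Qed.

End recovery.

(** * Failure below the threshold *)

Section trial_vector.
Context {R : realType} (n : nat) (S : {set 'I_n}) (sigma : 'I_n -> bool) (v u : R).
Hypotheses (v0 : 0 <= v) (uv : u <= v).
Variable g : 'rV[R]_n.

(* Up to normalisation, the maximiser of [dotv h g] over the cone when [u] is the
   optimal multiplier; a slightly larger [u] pushes it inside the cone. *)
Definition trial : 'rV[R]_n := \row_j (if j \in S then g 0 j - u * (-1) ^+ sigma j
  else trunc v (g 0 j) * (Num.sg (g 0 j) * (`|g 0 j| - u))).

(** Since [u <= v], the difference [|x| - u] is positive wherever the truncation is active, so it is
    its own modulus in the sums below. *)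
Lemma truncP (x : R) : trunc v x = 0 \/ [/\ trunc v x = 1, u < `|x| & Num.sg x ^+ 2 = 1].
Proof.
rewrite /trunc; case: (boolP (v < `|x|)) => h; [right|by left].
split => //; first exact: le_lt_trans h.
by rewrite sqr_sg -normr_gt0 (le_lt_trans v0 h).
Qed.

Lemma cone_fun_trial : cone_fun S sigma trial =
  \sum_j col_quad S sigma v 0 1 (- u) 0 1 (- u) j (g 0 j).
Proof.
rewrite [RHS](bigID (mem S))/= addrC /cone_fun; congr (_ + _); apply: eq_bigr => j jS.
  rewrite /col_quad (negbTE jS) mxE (negbTE jS) /trunc_quad mul0r add0r mul1r.
  case: (truncP (g 0 j)) => [->|[-> ug sg2]]; first by rewrite !mul0r normr0.
  rewrite !mul1r normrM (ger0_norm (_ : 0 <= `|g 0 j| - u)); last by rewrite subr_ge0 ltW.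
  have : `|Num.sg (g 0 j)| ^+ 2 = 1 ^+ 2 by rewrite real_normK ?num_real// sg2 expr1n.
  by move=> /eqP; rewrite eqrXn2// => /eqP ->; rewrite mul1r.
rewrite /col_quad jS mxE jS /signed_quad mul0r add0r mul1r mulrBr.
by rewrite (mulrCA _ u) -expr2 sqrr_sign mulr1.
Qed.

Lemma dotv_trial : - dotv trial g =
  \sum_j col_quad S sigma v (- 1) u 0 (- 1) u 0 j (g 0 j).
Proof.
rewrite /dotv -sumrN; apply: eq_bigr => j _; rewrite mxE /col_quad.
case: (j \in S); first by rewrite /signed_quad; ring.
rewrite /trunc_quad -(real_normK (num_real (g 0 j))).
set x := g 0 j; have -> : - (trunc v x * (Num.sg x * (`|x| - u)) * x) =
  - (trunc v x * ((`|x| - u) * (Num.sg x * x))) by ring.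
by rewrite -normrEsg; ring.
Qed.

Lemma dotv_trial_trial : dotv trial trial =
  \sum_j col_quad S sigma v 1 (- 2 * u) (u ^+ 2) 1 (- 2 * u) (u ^+ 2) j (g 0 j).
Proof.
rewrite /dotv; apply: eq_bigr => j _; rewrite mxE /col_quad.
case: (j \in S).
  rewrite /signed_quad; have s2 := sqrr_sign R (sigma j).
  set s := (-1) ^+ sigma j in s2 *; set x := g 0 j.
  have -> : (x - u * s) * (x - u * s) = x ^+ 2 - 2 * u * (s * x) + u ^+ 2 * s ^+ 2 by ring.
  by rewrite s2; ring.
rewrite /trunc_quad -[in RHS](real_normK (num_real (g 0 j))).
case: (truncP (g 0 j)) => [->|[-> ug sg2]]; first by ring.
have -> : 1 * (Num.sg (g 0 j) * (`|g 0 j| - u)) * (1 * (Num.sg (g 0 j) * (`|g 0 j| - u))) =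
  Num.sg (g 0 j) ^+ 2 * (`|g 0 j| - u) ^+ 2 by ring.
by rewrite sg2; ring.
Qed.

End trial_vector.

Lemma event_col_sqr {R : realType} : exists2 c : R, 0 < c & forall m n : nat,
  small_event [set z : mx_index m n -> R |
    2 * n%:R <= \sum_j z (col_coord m j) ^+ 2] (expR (- c * n%:R)).
Proof.
have [c c0 H] := event_cols (ltr01 : 0 < 1 :> R) (ltr01 : 0 < 1 :> R).
exists c => // m n.
apply: small_event_sub (H m n (fun _ x => x ^+ 2) n%:R _ _ _).
- by move=> z /= h; apply: le_trans h; lra.
- by move=> ?; exact: measurable_sqr.
- by move=> _; exact: sqr_bound.
- by rewrite Rintegral_gauss_sqr sumr_const card_ord.
Qed.

Section failure.
Context {R : realType}.
Local Notation pdf := (normal_pdf (0 : R) 1).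

(** The hypothesis says that [cone_fun] of the trial vector has mean zero at [u = v']. Raising [u]
    by [tau] puts that mean at [- th * tau], at first-order cost in the inner product and
    second-order cost in the squared norm. *)
Lemma trial_means (beta v v' tau : R) : let th := beta + (1 - beta) * gauss_tail v in
  let F := quad_mean beta v 1 (v' ^+ 2) 1 (- 2 * v') (v' ^+ 2) in let u := v' + tau in
  th * v' = (1 - beta) * (2 * pdf v) ->
  [/\ quad_mean beta v 0 (- u) 0 1 (- u) = - (th * tau),
      quad_mean beta v (- 1) 0 (- 1) u 0 = - (F - th * v' * tau) &
      quad_mean beta v 1 (u ^+ 2) 1 (- 2 * u) (u ^+ 2) = F + th * tau ^+ 2].
Proof.
move=> th F u hth; rewrite /F /u /quad_mean; split.
- have -> : th * tau = th * v' + th * tau - (1 - beta) * (2 * pdf v) by rewrite hth; ring.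
  by rewrite /th; ring.
- have -> : th * v' * tau = (1 - beta) * (2 * pdf v) * tau by rewrite -hth; ring.
  have e : beta * v' ^+ 2 + (1 - beta) * (v' ^+ 2 * gauss_tail v) = (1 - beta) * (2 * pdf v) * v'.
    by rewrite -hth /th; ring.
  have E : beta * (1 + v' ^+ 2) + (1 - beta) * (1 * (2 * v * pdf v + gauss_tail v) + - 2 * v' * (2 * pdf v) + v' ^+ 2 * gauss_tail v)
    = beta + (1 - beta) * (2 * v * pdf v + gauss_tail v) + (1 - beta) * (- 2 * v' * (2 * pdf v)) +
      (beta * v' ^+ 2 + (1 - beta) * (v' ^+ 2 * gauss_tail v)) by ring.
  by rewrite E e; ring.
- have e : th * tau ^+ 2 = th * tau ^+ 2 + 2 * (th * v') * tau - 2 * ((1 - beta) * (2 * pdf v)) * tau.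
    by rewrite hth; ring.
  by rewrite e /th; ring.
Qed.

(** The left side bounds [|g'|] and the right side the product of [g''] with the normalised trial
    vector, both over [sqrt n]. After squaring, [(alpha + kap) (alpha + 5 kap)] falls short of
    [(alpha + 3 kap)^2] by [4 kap^2]. *)
Lemma trial_gap (alpha F kap : R) : 0 < alpha -> 0 < kap -> F = alpha + 4 * kap ->
  Num.sqrt (alpha + kap) < (F - kap) / Num.sqrt (F + kap).
Proof.
move=> a0 k0 kapE.
have p1 : 0 < alpha + kap by lra.
have p2 : 0 < F + kap by lra.
rewrite ltr_pdivlMr ?sqrtr_gt0// -sqrtrM ?(ltW p1)//.
have p3 : 0 <= F - kap by lra.
rewrite -[ltRHS]ger0_norm// -sqrtr_sqr ltr_sqrt; last by rewrite exprn_gt0//; lra.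
by rewrite kapE; nra.
Qed.

Lemma nrm2_subC n (a b : 'rV[R]_n) : nrm2 (a - b) = nrm2 (b - a).
Proof. by rewrite -opprB -scaleN1r nrm2Z normrN1 mul1r. Qed.

Theorem sparse_failure (alpha beta v v' : R) : 0 < alpha <= 1 -> 0 < beta <= 1 ->
  0 <= v -> v' < v ->
  (beta + (1 - beta) * gauss_tail v) * v' = (1 - beta) * (2 * pdf v) ->
  0 <= gauss_tail v ->
  alpha < quad_mean beta v 1 (v' ^+ 2) 1 (- 2 * v') (v' ^+ 2) ->
  exists2 c : R, 0 < c & exists N : nat, forall n, (N <= n)%N ->
  forall d (T : measurableType d) (P : probability T R)
    (A : T -> 'M[R]_(Num.truncn (alpha * n%:R), n)), iid_std_normal_matrix P A ->
  forall (S : {set 'I_n}) sigma, #|S| = Num.truncn (beta * n%:R) ->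
  ((1 - expR (- c * n%:R))%:E <= P [set w | ~ cone_kernel_trivial S sigma (A w)])%E.
Proof.
move=> /andP[alpha0 alpha1] /andP[beta0 beta1] v0 v'v hth tail0.
have means := fun tau => @trial_means beta v v' tau hth.
move: hth means; set th := beta + _ => hth; cbv zeta.
set F := quad_mean _ _ 1 (v' ^+ 2) _ _ _ => means alphaF.
have th0 : 0 < th by rewrite ltr_wpDr// mulr_ge0// subr_ge0.
have v'0 : 0 <= v'.
  by rewrite -(pmulr_rge0 _ th0) hth !mulr_ge0 ?subr_ge0 ?normal_pdf_ge0.
have F0 : 0 < F by exact: lt_trans alphaF.
pose kap := (F - alpha) / 4.
have kap0 : 0 < kap by rewrite divr_gt0// subr_gt0.
have kapE : F = alpha + 4 * kap by rewrite /kap; field.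
have fk0 : 0 < F - kap by lra.
have sfk0 : 0 < Num.sqrt (F + kap) by rewrite sqrtr_gt0; lra.
have gap := trial_gap alpha0 kap0 kapE.
pose L := 2 * (th * (v' + 1)).
have L0 : 0 < L by rewrite !mulr_gt0// ltr_wpDl.
(* The bounds keep [u] at most [v], make [tau^2 <= tau], and limit each loss in [trial_means] to
   [kap / 2]. *)
pose tau := Num.min (Num.min (v - v') 1) (kap / L).
have tau0 : 0 < tau by rewrite !lt_min subr_gt0 v'v ltr01 divr_gt0.
have tau1 : tau <= 1 by rewrite !ge_min lexx orbT.
have tauv : v' + tau <= v by rewrite addrC -lerBrDr !ge_min lexx.
have tauk : th * (v' + 1) * tau <= kap / 2.
  have h : tau <= kap / L by rewrite ge_min lexx orbT.
  rewrite ler_pdivlMr// in h; rewrite ler_pdivlMr//; apply: le_trans h.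
  by rewrite /L; lra.
have tvt0 : 0 <= th * v' * tau by rewrite !mulr_ge0// ltW.
have tt0 : 0 <= th * tau by rewrite mulr_ge0// ltW.
have ttt : th * tau ^+ 2 <= th * tau.
  by rewrite expr2 mulrA ler_piMr.
have k1 : th * v' * tau <= kap / 2 by lra.
have k2 : th * tau ^+ 2 <= kap / 2 by lra.
(* The second bound keeps the trial vector in the cone: a fluctuation of [e] cannot exceed the
   margin [th * tau]. *)
pose e := Num.min (kap / 2) (th * tau).
have e0 : 0 < e by rewrite lt_min divr_gt0// mulr_gt0.
have ek : e <= kap / 2 by rewrite ge_min lexx.
have et : e <= th * tau by rewrite ge_min lexx orbT.
pose u := v' + tau.
have [m1 m2 m3] := means tau; rewrite -/u in m1 m2 m3.
pose r := (F - kap) / Num.sqrt (F + kap); pose sa := Num.sqrt (alpha + kap).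
rewrite -/sa -/r in gap.
pose eps := (r - sa) / 8.
have eps0 : 0 < eps by rewrite divr_gt0// subr_gt0.
have epsE : r - sa = 8 * eps by rewrite /eps; field.
(* The net error for [h] is multiplied by [|g''| <= 2 sqrt n], hence costs at most [del]. *)
pose eta := eps / 2.
have eta0 : 0 < eta by rewrite divr_gt0.
have eps20 : 0 < eps ^+ 2 / 2 by rewrite divr_gt0// exprn_gt0.
have [c1 c10 H1] := event_row_sqr e0.
have [c2 c20 [N2 H2]] := event_quad 0 1 (- u) 0 1 (- u) (ltW beta0) v0 e0.
have [c5 c50 [N5 H5]] := event_quad (- 1) u 0 (- 1) u 0 (ltW beta0) v0 e0.
have [c6 c60 [N6 H6]] := event_quad 1 (- 2 * u) (u ^+ 2) 1 (- 2 * u) (u ^+ 2) (ltW beta0) v0 e0.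
have [c7 c70 H7] := @event_col_sqr R.
have [c3 c30 H3] := event_scalar eps20.
have [c4 c40 H4] := @event_entries R.
have [|c c0 [N0 HN0]] := @expRN_sum R [:: c3; c4; c1; c2; c5; c6; c7].
  by move=> x; rewrite !inE => /orP[/eqP ->//|/orP[/eqP ->//|/orP[/eqP ->//|/or4P[] /eqP ->]]].
have [N8 H8] := @ex_large_nat R beta^-1.
have [N9 H9] := @ex_large_nat R (eps ^+ 2 / 2)^-1.
exists c => //; exists (maxn N0 (maxn N2 (maxn N5 (maxn N6 (maxn N8 (maxn N9 1)))))) => n.
rewrite !geq_max => /and5P[nN0 nN2 nN5 nN6 /and3P[nN8 nN9 n1]] d T P A iidA S sigma cardS.
have n0 : 0 < n%:R :> R by rewrite ltr0n.
have bn1 : 1 <= beta * n%:R by rewrite -ler_pdivrMl// mulr1 H8.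
have epsn : 1 <= eps ^+ 2 / 2 * n%:R by rewrite -ler_pdivrMl// mulr1 H9.
(* [cone_kernel_nontrivial] builds its boundary direction from an element of [S], which exists once
   [beta n >= 1]. *)
have [i0 i0S] : exists i0, i0 \in S.
  apply/card_gt0P; rewrite cardS lt0n; apply/negP => /eqP k0.
  by have := truncnS_gt (beta * n%:R); rewrite k0; clear -bn1; lra.
pose m := Num.truncn (alpha * n%:R).
have mn : (m <= n)%N by apply: truncn_leq_nat; rewrite ltW.
have mup : m%:R <= alpha * n%:R by rewrite truncn_le// mulr_ge0// ltW.
pose sn : R := Num.sqrt n%:R.
have sn0 : 0 < sn by rewrite sqrtr_gt0.
have sn2 : sn ^+ 2 = n%:R by rewrite sqr_sqrtr// ltW.
pose del : R := eps * sn.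
have del0 : 0 < del by rewrite mulr_gt0.
have epsdel : eps ^+ 2 / 2 * n%:R = del ^+ 2 / 2 by rewrite -sn2 /del; ring.
have del2 : 2 <= del ^+ 2 by move: epsn; rewrite epsdel ler_pdivlMr// mul1r.
have del1 : 1 <= del.
  by rewrite -(@ler_pXn2r _ 2)// ?nnegrE ?ler01 ?(ltW del0)// expr1n (le_trans _ del2)// ler1n.
pose Rn : R := Num.sqrt (2 * (m * n) + n)%:R.
have Rn0 : 0 < Rn by rewrite sqrtr_gt0 ltr0n addn_gt0 n1 orbT.
have K1 x : (cone S sigma `&` @usphere R n) x -> nrm2 x <= 1 by move=> [_ ->].
have S1 x : @usphere R m x -> nrm2 x <= 1 by move=> ->.
have eS0 : 0 < del / (2 * Rn) by rewrite divr_gt0// mulr_gt0.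
have [NA [pN [pNS pNnet]]] := finite_net eS0 S1.
have [NH [qN [qNK qNnet]]] := finite_net eta0 K1.
(* Now blocks are points of the sphere: every [p] must find some [q] in the cone. *)
pose p (a : NA * NH) := pN a.1; pose q (a : NA * NH) := qN a.2.
have sBY := small_eventU (H1 m n mn) (small_eventU (H2 m n nN2 S sigma cardS)
  (small_eventU (H5 m n nN5 S sigma cardS) (small_eventU (H6 m n nN6 S sigma cardS) (H7 m n)))).
have sBX := small_eventU (H3 m n n1) (H4 m n).
have mE : measurable [set w | ~ cone_kernel_trivial S sigma (A w)].
  rewrite (_ : [set _ | _] = ~` [set w | cone_kernel_trivial S sigma (A w)])//.
  by apply: measurableC; apply: measurable_cone_kernel_trivial; exact: iidA.1.
have core := @random_matrix_core R d T P m n A iidA NA NH p q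
  (fun a => pNS a.1) (fun a => (qNK a.2).2)
  (fun a b ab => or_introl (congr1 pN ab)) (2 * del) _ _ _ _ _ mE sBX sBY.
apply: le_trans (core _ _).
- rewrite lee_fin lerB//; apply: le_trans (HN0 n nN0).
  by rewrite !big_cons big_nil addr0 !addrA.
- move=> z /not_orP[/negP z1 /not_orP[/negP z2 /not_orP[/negP z5 /not_orP[/negP z6 /negP z7]]]].
  rewrite -!ltNge in z1 z2 z5 z6 z7.
  rewrite m1 in z2; rewrite m2 in z5; rewrite m3 in z6.
  set gm := row_part z; set gn := col_part z.
  pose h := trial S sigma v u gn.
  have colE a b c' a' b' c'' : \sum_j col_quad S sigma v a b c' a' b' c'' j (z (col_coord m j)) =
      \sum_j col_quad S sigma v a b c' a' b' c'' j (gn 0 j).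
    by apply: eq_bigr => j _; rewrite mxE.
  rewrite colE -cone_fun_trial// in z2.
  rewrite colE -dotv_trial in z5; rewrite colE -(dotv_trial_trial _ _ v0 tauv) in z6.
  rewrite -/h in z2 z5 z6.
  have ch : cone S sigma h.
    apply/ltW; apply: lt_le_trans z2 _; rewrite pmulr_rle0//; clear -et; lra.
  have hg : n%:R * (F - kap) <= dotv h gn.
    have : n%:R * (F - kap) <= n%:R * (F - th * v' * tau - e) by rewrite ler_pM2l//; clear -k1 ek; lra.
    clear -z5; lra.
  have hh : nrm2 h <= sn * Num.sqrt (F + kap).
    rewrite -sqrtrM ?(ltW n0)//; apply: ler_wsqrtr; apply: le_trans (ltW z6) _.
    by rewrite ler_pM2l//; clear -k2 ek; lra.
  have hg0 : 0 < dotv h gn by apply: lt_le_trans hg; rewrite mulr_gt0.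
  have h0 : nrm2 h != 0.
    by apply/eqP => /nrm2_eq0 h0; move: hg0; rewrite h0 -(scale0r (0 : 'rV[R]_n)) dotvZl mul0r ltxx.
  have hp0 : 0 < nrm2 h by rewrite lt_def h0 nrm2_ge0.
  pose hu := (nrm2 h)^-1 *: h.
  have Khu : (cone S sigma `&` @usphere R n) hu.
    by split; [apply: coneZ; rewrite ?invr_ge0 ?nrm2_ge0|exact: nrm2_unit].
  have [hN hNP] := qNnet _ Khu.
  have hug : sn * r <= dotv hu gn.
    rewrite dotvZl [leRHS]mulrC ler_pdivlMr//.
    apply: le_trans hg; rewrite -sn2 /r.
    have e1 : sn * ((F - kap) / Num.sqrt (F + kap)) * nrm2 h <=
        sn * ((F - kap) / Num.sqrt (F + kap)) * (sn * Num.sqrt (F + kap)).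
      by rewrite ler_wpM2l// mulr_ge0 ?(ltW sn0)// divr_ge0// ltW.
    apply: (le_trans e1); rewrite le_eqVlt; apply/orP; left; apply/eqP.
    by field; rewrite gt_eqF.
  have gn2 : nrm2 gn <= 2 * sn.
    rewrite -(@ler_pXn2r _ 2)// ?nnegrE ?nrm2_ge0 ?mulr_ge0 ?(ltW sn0)//.
    rewrite exprMn sn2 nrm2_sqr.
    have -> : dotv gn gn = \sum_j z (col_coord m j) ^+ 2.
      by apply: eq_bigr => j _; rewrite !mxE expr2.
    by apply: le_trans (ltW z7) _; clear -n0; lra.
  have gmup : nrm2 gm <= sn * sa.
    rewrite /sn /sa -sqrtrM ?(ltW n0)//; apply: ler_wsqrtr; rewrite dotv_row_part.
    apply: le_trans (ltW z1) _; have : n%:R * e <= n%:R * (kap / 2) by rewrite ler_pM2l.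
    have : 0 <= n%:R * kap by rewrite mulr_ge0// ltW.
    clear -mup; lra.
  apply: gordonF_eq1 => cN; exists hN.
  rewrite linI_vec_form /p /q/= -/gm -/gn.
  have qg := dotv_net gn hNP.
  have : eta * nrm2 gn <= del.
    apply: (@le_trans _ _ (eta * (2 * sn))); first by rewrite ler_pM2l.
    by rewrite /del /eta mulrA divfK.
  have := cauchy_schwarzN (pN cN) gm; rewrite (pNS cN) mul1r.
  have : sn * r - sn * sa = 8 * del by rewrite -mulrBr epsE /del; ring.
  clear -qg hug gmup del1; lra.
- move=> w /not_orP[/negP zs /negP ze] gF; rewrite -!ltNge in zs ze.
  apply: (@cone_kernel_nontrivial R n S sigma m (A w.1) (del / 2) i0) => //.
    by rewrite divr_gt0.
  move=> b nb; have [k hk] := pNnet b nb.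
  rewrite epsdel in zs; have [l hl] := gordonF_mx_form del0 del2 zs gF k.
  have fA := fnorm_joint ze.
  exists (qN l); split; [exact: (qNK l).1|exact: (qNK l).2|].
  rewrite nrm2_subC in hk; have := dotv_net (qN l *m (A w.1)^T) hk.
  have : del / (2 * Rn) * nrm2 (qN l *m (A w.1)^T) <= del / 2.
    apply: (@le_trans _ _ (del / (2 * Rn) * Rn)).
      rewrite ler_pM2l//; apply: le_trans (nrm2_mulmx _ _) _.
      by rewrite (qNK l).2 mulr1.
    have RN : Rn != 0 by rewrite gt_eqF.
    by rewrite le_eqVlt; apply/orP; left; apply/eqP; field.
  clear -hl; lra.
Qed.

End failure.

(** * The threshold *)

Section thresholds.
Context {R : realType}.
Local Notation pdf := (normal_pdf (0 : R) 1).

(** The balance turns the cross term [- 4 (1 - beta) v' pdf v] into [- 2 th v'^2], which half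
    cancels against the square term. *)
Lemma quad_mean_balanced (beta v v' : R) : let th := beta + (1 - beta) * gauss_tail v in
  th * v' = (1 - beta) * (2 * pdf v) ->
  quad_mean beta v 1 (v' ^+ 2) 1 (- 2 * v') (v' ^+ 2) =
  th + 2 * (1 - beta) * (v * pdf v) - th * v' ^+ 2.
Proof.
move=> th hth; rewrite /quad_mean.
have -> : th * v' ^+ 2 = 2 * ((1 - beta) * (2 * pdf v)) * v' - th * v' ^+ 2 by rewrite -hth; ring.
by rewrite /th; ring.
Qed.

Variables beta th : R.
Hypotheses (beta01 : 0 < beta < 1) (thI : beta < th <= 1).
Local Notation x := ((1 - th) / (1 - beta)).
Local Notation E := (erfinv x).

Definition cutoff : R := Num.sqrt 2 * E.
(** With the cutoff fixed, [quad_mean] is quadratic in [v'] with leading coefficient [th]; this is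
    its minimiser, by [multiplier_eq]. *)
Definition multiplier : R := (1 - beta) * (Num.sqrt (2 / pi) * expR (- E ^+ 2) / th).

Let b1 : 0 < 1 - beta. Proof. by case/andP: beta01 => _ ?; rewrite subr_gt0. Qed.
Let th0 : 0 < th. Proof. by case/andP: beta01 => b0 _; case/andP: thI => + _; exact: lt_trans. Qed.

Lemma ratio_itv : 0 <= x < 1.
Proof.
case/andP: thI => bth th1; apply/andP; split; last by rewrite ltr_pdivrMr// mul1r ltrD2l ltrN2.
by apply: divr_ge0 (ltW b1); rewrite subr_ge0.
Qed.

Lemma erfinv_ratio_ge0 : 0 <= E.
Proof. exact: erfinv_ge0 ratio_itv. Qed.

Lemma cutoff_ge0 : 0 <= cutoff.
Proof. by rewrite mulr_ge0 ?sqrtr_ge0 ?erfinv_ratio_ge0. Qed.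

Lemma sqrt_sqr_cutoff : Num.sqrt (2 * E ^+ 2) = cutoff.
Proof. by rewrite sqrtrM// sqrtr_sqr ger0_norm// erfinv_ratio_ge0. Qed.

Lemma gauss_tail_cutoff : gauss_tail cutoff = 1 - x.
Proof.
have s2 : Num.sqrt 2 != 0 :> R by rewrite gt_eqF// sqrtr_gt0.
rewrite /gauss_tail (_ : cutoff / Num.sqrt 2 = E); last by rewrite mulrC mulKf.
by rewrite erfinvK// ratio_itv.
Qed.

Lemma theta_cutoff : beta + (1 - beta) * gauss_tail cutoff = th.
Proof. by rewrite gauss_tail_cutoff; field; rewrite gt_eqF. Qed.

Lemma pdf_cutoff : pdf cutoff = expR (- E ^+ 2) / Num.sqrt (2 * pi).
Proof.
rewrite gauss_pdfE mulrC; congr (expR _ / _).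
by rewrite /cutoff exprMn sqr_sqrtr//; field.
Qed.

Lemma sqrt_2_over_pi : Num.sqrt (2 / pi) = 2 / Num.sqrt (2 * pi) :> R.
Proof.
have p0 : 0 < pi :> R by exact: pi_gt0.
have s0 : 0 < Num.sqrt (2 * pi) :> R by rewrite sqrtr_gt0 mulr_gt0.
have pN0 : pi != 0 :> R by rewrite gt_eqF.
have sN0 : Num.sqrt (2 * pi) != 0 :> R by rewrite gt_eqF.
apply: (mulIf sN0).
rewrite divfK ?gt_eqF// -sqrtrM ?divr_ge0 ?(ltW p0)//.
have e : 2 / pi * (2 * pi) = 2 ^+ 2 :> R by rewrite mulrACA mulVf// mulr1 expr2.
rewrite e.
by rewrite sqrtr_sqr ger0_norm.
Qed.

Lemma multiplier_eq : th * multiplier = (1 - beta) * (2 * pdf cutoff).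
Proof.
by rewrite /multiplier pdf_cutoff sqrt_2_over_pi; field; rewrite !gt_eqF ?sqrtr_gt0 ?mulr_gt0 ?pi_gt0.
Qed.

Lemma multiplier_gt0 : 0 < multiplier.
Proof.
have p0 : 0 < pi :> R by exact: pi_gt0.
by rewrite mulr_gt0// divr_gt0// mulr_gt0 ?expR_gt0// sqrtr_gt0 divr_gt0.
Qed.

Definition threshold : R :=
  quad_mean beta cutoff 1 (multiplier ^+ 2) 1 (- 2 * multiplier) (multiplier ^+ 2).

Lemma thresholdE : threshold =
  th + 2 * (1 - beta) / Num.sqrt (2 * pi) * (Num.sqrt (2 * E ^+ 2) / expR (E ^+ 2))
  - ((1 - beta) * Num.sqrt (2 / pi) * expR (- E ^+ 2)) ^+ 2 / th.
Proof.
have := @quad_mean_balanced beta cutoff multiplier; cbv zeta; rewrite theta_cutoff.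
move=> /(_ multiplier_eq); rewrite -/threshold => ->.
have -> : th * multiplier ^+ 2 = ((1 - beta) * Num.sqrt (2 / pi) * expR (- E ^+ 2)) ^+ 2 / th.
  by rewrite /multiplier; field; rewrite gt_eqF.
congr (_ + _ - _); rewrite sqrt_sqr_cutoff pdf_cutoff expRN.
by field; rewrite !gt_eqF ?sqrtr_gt0 ?mulr_gt0 ?pi_gt0 ?expR_gt0.
Qed.

(** Monotonicity of [erfinv] gives [cutoff <= sqrt 2 * erfinv ((1 + e) x)], and the equation
    identifies the latter with [(1 - e) * multiplier]. *)
Lemma cutoff_le_multiplier (e : R) : 0 < e -> -1 < (1 + e) * x < 1 ->
  (1 - e) * (1 - beta) * (Num.sqrt (2 / pi) * expR (- E ^+ 2) / th)
    - Num.sqrt 2 * erfinv ((1 + e) * x) = 0 ->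
  cutoff <= multiplier.
Proof.
move=> e0 /andP[_ ex1] eq0; have /andP[x0 x1] := ratio_itv.
have xe : x <= (1 + e) * x by rewrite ler_peMl//; lra.
have h : cutoff <= Num.sqrt 2 * erfinv ((1 + e) * x).
  by rewrite ler_wpM2l ?sqrtr_ge0// erfinv_le.
have : (1 - e) * multiplier = Num.sqrt 2 * erfinv ((1 + e) * x).
  by rewrite /multiplier mulrA; exact: subr0_eq eq0.
have := multiplier_gt0; nra.
Qed.

Lemma multiplier_lt_cutoff (e : R) : 0 < e -> -1 < (1 - e) * x < 1 ->
  (1 + e) * (1 - beta) * (Num.sqrt (2 / pi) * expR (- E ^+ 2) / th)
    - Num.sqrt 2 * erfinv ((1 - e) * x) = 0 ->
  multiplier < cutoff.
Proof.
move=> e0 /andP[_ ex1] eq0; have /andP[x0 x1] := ratio_itv.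
have E1 : (1 + e) * multiplier = Num.sqrt 2 * erfinv ((1 - e) * x).
  by rewrite /multiplier [LHS]mulrA; exact: subr0_eq eq0.
have m0 := multiplier_gt0.
(* For [e > 1] the argument could be negative; then [erfinv] would be at most 0, against the
   positivity of the multiplier. *)
have ex0 : 0 <= (1 - e) * x.
  rewrite leNgt; apply/negP => /erfinv_neg h.
  have : Num.sqrt 2 * erfinv ((1 - e) * x) <= 0 by rewrite mulr_ge0_le0// sqrtr_ge0.
  by rewrite -E1; nra.
have xe : (1 - e) * x <= x by rewrite ler_piMl//; lra.
have h : Num.sqrt 2 * erfinv ((1 - e) * x) <= cutoff.
  by rewrite ler_wpM2l ?sqrtr_ge0// erfinv_le.
nra.
Qed.

End thresholds.

Theorem theorem3 (R : realType) (alpha beta : R)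
  (e1c e2c e1m e1g e3g : R)
  (d : measure_display) (T : measurableType d) (P : probability T R)
  (A : forall n : nat, T -> 'M[R]_(Num.truncn (alpha * n%:R), n)) :
  0 < alpha < 1 -> 0 < beta < 1 ->
  0 < e1c -> 0 < e2c -> 0 < e1m -> 0 < e1g -> 0 < e3g ->
  (forall n, iid_std_normal_matrix P (A n)) ->
  (* part (1) *)
  (forall th : R,
     beta < th <= 1 ->
     -1 < (1 + e1c) * ((1 - th) / (1 - beta)) < 1 ->
     (1 - e1c) * (1 - beta) *
        (Num.sqrt (2 / pi) * expR (- erfinv ((1 - th) / (1 - beta)) ^+ 2) / th)
       - Num.sqrt 2 * erfinv ((1 + e1c) * ((1 - th) / (1 - beta))) = 0 ->
     let E := erfinv ((1 - th) / (1 - beta)) in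
     alpha >
       (1 - beta) / Num.sqrt (2 * pi) *
         (Num.sqrt (2 * pi) + 2 * (Num.sqrt (2 * E ^+ 2) / expR (E ^+ 2))
          - Num.sqrt (2 * pi) * ((1 - th) / (1 - beta)))
       + beta
       - ((1 - beta) * Num.sqrt (2 / pi) * expR (- E ^+ 2)) ^+ 2 / th ->
     exists c : R, 0 < c /\ exists N : nat, forall n : nat, (N <= n)%N ->
       forall (S : {set 'I_n}) (sigma : 'I_n -> bool),
         #|S| = Num.truncn (beta * n%:R) ->
         (P [set w | forall x : 'cV[R]_n, sparse_with_signs S sigma x ->
                       l1_unique_solution (A n w) (A n w *m x) x]
          >= (1 - expR (- c * n%:R))%:E)%E) /\
  (* part (2) *)
  (forall th : R,
     beta < th <= 1 ->
     -1 < (1 - e2c) * ((1 - th) / (1 - beta)) < 1 ->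
     (1 + e2c) * (1 - beta) *
        (Num.sqrt (2 / pi) * expR (- erfinv ((1 - th) / (1 - beta)) ^+ 2) / th)
       - Num.sqrt 2 * erfinv ((1 - e2c) * ((1 - th) / (1 - beta))) = 0 ->
     let E := erfinv ((1 - th) / (1 - beta)) in
     alpha <
       ((1 - e1g) * (th + 2 * (1 - beta) / Num.sqrt (2 * pi) *
                         (Num.sqrt (2 * E ^+ 2) / expR (E ^+ 2)))
        - (1 + e3g) ^+ 2 *
            (((1 - beta) * Num.sqrt (2 / pi) * expR (- E ^+ 2)) ^+ 2 / th))
       / (1 + e1m) ^+ 2 ->
     exists c : R, 0 < c /\ exists N : nat, forall n : nat, (N <= n)%N ->
       forall (S : {set 'I_n}) (sigma : 'I_n -> bool),
         #|S| = Num.truncn (beta * n%:R) ->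
         (P [set w | exists x : 'cV[R]_n, sparse_with_signs S sigma x /\
                       ~ l1_unique_solution (A n w) (A n w *m x) x]
          >= (1 - expR (- c * n%:R))%:E)%E).
Proof.
move=> /andP[alpha0 alpha1] beta01 e1c0 e2c0 e1m0 e1g0 e3g0 iidA.
have alphaI : 0 < alpha <= 1 by rewrite alpha0 ltW.
have /andP[beta0 beta1] := beta01.
have b1 : 0 < 1 - beta by rewrite subr_gt0.
have spi0 : 0 < Num.sqrt (2 * pi) :> R by rewrite sqrtr_gt0 mulr_gt0 ?pi_gt0.
split=> th thI ratioI eq0 E alphaE.
- have cm := cutoff_le_multiplier beta01 thI e1c0 ratioI eq0.
  (* The assumed bound equals the threshold once [th] is rewritten as
     [beta + (1 - beta) * (1 - x)]. *)
  have tha : threshold beta th < alpha.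
    rewrite (thresholdE beta01 thI); apply: le_lt_trans alphaE.
    rewrite le_eqVlt; apply/orP; left; apply/eqP; rewrite -/E.
    congr (_ - _); rewrite -[in LHS](theta_cutoff beta01 thI) (gauss_tail_cutoff beta01 thI).
    by field; rewrite !gt_eqF// expR_gt0.
  have [|c c0 [N HN]] := sparse_recovery alphaI (ltW beta0) _ tha.
    by rewrite cutoff_ge0.
  exists c; split => //; exists N => n nN S sigma cardS.
  rewrite (_ : [set _ | _] = [set w | cone_kernel_trivial S sigma (A n w)]); first exact: HN.
  by apply/seteqP; split => w /sparse_success_iff.
- have cm := multiplier_lt_cutoff beta01 thI e2c0 ratioI eq0.
  have th0 : 0 < th by case/andP: thI => + _; exact: lt_trans.
  have tha : alpha < threshold beta th.
    rewrite (thresholdE beta01 thI) -/E.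
    (* As [U], [W] and [alpha] are nonnegative, each slack constant only strengthens the assumption,
       and [alpha < U - W] remains. *)
    set U := th + _ in alphaE *; set W := _ ^+ 2 / th in alphaE *.
    have W0 : 0 <= W by rewrite divr_ge0 ?sqr_ge0// ltW.
    have U0 : 0 <= U.
      by rewrite addr_ge0 ?(ltW th0)// mulr_ge0// divr_ge0 ?mulr_ge0 ?sqrtr_ge0 ?expR_ge0// ltW.
    have m0 : 0 < (1 + e1m) ^+ 2 by rewrite exprn_gt0//; lra.
    rewrite ltr_pdivlMr// in alphaE.
    have : alpha <= alpha * (1 + e1m) ^+ 2 by rewrite ler_peMr ?(ltW alpha0)//; nra.
    have : W <= (1 + e3g) ^+ 2 * W by rewrite ler_peMl//; nra.
    have : (1 - e1g) * U <= U by rewrite ler_piMl//; lra.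
    lra.
  have [||||c c0 [N HN]] := @sparse_failure R alpha beta (cutoff beta th) (multiplier beta th) alphaI _ _ cm _ _ tha.
  + by rewrite beta0 ltW.
  + exact: cutoff_ge0.
  + by rewrite theta_cutoff// multiplier_eq.
  + by rewrite gauss_tail_cutoff// subr_ge0; case/andP: (ratio_itv beta01 thI) => _ /ltW.
  exists c; split => //; exists N => n nN S sigma cardS.
  rewrite (_ : [set _ | _] = [set w | ~ cone_kernel_trivial S sigma (A n w)]); first exact: HN.
  apply/seteqP; split => w /=.
    by move=> [x [sx nx]] /sparse_success_iff h; apply: nx; exact: h.
  move=> h; apply: contrapT => /forallNP hx; apply: h; apply/sparse_success_iff => x sx.
  by apply: contrapT => nx; apply: (hx x).
Qed.
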